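(* Let $(X,\mu)$ be a standard probability space and let $\mathcal{S}\leq \mathcal{R}$ be discrete, measure-preserving equivalence relations on $(X,\mu)$. If the inclusion $\mathcal{S}\leq \mathcal{R}$ is everywhere coamenable and $\mathcal{R}$ is strongly ergodic, then $\mathcal{S}$ has countable ergodic decomposition and each ergodic component of $\mathcal{S}$ is strongly ergodic.
   Context: An equivalence relation over a standard probability space $(X,\mu)$ is a Borel subset $\mathcal{R}\subseteq X\times X$ that is an equivalence relation on $X$; $[x]_{\mathcal{R}}$ denotes the class of $x$. It is discrete if $[x]_{\mathcal{R}}$ is countable for almost every $x$. For discrete $\mathcal{R}$ set $\mu_{\mathcal{R}}(E)=\int_X |\{y:(x,y)\in E\}|\,d\mu(x)$ for Borel $E\subseteq\mathcal{R}$ (and its completion); $\mathcal{R}$ is measure-preserving if $(x,y)\mapsto(y,x)$ preserves $\mu_{\mathcal{R}}$. $\mathcal{S}\leq\mathcal{R}$ means $\mathcal{S}\subseteq\mathcal{R}$, both relations over the same $(X,\mu)$. For $E\subseteq X$ with $\mu(E)>0$, $\mathcal{R}|_E=\mathcal{R}\cap(E\times E)$, a measure-preserving relation over the probability space $(E,\mu(E\cap\cdot)/\mu(E))$. The full group $[\mathcal{R}]$ is the group of bimeasurable bijections $\gamma:X\to X$ with $\gamma(x)\in[x]_{\mathcal{R}}$ for almost every $x$, modulo almost everywhere equality. A measurable $E$ is $\mathcal{R}$-invariant if $\mu(\gamma E\Delta E)=0$ for all $\gamma\in[\mathcal{R}]$; $\mathcal{R}$ is ergodic if every invariant measurable set has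 measure $0$ or $1$. $\mathcal{R}$ is strongly ergodic if whenever $(E_n)_n$ is a sequence of measurable subsets of $X$ with $\mu(\gamma E_n\Delta E_n)\to 0$ for all $\gamma\in[\mathcal{R}]$, then $\mu(E_n)(1-\mu(E_n))\to 0$. $\mathcal{R}$ has countable ergodic decomposition if there are a countable set $I$ and a partition (modulo null sets) $(E_i)_{i\in I}$ of $X$ into positive measure, $\mathcal{R}$-invariant sets such that each $\mathcal{R}|_{E_i}$ is ergodic; the $\mathcal{R}|_{E_i}$ are the ergodic components of $\mathcal{R}$. Coamenability: for $\mathcal{S}\leq\mathcal{R}$ and $x\in X$ let $[x]_{\mathcal{R}}/\mathcal{S}$ be the set of $\mathcal{S}$-classes contained in $[x]_{\mathcal{R}}$. A family $\xi=(\xi_x)_{x\in X}$ with $\xi_x\in\ell^2([x]_{\mathcal{R}}/\mathcal{S})$ is measurable if $x\mapsto \xi_x([\gamma(x)]_{\mathcal{S}})$ is measurable for all $\gamma\in[\mathcal{R}]$. The inclusion $\mathcal{S}\leq\mathcal{R}$ is coamenable if there is a sequence of measurable families $\xi^{(n)}$ with $\|\xi^{(n)}_x\|_2=1$ for almost every $x$ and $\lim_{n}\|\xi^{(n)}_x-\xi^{(n)}_y\|_2=0$ for almost every $(x,y)\in\mathcal{R}$. This is equivalent to the inclusion of von Neumann algebras $L(\mathcal{S})\subseteq L(\mathcal{R})$ being relatively amenable (coamenable) in the sense of Popa. The inclusion $\mathcal{S}\leq\mathcal{R}$ is everywhere coamenable if $\mathcal{S}|_E\leq\mathcal{R}|_E$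 is coamenable for every measurable $E\subseteq X$ with $\mu(E)>0$. *)

(* Defs.v *)
From HB Require Import structures.
From mathcomp Require Import all_boot all_order all_algebra.
From mathcomp Require Import all_classical all_reals all_analysis.
From mathcomp.real_closed Require Import complex.

Set Implicit Arguments.
Unset Strict Implicit.
Unset Printing Implicit Defensive.

Import Order.TTheory GRing.Theory Num.Theory.
Import numFieldNormedType.Exports.

Local Open Scope classical_set_scope.
Local Open Scope ring_scope.

Definition polish_space (R : realType) (Y : metricType R) : Prop :=
  (forall F : set_system Y, ProperFilter F -> cauchy F -> exists y : Y, F --> y)
  /\ (exists2 A : set Y, countable A & dense A).

(* A standard Borel space: up to an isomorphism f of measurable spaces, a
   Polish space with its Borel sigma-algebra. *)
Definition standard_borel (R : realType) d (T : measurableType d) : Prop :=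
  exists (Y : metricType R) (f : T -> Y),
    [/\ polish_space Y, bijective f &
        forall B : set Y,
          <<s [set U : set Y | open U] >> B <-> measurable (f @^-1` B)].

(* All notions below are relative to a probability space (D, mu) carried by a
   measurable subset D of T: mu : set T -> \bar R is a probability measure on T
   with mu D = 1, and only subsets of D matter. The whole space is D = setT. The
   subspace (E, mu(E `&` _) / mu E) is given by E and normalized_restr mu E, and
   the relation rel|_E by restr_rel rel E. Functions and relations are total on
   T, their values outside of D being irrelevant. *)

Definition normalized_restr (R : realType) d (T : measurableType d)
  (mu : set T -> \bar R) (E : set T) : set T -> \bar R :=
  fun A => (mu (E `&` A) / mu E)%E.

Definition restr_rel (T : Type) (rel : set (T * T)) (E : set T) : set (T * T) :=
  rel `&` (E `*` E).

(* The class of x is the section [xsection rel x] = {y | (x, y) in rel}. *)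
Definition borel_equivalence d (T : measurableType d) (D : set T)
  (rel : set (T * T)) : Prop :=
  [/\ measurable rel, rel `<=` D `*` D,
      (forall x, D x -> rel (x, x)),
      (forall x y, rel (x, y) -> rel (y, x)) &
      (forall x y z, rel (x, y) -> rel (y, z) -> rel (x, z))].

Definition discrete_rel (R : realType) d (T : measurableType d) (D : set T)
  (mu : set T -> \bar R) (rel : set (T * T)) : Prop :=
  {ae mu, forall x, D x -> countable (xsection rel x)}.

(* The measure on rel integrating the number of points of the fibres of E, as a
   set function on T * T concentrated on rel. *)
Definition rel_measure (R : realType) d (T : measurableType d) (D : set T)
  (mu : set T -> \bar R) (rel : set (T * T)) : set (T * T) -> \bar R :=
  fun E => (\int[mu]_(x in D) counting (xsection (E `&` rel) x))%E.

Definition measure_preserving_rel (R : realType) d (T : measurableType d)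
  (D : set T) (mu : set T -> \bar R) (rel : set (T * T)) : Prop :=
  forall E : set (T * T), measurable E -> E `<=` rel ->
    rel_measure D mu rel ((fun p => (p.2, p.1)) @^-1` E)
    = rel_measure D mu rel E.

Definition discrete_pmp_equivalence (R : realType) d (T : measurableType d)
  (D : set T) (mu : set T -> \bar R) (rel : set (T * T)) : Prop :=
  [/\ borel_equivalence D rel, discrete_rel D mu rel &
      measure_preserving_rel D mu rel].

(* Representatives of the elements of the full group; every use of them below
   is insensitive to changes on a null set. *)
Definition full_group (R : realType) d (T : measurableType d) (D : set T)
  (mu : set T -> \bar R) (rel : set (T * T)) : set (T -> T) :=
  [set g | [/\ set_bij D D g, measurable_fun D g,
               (forall A, measurable A -> A `<=` D -> measurable (g @` A)) &
               {ae mu, forall x, D x -> rel (x, g x)}]].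

Definition invariant_set (R : realType) d (T : measurableType d) (D : set T)
  (mu : set T -> \bar R) (rel : set (T * T)) (E : set T) : Prop :=
  [/\ measurable E, E `<=` D &
      forall g, full_group D mu rel g -> mu ((g @` E) `+` E) = 0%E].

Definition ergodic (R : realType) d (T : measurableType d) (D : set T)
  (mu : set T -> \bar R) (rel : set (T * T)) : Prop :=
  forall E, invariant_set D mu rel E -> mu E = 0%E \/ mu E = 1%E.

Definition strongly_ergodic (R : realType) d (T : measurableType d) (D : set T)
  (mu : set T -> \bar R) (rel : set (T * T)) : Prop :=
  forall E : nat -> set T,
    (forall n, measurable (E n) /\ E n `<=` D) ->
    (forall g, full_group D mu rel g ->
       (fun n => mu ((g @` E n) `+` E n)) @ \oo --> 0%E) ->
    (fun n => (mu (E n) * (1 - mu (E n)))%E) @ \oo --> 0%E.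

Definition ergodic_decomposition (R : realType) d (T : measurableType d)
  (D : set T) (mu : set T -> \bar R) (rel : set (T * T))
  (I : set nat) (E : nat -> set T) : Prop :=
  [/\ (forall i, I i -> invariant_set D mu rel (E i)),
      (forall i, I i -> (0 < mu (E i))%E),
      (forall i j, I i -> I j -> i <> j -> mu (E i `&` E j) = 0%E),
      mu (D `\` \bigcup_(i in I) E i) = 0%E &
      (forall i, I i ->
         ergodic (E i) (normalized_restr mu (E i)) (restr_rel rel (E i)))].

Definition countable_ergodic_decomposition (R : realType) d
  (T : measurableType d) (D : set T) (mu : set T -> \bar R)
  (rel : set (T * T)) : Prop :=
  exists (I : set nat) (E : nat -> set T), ergodic_decomposition D mu rel I E.

(* F carries an ergodic component restr_rel rel F of rel: it is a piece of some
   countable ergodic decomposition. *)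
Definition ergodic_component (R : realType) d (T : measurableType d)
  (D : set T) (mu : set T -> \bar R) (rel : set (T * T)) (F : set T) : Prop :=
  exists (I : set nat) (E : nat -> set T),
    ergodic_decomposition D mu rel I E /\ exists2 i, I i & F = E i.

Definition quotient_classes (T : Type) (D : set T) (rel sub : set (T * T))
  (x : T) : set (set T) :=
  [set C | (exists2 y, D y & C = xsection sub y) /\ C `<=` xsection rel x].

Definition l2norm (R : realType) (I : choiceType) (Q : set I) (f : I -> R[i])
  : \bar R :=
  sqrte (\esum_(c in Q) (Normc.normc (f c) ^+ 2)%:E).

(* Measurability with respect to the completion of mu, as is needed for
   functions that are only defined almost everywhere. *)
Definition ae_measurable (R : realType) d (T : measurableType d) (D : set T)
  (mu : set T -> \bar R) (f : T -> R) : Prop :=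
  exists2 h : T -> R, measurable_fun D h & {ae mu, forall x, D x -> f x = h x}.

(* xi x : set T -> R[i] stands for its restriction to the quotient
   [x]_rel / sub. *)
Definition measurable_family (R : realType) d (T : measurableType d)
  (D : set T) (mu : set T -> \bar R) (rel sub : set (T * T))
  (xi : T -> set T -> R[i]) : Prop :=
  (forall x, D x -> (l2norm (quotient_classes D rel sub x) (xi x) < +oo)%E) /\
  (forall g, full_group D mu rel g ->
     ae_measurable D mu (fun x => complex.Re (xi x (xsection sub (g x)))) /\
     ae_measurable D mu (fun x => complex.Im (xi x (xsection sub (g x))))).

Definition coamenable (R : realType) d (T : measurableType d) (D : set T)
  (mu : set T -> \bar R) (sub rel : set (T * T)) : Prop :=
  exists xi : nat -> T -> set T -> R[i],
    [/\ forall n, measurable_family D mu rel sub (xi n),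
        forall n, {ae mu, forall x, D x ->
          l2norm (quotient_classes D rel sub x) (xi n x) = 1%E} &
        {ae rel_measure D mu rel, forall p, rel p ->
          (fun n => l2norm (quotient_classes D rel sub p.1)
                      (fun c => xi n p.1 c - xi n p.2 c)) @ \oo --> 0%E}].

Definition everywhere_coamenable (R : realType) d (T : measurableType d)
  (D : set T) (mu : set T -> \bar R) (sub rel : set (T * T)) : Prop :=
  forall E, measurable E -> E `<=` D -> (0 < mu E)%E ->
    coamenable E (normalized_restr mu E) (restr_rel sub E) (restr_rel rel E).

(* Main.v *)
From HB Require Import structures.
From mathcomp Require Import all_boot all_order all_algebra.
From mathcomp Require finmap.
From mathcomp Require Import all_classical all_reals all_analysis.
From mathcomp Require Import measurable_realfun.
From mathcomp Require Import ring lra zify.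
From mathcomp.real_closed Require Import complex.
Require Import Defs.

(** Feldman-Moore provides measure-preserving involutions generating the relations ([feldman_moore]), so that invariance,
    asymptotic invariance and strong ergodicity become statements on the boundaries of sets: the points that a generator
    moves across the set. Write R for the large relation, S for the subrelation and E for a set of positive measure.

    The heart of the proof is [strongly_ergodic_no_fine]: if S|E is coamenable in R|E and R|E is strongly ergodic, then E
    has no finite measurable partitions that are asymptotically S-invariant and have atoms of vanishing measure. The
    squared moduli of the coamenability vectors are probability measures on the S-classes inside the R-class of x, and
    they vary little along R. A partition of the kind excluded is almost constant on S-classes, so it pushes these
    measures to distributions pi_x on its labels; they still vary little along R, but each label z has positive
    probability only on a small set of points x. The level sets of the functions x |-> pi_x (z), over all z and all
    levels, cover E once on average and have a small total boundary, as in the coarea formula. A greedy union of level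
    sets whose boundary is at most proportional to the measure that they add stops between one third and one half of E,
    with small boundary ([greedy_union], [round_distribution], [small_perimeter_set]). This contradicts the strong
    ergodicity of R|E, which is inherited from R ([gens_strongly_ergodic_restr]).

    Both ways in which the theorem could fail produce such partitions. If a maximal disjoint sequence of ergodic
    S-invariant sets does not exhaust the space, then every invariant subset of the remainder splits further, and the
    remainder is cut into invariant sets as small as one likes ([diffuse_fine]). If S|E is ergodic and has asymptotically
    invariant sets A_n of measure bounded away from 0 and from that of E, then the limit along an ultrafilter of the
    measures of C inter A_n is an invariant measure dominated by mu, so by Hahn decomposition and ergodicity it is at
    least a positive multiple of mu. Hence A_n and its complement meet every C in a proportion bounded below
    ([ratio_lower]), and cutting repeatedly by sets A_n yields fine almost invariant partitions ([iterated_split_fine]).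

    Feldman-Moore itself rests on the enumeration of the sections of a measurable set with countable sections by
    measurable functions. It is needed only up to null sets, which allows a direct proof with Souslin schemes:
    measurable projection ([souslin_proj]) and the construction, over a point where the enumeration fails, of an element
    of the section outside of any given list ([small_souslin_of]). *)

Set Implicit Arguments.
Unset Strict Implicit.
Unset Printing Implicit Defensive.

Import Order.TTheory GRing.Theory Num.Theory.
Import numFieldNormedType.Exports.

Local Open Scope classical_set_scope.
Local Open Scope ring_scope.

(** * Combinatorial bases of Polish spaces *)

(** Closed balls around a dense sequence, described without a metric: b n k is the ball of radius
    1 / (n + 1) around the k-th point, and cv is convergence of sequences. A sequence that for each n stays eventually in
    one ball of level n is Cauchy, whence pb_complete; pb_open says that complements of balls are F-sigma. *)
Record polish_base (d : measure_display) (T : measurableType d)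
    (cv : (nat -> T) -> T -> Prop) (b : nat -> nat -> set T) : Prop :=
  PolishBase {
  pb_uniq : forall t a a', cv t a -> cv t a' -> a = a' ;
  pb_meas : forall n k, measurable (b n k) ;
  pb_closed : forall n k t a, (exists N, forall i, (N <= i)%N -> b n k (t i)) ->
    cv t a -> b n k a ;
  pb_cover : forall n x, exists k, b n k x ;
  pb_complete : forall (s : nat -> nat) t,
    (forall n, exists N, forall i, (N <= i)%N -> b n (s n) (t i)) ->
    exists a, cv t a ;
  pb_sep : forall a a', a <> a' ->
    exists n k k', [/\ b n k a, b n k' a' & b n k `&` b n k' = set0] ;
  pb_gen : forall B, measurable B ->
    <<s [set C | exists n k, C = b n k] >> B ;
  pb_open : forall n k, exists C : nat -> set T,
    [/\ forall j, measurable (C j),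
        forall j t a, (exists N, forall i, (N <= i)%N -> C j (t i)) ->
          cv t a -> C j a &
        ~` b n k = \bigcup_j C j] }.

Lemma standard_polish_base (R : realType) (d : measure_display)
  (T : measurableType d) (t0 : T) : standard_borel R T ->
  exists cv b, @polish_base d T cv b.
Proof.
move=> [Y [f [[Ycomp [A Acount Adense]] [fi fK fiK] fmeas]]].
have [a0 Aa0] : A !=set0.
  have := Adense setT (ex_intro _ (f t0) Logic.I) openT.
  by rewrite setTI.
have [a ha] : exists a : nat -> Y, forall y, A y -> exists k, a k = y.
  have [g /= ginj] := countable_injP _ Acount.
  exists (fun k => xget a0 [set y | A y /\ g y = k]) => y Ay.
  exists (g y); case: xgetP => [z -> [Az gz]|/(_ y)]; last by case.
  by apply: ginj => //; rewrite inE.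
have cl y (r : R) : closed [set z | mdist z y <= r].
  rewrite -openC; have -> : ~` [set z | mdist z y <= r] = [set z | r < mdist z y].
    by apply/seteqP; split=> z /=; [move/negP; rewrite -ltNge | rewrite ltNge => /negP].
  rewrite openE => z /= rz; rewrite /interior nbhs_ballP.
  exists (mdist z y - r); first by rewrite /= subr_gt0.
  move=> w; rewrite ballEmdist /= => zw.
  have := metric_triangle z w y; lra.
have cl' y (r : R) : closed [set z | r <= mdist z y].
  rewrite -openC; have -> : ~` [set z | r <= mdist z y] = [set z | mdist z y < r].
    by apply/seteqP; split=> z /=; [move/negP; rewrite -ltNge | rewrite ltNge => /negP].
  rewrite openE => z /= rz; rewrite /interior nbhs_ballP.
  exists (r - mdist z y); first by rewrite /= subr_gt0.
  move=> w; rewrite ballEmdist /= => zw.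
  have := metric_triangle w z y; rewrite (metric_sym w z); lra.
have mclosed C : closed C -> measurable (f @^-1` C).
  move=> clC; apply/fmeas; rewrite -[X in _ X]setCK; rewrite -setTD.
  have [_ + _] := @smallest_sigma_algebra _ (@setT Y) open.
  by apply; apply: sub_sigma_algebra; rewrite /= openC.
have mcl y (r : R) : measurable (f @^-1` [set z | mdist z y <= r]).
  by apply: mclosed; exact: cl.
pose e n : R := (n.+1%:R)^-1.
have e0 n : 0 < e n by rewrite invr_gt0 ltr0n.
have eN (r : R) : 0 < r -> exists n, e n < r.
  move=> r0; exists (Num.truncn r^-1); rewrite /e invf_plt ?posrE ?ltr0n//.
  exact: truncnS_gt.
pose b n k := f @^-1` [set z | mdist z (a k) <= e n].
pose cv (t : nat -> T) (x : T) := forall r : R, 0 < r -> exists N, forall i,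
  (N <= i)%N -> mdist (f (t i)) (f x) < r.
have approx y (r : R) : 0 < r -> exists k, mdist y (a k) < r.
  move=> r0.
  have [|z [/interior_subset yz /ha[k zk]]] := Adense (ball y r)^° _ (@open_interior _ _).
    by exists y; exact: nbhsx_ballx.
  by exists k; rewrite zk; move: yz; rewrite ballEmdist.
exists cv, b; split.
- move=> t x y tx ty; apply: (can_inj fK); apply: mdist_positivity.
  apply/eqP; rewrite eq_le mdist_ge0 andbT leNgt; apply/negP => xy.
  have [|N1 h1] := tx (mdist (f x) (f y) / 2); first by rewrite divr_gt0.
  have [|N2 h2] := ty (mdist (f x) (f y) / 2); first by rewrite divr_gt0.
  have := h1 (maxn N1 N2) (leq_maxl _ _); have := h2 (maxn N1 N2) (leq_maxr _ _).
  have := metric_triangle (f x) (f (t (maxn N1 N2))) (f y).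
  rewrite (metric_sym (f x) (f (t _))); lra.
- by move=> n k; exact: mcl.
- move=> n k t x [N hN] tx; rewrite /b /=; apply/ler_addgt0Pl => r r0.
  have [M hM] := tx r r0.
  have := hN (maxn N M) (leq_maxl _ _); have := hM (maxn N M) (leq_maxr _ _).
  rewrite /b /=; have := metric_triangle (f x) (f (t (maxn N M))) (a k).
  rewrite (metric_sym (f x) (f (t _))); lra.
- by move=> n x; have [k /ltW hk] := approx (f x) (e n) (e0 n); exists k.
- move=> s t st.
  have [y ty] : exists y : Y, (fun n => f (t n)) @ \oo --> y.
    have PF : ProperFilter ((fun n => f (t n)) @ \oo) by typeclasses eauto.
    have /Ycomp : cauchy ((fun n => f (t n)) @ \oo); last by case=> [y ty]; exists y.
    apply: cauchy_exP => r r0.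
    have [n nr] := eN r r0; have [N hN] := st n.
    exists (a (s n)); exists N => // i /= Ni; rewrite ballEmdist /= metric_sym.
    by apply: le_lt_trans nr; exact: hN.
  exists (fi y) => r r0.
  have /= [N _ hN] := ty _ (nbhsx_ballx y r r0).
  exists N => i Ni; have := hN i Ni; rewrite fiK ballEmdist /= /comp.
  by rewrite metric_sym.
- move=> x y xy.
  have r0 : 0 < mdist (f x) (f y) by rewrite mdist_gt0; apply/eqP => /(can_inj fK).
  have [n nr] := eN (mdist (f x) (f y) / 4) (divr_gt0 r0 (ltr0n _ 4)).
  have [k xk] := approx (f x) (e n) (e0 n).
  have [k' yk] := approx (f y) (e n) (e0 n).
  exists n, k, k'; split; [exact: ltW|exact: ltW|].
  rewrite -subset0 => z [/= zk zk'].
  have := metric_triangle (f x) (a k) (f y).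
  have := metric_triangle (a k) (f z) (f y).
  have := metric_triangle (f z) (a k') (f y).
  move: zk zk' xk yk nr; rewrite (metric_sym (a k') (f y)) (metric_sym (a k) (f z)) /b /=; lra.
- move=> B mB.
  have {1}-> : B = f @^-1` (fi @^-1` B).
    by apply/seteqP; split => x /=; rewrite fK.
  have /fmeas : measurable (f @^-1` (fi @^-1` B)).
    by rewrite -comp_preimage (_ : fi \o f = id) //; apply/funext => x /=.
  move: (fi @^-1` B) => {mB}B; move: B.
  pose G := <<s [set C | exists n k, C = b n k] >>.
  have sG : sigma_algebra setT G by exact: smallest_sigma_algebra.
  pose G' := image_set_system setT f G.
  have sG' : sigma_algebra setT G' by exact: sigma_algebra_image.
  suff sub : <<s [set U : set Y | open U] >> `<=` G'.
    by move=> B /sub; rewrite /G' /image_set_system /= setTI.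
  apply: smallest_sub => // U oU; rewrite /G' /image_set_system /= setTI.
  have [_ _ Gcup] := sG.
  have -> : f @^-1` U = \bigcup_n \bigcup_k
      [set x | b n k x /\ b n k `<=` f @^-1` U].
    apply/seteqP; split => [x Ux|x [n _ [k _] [+ +]]]; last by move=> bx /(_ _ bx).
    have /nbhs_ballP[r /= r0 rU] : nbhs (f x) U by exact: open_nbhs_nbhs.
    have [n nr] := eN (r / 2) (divr_gt0 r0 (ltr0n _ 2)).
    have [k xk] := approx (f x) (e n) (e0 n).
    exists n => //; exists k => //; split; first exact: ltW.
    move=> z /= zk; apply: rU; rewrite ballEmdist /=.
    have := metric_triangle (f x) (a k) (f z); rewrite (metric_sym (a k) (f z)).
    move: zk; rewrite /b /=; lra.
  apply: (Gcup) => n; apply: (Gcup) => k.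
  have [sub|nsub] := pselect (b n k `<=` f @^-1` U).
    rewrite (_ : [set x | _] = b n k).
      by apply: sub_sigma_algebra; exists n, k.
    by apply/seteqP; split => x //= [].
  rewrite (_ : [set x | _] = set0); first by case: sG.
  by rewrite -subset0 => x [].
- move=> n k; exists (fun j => f @^-1` [set z | e n + e j <= mdist z (a k)]); split.
  + by move=> j; apply: mclosed; exact: cl'.
  + move=> j t x [N hN] tx; rewrite /=; apply/ler_addgt0Pl => r r0.
    have [M hM] := tx r r0.
    have := hN (maxn N M) (leq_maxl _ _); have := hM (maxn N M) (leq_maxr _ _).
    rewrite /=; have := metric_triangle (f (t (maxn N M))) (f x) (a k); lra.
  + apply/seteqP; split => [x /= /negP|x [j _ /=]].
      rewrite -ltNge -subr_gt0 => /eN[j /ltW hj]; exists j => //=.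
      by move: hj; lra.
    by rewrite /b /= => h1 h2; have := e0 j; move: h1 h2; lra.
Qed.

(** * Souslin sets *)

Section souslin.
Context (dX : measure_display) (X : measurableType dX).
Context (d : measure_display) (T : measurableType d).
Context (cv : (nat -> T) -> T -> Prop) (b : nat -> nat -> set T).
Hypothesis pb : polish_base cv b.

(** A Souslin scheme on X * T: for a branch s the conditions P j s (on x) and Q j s (on y) are decided by finitely many
    values of s, and a sequence that satisfies eventually every Q j s converges to a point that satisfies all of them.
    The last clause replaces compactness in the proof of measurable projection. *)
Definition souslin_scheme (P : nat -> (nat -> nat) -> set X)
    (Q : nat -> (nat -> nat) -> set T) : Prop :=
  [/\ forall j s, measurable (P j s),
      forall j s, exists D, forall s', (forall i, (i < D)%N -> s' i = s i) ->
        P j s' = P j s /\ Q j s' = Q j s &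
      forall s t, (forall j, exists N, forall i, (N <= i)%N -> Q j s (t i)) ->
        exists a, cv t a /\ forall j, Q j s a].

Definition souslin_of (P : nat -> (nat -> nat) -> set X)
    (Q : nat -> (nat -> nat) -> set T) : set (X * T) :=
  [set p | exists s, forall j, P j s p.1 /\ Q j s p.2].

Definition souslin (W : set (X * T)) : Prop :=
  exists P Q, souslin_scheme P Q /\ W = souslin_of P Q.

Definition seqclosed (C : set T) := forall t a,
  (exists N, forall i, (N <= i)%N -> C (t i)) -> cv t a -> C a.

(** The branch s tells in which ball of each level y lies. *)
Lemma souslin_rect A C : measurable A -> seqclosed C -> souslin (A `*` C).
Proof.
move=> mA cC; exists (fun _ _ => A), (fun j s => b j (s j) `&` C); split.
  split => //.
  - by move=> j s; exists j.+1 => s' -> //.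
  - move=> s t ht.
    have [n|a ta] := pb_complete pb (s := s) (t := t).
      by have [N hN] := ht n; exists N => i /hN[].
    exists a; split => // j; split.
      by apply: (pb_closed pb _ ta); have [N hN] := ht j; exists N => i /hN[].
    by apply: (cC _ _ _ ta); have [N hN] := ht 0%N; exists N => i /hN[].
apply/seteqP; split => [[x y] [/= Ax Cy]|[x y] [s hs] /=].
  have /choice[s hs] := fun j => pb_cover pb j y.
  by exists s.
by split; [have [] := hs 0%N|have [_ []] := hs 0%N].
Qed.

(** The first value of a branch chooses the member of the union. *)
Lemma souslin_bigcup (W : nat -> set (X * T)) :
  (forall k, souslin (W k)) -> souslin (\bigcup_k W k).
Proof.
move=> /choice[P /choice[Q h]].
exists (fun j s => P (s 0%N) j (s \o S)), (fun j s => Q (s 0%N) j (s \o S)); split.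
  split.
  - by move=> j s; have [[+ _ _] _] := h (s 0%N); apply.
  - move=> j s; have [[_ + _] _] := h (s 0%N).
    move=> /(_ j (s \o S))[D hD]; exists D.+1 => s' hs'.
    by rewrite hs' //; apply: hD => i iD /=; rewrite hs'.
  - by move=> s t ht; have [[_ _ +] _] := h (s 0%N); apply.
apply/seteqP; split => [p [k _ Wp]|p [s hs]].
  have [_ Wk] := h k; move: Wp; rewrite Wk => -[s hs].
  by exists (fun i => if i is i'.+1 then s i' else k) => j; exact: hs.
exists (s 0%N) => //; have [_ ->] := h (s 0%N).
by exists (s \o S) => j; exact: hs.
Qed.

(** A branch encodes one branch for each member, by the pairing of indices. All members see the same sequence in T, so
    uniqueness of limits gives a common limit point. *)
Lemma souslin_bigcap (W : nat -> set (X * T)) :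
  (forall k, souslin (W k)) -> souslin (\bigcap_k W k).
Proof.
move=> /choice[P /choice[Q h]].
pose sub (s : nat -> nat) (k i : nat) := s (pickle (k, i)).
exists (fun j s => if unpickle j is Some (k, n) then P k n (sub s k) else setT),
  (fun j s => if unpickle j is Some (k, n) then Q k n (sub s k) else setT); split.
  split.
  - move=> j s; case: (unpickle j) => [[k n]|]; last exact: measurableT.
    by have [[+ _ _] _] := h k; apply.
  - move=> j s; case: (unpickle j) => [[k n]|]; last by exists 0%N.
    have [[_ + _] _] := h k; move=> /(_ n (sub s k))[D hD].
    exists (\max_(i < D) (pickle (k, i : nat)).+1)%N => s' hs'.
    apply: hD => i iD; apply: hs'.
    exact: (leq_bigmax (Ordinal iD)).
  - move=> s t ht.
    have hk k : exists a, cv t a /\ forall n, Q k n (sub s k) a.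
      have [[_ _ +] _] := h k; apply => n.
      by have := ht (pickle (k, n)); rewrite pickleK.
    have [a [ta _]] := hk 0%N; exists a; split => // j.
    case: (unpickle j) => [[k n]|//].
    by have [a' [ta' ha']] := hk k; rewrite (pb_uniq pb ta ta').
apply/seteqP; split => [p Wp|p [s hs] k _].
  have /choice[s hs] : forall k, exists s, forall j, P k j s p.1 /\ Q k j s p.2.
    by move=> k; have := Wp k Logic.I; have [_ {1}->] := h k.
  exists (fun i => if unpickle i is Some (k, n) then s k n else 0%N) => j.
  have E k : sub (fun i => if unpickle i is Some (k, n) then s k n else 0%N) k = s k.
    by apply/funext => i; rewrite /sub pickleK.
  by case: (unpickle j) => [[k n]|//]; rewrite E; exact: hs.
have [_ ->] := h k; exists (sub s k) => j.
by have := hs (pickle (k, j)); rewrite pickleK.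
Qed.

Lemma souslinI W1 W2 : souslin W1 -> souslin W2 -> souslin (W1 `&` W2).
Proof.
move=> h1 h2; rewrite (_ : _ `&` _ = \bigcap_k (if k is 0%N then W1 else W2)).
  by apply: souslin_bigcap => -[].
apply/seteqP; split => [p [w1 w2] [|k] _ //|p h].
by split; [exact: (h 0%N)|exact: (h 1%N)].
Qed.

(** The sets that are Souslin together with their complement form a sigma-algebra containing the rectangles. *)
Lemma souslin_measurable (W : set (X * T)) : measurable W -> souslin W.
Proof.
pose bi (W : set (X * T)) := souslin W /\ souslin (~` W).
have sc0 : souslin set0.
  rewrite -(set0X (@setT T)); apply: souslin_rect => //.
have scT : souslin setT.
  rewrite -setXTT; apply: souslin_rect => //.
have bi_sigma : sigma_algebra setT bi.
  split.
  - by split => //; rewrite setC0.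
  - by move=> A [h1 h2]; rewrite setTD; split => //; rewrite setCK.
  - move=> A hA; split; first by apply: souslin_bigcup => k; case: (hA k).
    by rewrite setC_bigcup; apply: souslin_bigcap => k; case: (hA k).
suff : measurable `<=` bi by move=> sub /sub[].
rewrite /measurable /=; apply: smallest_sub => // _ [[A mA <-]|[B mB <-]].
  rewrite setTI (_ : fst @^-1` A = A `*` setT).
    split; first exact: souslin_rect.
    rewrite (_ : ~` _ = (~` A) `*` setT).
      by apply: souslin_rect => //; exact: measurableC.
    by apply/seteqP; split => p /=; [move=> h; split=> // ?; apply: h|move=> [h _] [/h]].
  by apply/seteqP; split => p //= [].
rewrite setTI (_ : snd @^-1` B = setT `*` B); last first.
  by apply/seteqP; split => p //= [].
have := pb_gen pb mB; move: {mB}B.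
pose bi' (B : set T) := bi (setT `*` B).
have bi'_sigma : sigma_algebra setT bi'.
  have [c1 c2 c3] := bi_sigma.
  split.
  - by rewrite /bi' setX0; exact: c1.
  - move=> A /c2; rewrite /bi' !setTD (_ : ~` _ = setT `*` (~` A)) //.
    by apply/seteqP; split => p /=; [move=> h; split=> // ?; apply: h|move=> [_ h] [_ /h]].
  - by move=> A /c3; rewrite /bi' setX_bigcupr.
apply: smallest_sub => // _ [n [k ->]]; rewrite /bi'; split.
  by apply: souslin_rect => // t a; exact: (pb_closed pb).
have [C [mC cC bC]] := pb_open pb n k.
rewrite (_ : ~` _ = setT `*` (~` (b n k))).
  rewrite bC setX_bigcupr; apply: souslin_bigcup => j.
  by apply: souslin_rect => // t a; exact: cC.
by apply/seteqP; split => p /=; [move=> h; split=> // ?; apply: h|move=> [_ h] [_ /h]].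
Qed.

End souslin.

(** * Real-valued probabilities *)

Section real_measure.
Context (R : realType) (d : measure_display) (T : measurableType d).
Variable mu : probability T R.

Definition pr (A : set T) : R := fine (mu A).

Lemma prE A : measurable A -> mu A = (pr A)%:E.
Proof. by move=> mA; rewrite /pr fineK // fin_num_measure. Qed.

Lemma pr_ge0 A : 0 <= pr A.
Proof. by rewrite /pr fine_ge0. Qed.

Lemma pr0 : pr set0 = 0.
Proof. by rewrite /pr measure0. Qed.

Lemma prT : pr setT = 1.
Proof. by rewrite /pr probability_setT. Qed.

Lemma le_pr A B : measurable A -> measurable B -> A `<=` B -> pr A <= pr B.
Proof.
move=> mA mB AB; rewrite -lee_fin -!prE //.
by apply: le_measure; rewrite ?inE.
Qed.

Lemma pr_le1 A : measurable A -> pr A <= 1.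
Proof. by move=> mA; rewrite -prT; exact: le_pr. Qed.

Lemma pr_setU A B : measurable A -> measurable B -> A `&` B = set0 ->
  pr (A `|` B) = pr A + pr B.
Proof.
move=> mA mB AB; apply: EFin_inj; rewrite EFinD -!prE //; last exact: measurableU.
by rewrite measureU.
Qed.

Lemma pr_setID A B : measurable A -> measurable B ->
  pr A = pr (A `&` B) + pr (A `\` B).
Proof.
move=> mA mB; rewrite -pr_setU; first by rewrite setUIDK.
- exact: measurableI.
- exact: measurableD.
- by rewrite -subset0 => x [[_ +] []].
Qed.

Lemma pr_setU_le A B : measurable A -> measurable B ->
  pr (A `|` B) <= pr A + pr B.
Proof.
move=> mA mB; have mU := measurableU _ _ mA mB.
rewrite (pr_setID mU mA) lerD //.
  by apply: le_pr; [exact: measurableI|exact: mA|move=> x []].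
by apply: le_pr; [exact: measurableD|exact: mB|move=> x [[//|//]]].
Qed.

Lemma pr_setD A B : measurable A -> measurable B -> B `<=` A ->
  pr (A `\` B) = pr A - pr B.
Proof.
move=> mA mB BA; rewrite (pr_setID mA mB) setIC.
by move/setIidl : BA => ->; lra.
Qed.

Lemma pr_eq0 A : measurable A -> pr A = 0 -> mu A = 0%E.
Proof. by move=> mA h; rewrite prE // h. Qed.

Lemma pr_null A : mu A = 0%E -> pr A = 0.
Proof. by rewrite /pr => ->. Qed.

Lemma pr_sub0 A B : measurable A -> measurable B -> A `<=` B -> pr B = 0 -> pr A = 0.
Proof.
by move=> mA mB /(le_pr mA mB) h B0; apply/eqP; rewrite eq_le pr_ge0 -B0 h.
Qed.

Lemma pr_bigcup0 (A : nat -> set T) : (forall n, measurable (A n)) ->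
  (forall n, pr (A n) = 0) -> pr (\bigcup_n A n) = 0.
Proof.
move=> mA A0; apply: pr_null.
have /negligibleP : mu.-negligible (\bigcup_n A n).
  apply: negligible_bigcup => n; exists (A n); split => //.
  by apply: pr_eq0.
by apply; exact: bigcup_measurable.
Qed.

Lemma pr_cvg_bigcup (A : nat -> set T) : (forall n, measurable (A n)) ->
  (forall n, A n `<=` A n.+1) -> forall e, 0 < e ->
  exists N, forall n, (N <= n)%N -> pr ((\bigcup_k A k) `\` A n) < e.
Proof.
move=> mA iA e e0.
have mU : measurable (\bigcup_k A k) by exact: bigcup_measurable.
have nd : nondecreasing_seq A.
  by apply/nondecreasing_seqP => n; apply/subsetPset; exact: iA.
have : mu \o A @ \oo --> mu (\bigcup_k A k) := nondecreasing_cvg_mu mA mU nd.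
rewrite (prE mU) => /fine_cvgP[_ /cvgrPdist_lt /(_ e e0)[N _ hN]].
exists N => n Nn; have := hN n Nn; rewrite /= -/(pr (A n)).
have sub : A n `<=` \bigcup_k A k by move=> x Ax; exists n.
by rewrite pr_setD //; apply: le_lt_trans; exact: ler_norm.
Qed.

Lemma pr_cvg_bigcap0 (A : nat -> set T) : (forall n, measurable (A n)) ->
  (forall n, A n.+1 `<=` A n) -> pr (\bigcap_k A k) = 0 -> forall e, 0 < e ->
  exists N, forall n, (N <= n)%N -> pr (A n) < e.
Proof.
move=> mA iA A0 e e0.
have mC n : measurable (~` A n) by exact: measurableC.
have [|N hN] := pr_cvg_bigcup mC _ e0.
  by move=> n; apply: subsetC; exact: iA.
exists N => n /hN; apply: le_lt_trans.
have mcap : measurable (\bigcap_k A k) by exact: bigcap_measurable.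
rewrite (pr_setID (mA n) mcap) (@pr_sub0 (A n `&` _) (\bigcap_k A k)) //.
- rewrite add0r; apply: le_pr.
  + exact: measurableD.
  + by apply: measurableD => //; exact: bigcup_measurable.
  + move=> x [Ax nx]; split; last by rewrite /= => /(_ Ax).
    by rewrite -setC_bigcap.
- exact: measurableI.
Qed.

Lemma pr_null_cover (I : countType) (A : I -> set T) :
  (forall i, measurable (A i)) -> (forall i, pr (A i) = 0) ->
  exists N, [/\ measurable N, pr N = 0 & forall i, A i `<=` N].
Proof.
move=> mA A0.
pose B n := if unpickle n is Some i then A i else set0.
exists (\bigcup_n B n); split.
- by apply: bigcup_measurable => n _; rewrite /B; case: (unpickle n).
- apply: pr_bigcup0 => n; rewrite /B; case: (unpickle n) => //; exact: pr0.
- by move=> i x Ax; exists (pickle i) => //; rewrite /B pickleK.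
Qed.

(** A sequence of sets is negligible in the limit as soon as it is so on each piece of a countable cover: finitely many
    pieces carry all but an arbitrarily small part of the measure. *)
Lemma pr_split (B C : nat -> set T) N :
  (forall n, measurable (B n)) -> (forall k, measurable (C k)) ->
  measurable N -> pr N = 0 ->
  (forall n, B n `<=` N `|` \bigcup_k C k) ->
  (forall k e, 0 < e -> exists n0, forall n, (n0 <= n)%N -> pr (B n `&` C k) < e) ->
  forall e, 0 < e -> exists n0, forall n, (n0 <= n)%N -> pr (B n) < e.
Proof.
move=> mB mC mN N0 cov h e e0.
pose D k := \bigcup_(i in [set i | (i < k)%N]) C i.
have mD k : measurable (D k) by exact: bigcup_measurable.
have e2 : 0 < e / 2 by rewrite divr_gt0.
have [|K hK] := pr_cvg_bigcup mD _ e2.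
  by move=> n x [i /= ni Cx]; exists i => //=; rewrite (ltn_trans ni).
have hD k e' : 0 < e' -> exists n0, forall n, (n0 <= n)%N -> pr (B n `&` D k) < e'.
  elim: k e' => [|k IH] e' e'0.
    exists 0%N => n _; rewrite (_ : _ `&` _ = set0) ?pr0 //.
    by rewrite -subset0 => x [_ [z zk _]].
  have [|n1 h1] := IH (e' / 2); first by rewrite divr_gt0.
  have [|n2 h2] := h k (e' / 2); first by rewrite divr_gt0.
  exists (maxn n1 n2) => n; rewrite geq_max => /andP[/h1 h1' /h2 h2'].
  have : pr (B n `&` D k.+1) <= pr (B n `&` D k) + pr (B n `&` C k).
    apply: le_trans (pr_setU_le _ _); [|exact: measurableI|exact: measurableI].
    apply: le_pr; [exact: measurableI|by apply: measurableU; exact: measurableI|].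
    move=> x [Bx [i /= ik Cx]]; move: ik; rewrite ltnS leq_eqVlt => /predU1P[ik|ik].
      by right; split => //; rewrite -ik.
    by left; split => //; exists i.
  lra.
have [n0 hn0] := hD K _ e2; exists n0 => n /hn0 hn.
have mU : measurable (\bigcup_k D k) by exact: bigcup_measurable.
have mBD := measurableI _ _ (mB n) (mD K); have mUD := measurableD mU (mD K).
have mV := measurableU _ _ mBD mUD.
have h1 := pr_setU_le mBD mUD; have h2 := pr_setU_le mN mV.
have h3 : pr (B n) <= pr (N `|` (B n `&` D K `|` \bigcup_k D k `\` D K)).
  apply: le_pr => //; first exact: measurableU.
  move=> x Bx; have [Nx|[k _ Cx]] := cov n x Bx; first by left.
  right; have [Dx|Dx] := pselect (D K x); first by left.
  by right; split => //; exists k.+1 => //; exists k => /=.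
have := hK K (leqnn K); move: h1 h2 h3; rewrite N0; lra.
Qed.

Lemma pr_split_count (I : countType) (B : nat -> set T) (C : I -> set T) N :
  (forall n, measurable (B n)) -> (forall k, measurable (C k)) ->
  measurable N -> pr N = 0 ->
  (forall n, B n `<=` N `|` \bigcup_k C k) ->
  (forall k e, 0 < e -> exists n0, forall n, (n0 <= n)%N -> pr (B n `&` C k) < e) ->
  forall e, 0 < e -> exists n0, forall n, (n0 <= n)%N -> pr (B n) < e.
Proof.
move=> mB mC mN N0 cov h.
apply: (@pr_split B (fun n => if unpickle n is Some k then C k else set0) N) => //.
- by move=> n; case: (unpickle n).
- move=> n x /cov[|[k _ Cx]]; [by left|right].
  by exists (pickle k) => //; rewrite pickleK.
- move=> n e e0; case: (unpickle n) => [k|]; first exact: h.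
  by exists 0%N => m _; rewrite setI0 pr0.
Qed.

(** A class of measurable sets closed under countable unions has an almost everywhere largest member: a union of
    members whose measures approach the supremum. *)
Lemma pr_essmax (G : set (set T)) (A0 : set T) : G A0 -> G `<=` measurable ->
  (forall A : nat -> set T, (forall n, G (A n)) -> G (\bigcup_n A n)) ->
  exists2 A, G A & forall A', G A' -> pr (A' `\` A) = 0.
Proof.
move=> GA0 Gm Gcup.
pose S := [set r | exists2 A, G A & r = pr A].
have supS : has_sup S.
  split; first by exists (pr A0), A0.
  by exists 1 => _ [A /Gm mA ->]; exact: pr_le1.
have /choice[A hA] : forall n : nat, exists A, G A /\ sup S - n.+1%:R^-1 < pr A.
  move=> n; have [|r [A GA ->] h] := sup_adherent (eps := n.+1%:R^-1) _ supS.
    by rewrite invr_gt0 ltr0n.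
  by exists A.
have GU : G (\bigcup_n A n) by apply: Gcup => n; have [] := hA n.
exists (\bigcup_n A n) => // A' GA'.
have GUU : G ((\bigcup_n A n) `|` A').
  rewrite (_ : _ `|` A' = \bigcup_n (if n is n.+1 then A n else A')).
    by apply: Gcup => -[//|n]; have [] := hA n.
  apply/seteqP; split => [x [[n _ Ax]|A'x]|x [[|n] _ Ax]].
  - by exists n.+1.
  - by exists 0%N.
  - by right.
  - by left; exists n.
have le_sup B : G B -> pr B <= sup S.
  by move=> GB; apply: ub_le_sup; [case: supS|exists B].
have ge_sup : sup S <= pr (\bigcup_n A n).
  apply/ler_addgt0Pr => e e0.
  have [n ne] : exists n : nat, n.+1%:R^-1 < e.
    exists (Num.truncn e^-1); rewrite invf_plt ?posrE ?ltr0n//.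
    exact: truncnS_gt.
  have [GAn hn] := hA n.
  have : pr (A n) <= pr (\bigcup_n A n).
    by apply: le_pr; [exact: Gm|exact: Gm|move=> x Ax; exists n].
  by move: hn ne => /=; set u := _^-1; lra.
have := le_sup _ GUU.
rewrite (pr_setID (Gm _ GUU) (Gm _ GU)).
rewrite (_ : (_ `|` A') `&` _ = \bigcup_n A n); last first.
  by apply/seteqP; split => x; [case|move=> h; split => //; left].
rewrite (_ : (_ `|` A') `\` _ = A' `\` \bigcup_n A n); last first.
  by apply/seteqP; split => x [] => [[//|//]|]; [move=> ? ?; split => //; right].
move=> h; apply/eqP; rewrite eq_le pr_ge0 andbT; lra.
Qed.

End real_measure.

(** * Measurable projection and uniformization *)

Definition extends (u : seq nat) (s : nat -> nat) :=
  forall i, (i < size u)%N -> s i = nth 0%N u i.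

Section projection.
Context (R : realType).
Context (dX : measure_display) (X : measurableType dX).
Context (d : measure_display) (T : measurableType d).
Context (cv : (nat -> T) -> T -> Prop) (b : nat -> nat -> set T).
Hypothesis pb : polish_base cv b.
Variable mu : probability X R.
Implicit Types (W : set (X * T)).

(** Measurable projection, up to a null set. The set of points having a branch through the word u gets a measurable
    envelope; almost every point in the envelope of u lies in the envelope of some one-letter extension, so that
    a branch can be followed, and convergence along the branch produces a point of the section. *)
Lemma souslin_proj W : souslin cv W ->
  exists K N, [/\ measurable K, measurable N, pr mu N = 0 &
    forall x, ~ N x -> (K x <-> exists y, W (x, y))].
Proof.
move=> [P [Q [[mP detPQ convQ] ->]]].
(* B j s is the j-th approximation, and A u is the union of its branches through the word u;
   ~` Z u is a measurable envelope of A u. *)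
pose B j s := [set x | (forall i, (i <= j)%N -> P i s x) /\
  exists y, forall i, (i <= j)%N -> Q i s y].
have mB j s : measurable (B j s).
  have [ex|nex] := pselect (exists y, forall i, (i <= j)%N -> Q i s y); last first.
    by rewrite (_ : B j s = set0) // -subset0 => x [].
  rewrite (_ : B j s = \bigcap_(i in [set i | (i <= j)%N]) P i s).
    by apply: bigcap_measurable => [|i _]; [exists 0%N|].
  by apply/seteqP; split => x => [[h _] i ij|h]; [exact: h|split => // i ij; exact: h].
have detB j s : exists D, forall s', (forall i, (i < D)%N -> s' i = s i) ->
    B j s' = B j s.
  have /choice[D hD] := fun i => detPQ i s.
  exists (\max_(i < j.+1) D i)%N => s' hs'.
  have E i : (i <= j)%N -> P i s' = P i s /\ Q i s' = Q i s.
    rewrite -ltnS => ij; apply: hD => k kD; apply: hs'.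
    by apply: (leq_trans kD); exact: (leq_bigmax (Ordinal ij)).
  apply/seteqP; split => x [h1 [y h2]]; split.
  - by move=> i ij; have [<- _] := E i ij; exact: h1.
  - by exists y => i ij; have [_ <-] := E i ij; exact: h2.
  - by move=> i ij; have [-> _] := E i ij; exact: h1.
  - by exists y => i ij; have [_ ->] := E i ij; exact: h2.
pose A u := [set x | exists s, extends u s /\ forall j, B j s x].
have AE x : A [::] x <-> exists y, souslin_of P Q (x, y).
  split=> [[s [_ hs]]|[y [s hs]]].
    have /choice[t ht] : forall j, exists y, forall i, (i <= j)%N -> Q i s y.
      by move=> j; have [] := hs j.
    have [j|a [_ Qa]] := convQ s t; first by exists j => i ji; exact: ht.
    exists a, s => j; split => //=; have [+ _] := hs j; exact.
  exists s; split => // j; split; first by move=> i _; have [] := hs i.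
  by exists y => i _; have [] := hs i.
have /choice[Z hZ] : forall u, exists Z, [/\ measurable Z, Z `&` A u = set0 &
    forall Z', measurable Z' -> Z' `&` A u = set0 -> pr mu (Z' `\` Z) = 0].
  move=> u; have [||F hF|Z [mZ ZA] maxZ] :=
    @pr_essmax _ _ _ mu [set Z | measurable Z /\ Z `&` A u = set0] set0.
  - by split; rewrite // set0I.
  - by move=> ? [].
  - split; first by apply: bigcup_measurable => k _; case: (hF k).
    by rewrite setI_bigcupl bigcup0 // => k _; case: (hF k).
  - by exists Z; split => // Z' mZ' hZ'; apply: maxZ.
have subZ u Z' : measurable Z' -> A u `<=` Z' -> pr mu ((~` Z u) `\` Z') = 0.
  move=> mZ' AZ'; have [mZ _ maxZ] := hZ u.
  rewrite (_ : ~` Z u `\` Z' = ~` Z' `\` Z u); last by rewrite !setDE setIC.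
  apply: maxZ; first exact: measurableC.
  by rewrite -subset0 => x [nz /AZ'].
have AZ u x : A u x -> (~` Z u) x.
  by have [_ + _] := hZ u; rewrite -subset0 => h Ax Zx; exact: (h x).
pose C u j := if `[< forall s s', extends u s -> extends u s' -> B j s = B j s' >]
  then B j (nth 0%N u) else setT.
have mC u j : measurable (C u j) by rewrite /C; case: ifP.
have AC u j : A u `<=` C u j.
  move=> x [s [us hs]]; rewrite /C; case: asboolP => // h.
  by rewrite (h _ s) //; move=> i.
have mZ u : measurable (~` Z u) by apply: measurableC; case: (hZ u).
have mU u : measurable (\bigcup_i ~` Z (rcons u i)) by exact: bigcup_measurable.
have [||N1 [mN1 N10 hN1]] := @pr_null_cover _ _ _ mu _
    (fun u => (~` Z u) `\` \bigcup_i ~` Z (rcons u i)).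
- by move=> u; exact: measurableD.
- move=> u; apply: subZ => // x [s [us hs]]; exists (s (size u)) => //.
  apply: AZ; exists s; split => // i; rewrite size_rcons ltnS nth_rcons => iu.
  case: ltngtP iu => //; [by move=> /us|by move=> ->].
have [||N2 [mN2 N20 hN2]] := @pr_null_cover _ _ _ mu _
    (fun uj : seq nat * nat => (~` Z uj.1) `\` C uj.1 uj.2).
- by move=> u; exact: measurableD.
- by move=> u; apply: subZ.
exists (~` Z [::]), (N1 `|` N2); split => //.
- exact: measurableU.
- apply/eqP; rewrite eq_le pr_ge0 andbT.
  by apply: (le_trans (pr_setU_le _ mN1 mN2)); rewrite N10 N20 addr0.
move=> x /not_orP[nN1 nN2]; split; last by move=> /AE; exact: AZ.
move=> Z0; apply/AE.
(* Off the null sets one follows the envelopes from the empty word down a branch. *)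
have /choice[st hst] : forall u, exists i, (~` Z u) x -> (~` Z (rcons u i)) x.
  move=> u; have [zx|zx] := pselect ((~` Z u) x); last by exists 0%N.
  have [[i _ ?]|nh] := pselect ((\bigcup_i ~` Z (rcons u i)) x); first by exists i.
  by case: nN1; apply: (hN1 u); split.
pose us := fix us n := if n is n'.+1 then rcons (us n') (st (us n')) else [::].
pose s n := st (us n).
have usE n : us n = mkseq s n.
  elim: n => [//|n IH]; rewrite -[LHS]/(rcons (us n) (st (us n))).
  by rewrite mkseqS -IH.
have Zus n : (~` Z (us n)) x by elim: n => [//|n IH]; exact: hst.
exists s; split => // j; have [D hD] := detB j s.
have : C (mkseq s D) j x.
  have [//|nC] := pselect (C (mkseq s D) j x).
  by case: nN2; apply: (hN2 (mkseq s D, j)); split => //=; rewrite -usE; exact: (Zus D).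
rewrite /C; case: asboolP => [_|].
  by rewrite hD // => i iD; rewrite nth_mkseq.
case=> s1 s2 h1 h2; rewrite (hD s1) ?(hD s2) // => i iD.
  by rewrite h2 ?size_mkseq // nth_mkseq.
by rewrite h1 ?size_mkseq // nth_mkseq.
Qed.

(** The section point is a measurable function of x: the preimages of balls are projections of Souslin sets. *)
Lemma souslin_uniformize (t0 : T) W : souslin cv W ->
  (forall x y y', W (x, y) -> W (x, y') -> y = y') ->
  exists s N, [/\ measurable_fun setT s, measurable N, pr mu N = 0 &
    forall x y, W (x, y) -> ~ N x -> y = s x].
Proof.
move=> sW W1.
have [K [N0 [mK mN0 N00 hK]]] := souslin_proj sW.
have /choice[L /choice[M hLM]] : forall q : nat * nat, exists L M,
    [/\ measurable L, measurable M, pr mu M = 0 &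
      forall x, ~ M x -> (L x <-> exists y, W (x, y) /\ b q.1 q.2 y)].
  move=> [n k]; have [|L [M [mL mM M0 hL]]] :=
      @souslin_proj (W `&` (setT `*` b n k)).
    by apply: (souslinI pb) => //; apply: (souslin_rect pb) => // t a; exact: (pb_closed pb).
  exists L, M; split => // x /hL ->; split => -[y].
    by move=> [/= ? [_ ?]]; exists y.
  by move=> [/= ? ?]; exists y.
have [||N1 [mN1 N10 hN1]] := @pr_null_cover _ _ _ mu _ M.
- by move=> q; case: (hLM q).
- by move=> q; case: (hLM q).
pose V := K `\` (N0 `|` N1).
have mV : measurable V by apply: measurableD => //; exact: measurableU.
pose s x := if `[< V x >] then xget t0 [set y | W (x, y)] else t0.
have sE x y : W (x, y) -> ~ (N0 `|` N1) x -> y = s x.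
  move=> Wxy nN; rewrite /s; case: asboolP => [_|]; last first.
    by case; split => //; apply/(hK x); [move=> ?; apply: nN; left|exists y].
  by case: xgetP => [z _ /= /(W1 _ _ _ Wxy)|/(_ y)].
have sV x : V x -> W (x, s x).
  move=> Vx; have [Kx nN] := Vx.
  have [y Wxy] : exists y, W (x, y).
    by apply/(hK x) => // ?; apply: nN; left.
  by rewrite -(sE _ _ Wxy).
exists s, (N0 `|` N1); split => //; last first.
- apply/eqP; rewrite eq_le pr_ge0 andbT.
  by apply: (le_trans (pr_setU_le _ mN0 mN1)); rewrite N00 N10 addr0.
- exact: measurableU.
move=> _ B mB; rewrite setTI; have := pb_gen pb mB; move: {mB}B.
pose G := [set B : set T | measurable (s @^-1` B)].
have sG : sigma_algebra setT G.
  split.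
  - by rewrite /G /= preimage_set0.
  - by move=> A mA; rewrite /G /= setTD preimage_setC; exact: measurableC.
  - by move=> A mA; rewrite /G /= preimage_bigcup; apply: bigcup_measurable => k _; exact: mA.
apply: smallest_sub => // _ [n [k ->]]; rewrite /G /=.
have [mL mM M0 hL] := hLM (n, k).
rewrite (_ : s @^-1` _ = (V `&` L (n, k)) `|`
    (~` V `&` [set x | b n k t0])).
  apply: measurableU; first exact: measurableI.
  apply: measurableI; first exact: measurableC.
  have [h|h] := pselect (b n k t0).
    by rewrite (_ : [set x | _] = setT) //; apply/seteqP; split => x /=.
  by rewrite (_ : [set x | _] = set0) //; apply/seteqP; split => x /=.
apply/seteqP; split => x /=.
  have [Vx|nVx] := pselect (V x) => bs; last first.
    by right; split => //; move: bs; rewrite /s; case: asboolP.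
  left; split => //; apply/hL; first by move/(hN1 (n, k)); case: Vx => _ h ?; apply: h; right.
  by exists (s x); split => //; exact: sV.
move=> [[Vx /hL]|[nVx bt]]; last by rewrite /s; case: asboolP.
case; first by move/(hN1 (n, k)); case: Vx => _ h ?; apply: h; right.
by move=> y [Wxy /= bny]; rewrite -(sE _ _ Wxy) //; case: Vx.
Qed.

End projection.

(** * Sets with countable sections *)

Section covering.
Context (R : realType).
Context (dX : measure_display) (X : measurableType dX).
Context (d : measure_display) (T : measurableType d).
Context (cv : (nat -> T) -> T -> Prop) (b : nat -> nat -> set T).
Hypothesis pb : polish_base cv b.
Variables (t0 : T) (mu : probability X R).
Implicit Types (W : set (X * T)).

(** Small sets form a sigma-ideal; it turns out to contain the measurable sets with countable sections. *)
Definition small W := exists (s : nat -> X -> T) N,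
  [/\ forall i, measurable_fun setT (s i), measurable N, pr mu N = 0 &
      forall x y, W (x, y) -> ~ N x -> exists i, y = s i x].

Lemma sub_small W W' : W `<=` W' -> small W' -> small W.
Proof. by move=> WW [s [N [? ? ? h]]]; exists s, N; split=> // x y /WW; exact: h. Qed.

Lemma small_bigcup (I : countType) (W : I -> set (X * T)) :
  (forall i, small (W i)) -> small (\bigcup_i W i).
Proof.
move=> /choice[s /choice[N h]].
have [||M [mM M0 hM]] := @pr_null_cover _ _ _ mu _ N.
- by move=> i; case: (h i).
- by move=> i; case: (h i).
exists (fun n => if unpickle n is Some (i, k) then s i k else fun=> t0), M; split => //.
  move=> n; case: (unpickle n) => [[i k]|]; last exact: measurable_cst.
  by case: (h i).
move=> x y [i _ Wxy] nM; have [_ _ _ hi] := h i.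
have [k ->] := hi x y Wxy (fun Nx => nM (hM i x Nx)).
by exists (pickle (i, k)); rewrite pickleK.
Qed.

Lemma smallU W1 W2 : small W1 -> small W2 -> small (W1 `|` W2).
Proof.
move=> h1 h2; apply: (sub_small _ (@small_bigcup bool (fun c => if c then W1 else W2) _)).
  by move=> p [?|?]; [exists true|exists false].
by case.
Qed.

(** H is the set of points over which W is nowhere small: the complement of the largest set over which W is small. *)
Lemma heavy_exists W : exists H, [/\ measurable H,
  small (W `&` ((~` H) `*` setT)) &
  forall A, measurable A -> small (W `&` (A `*` setT)) -> pr mu (A `&` H) = 0].
Proof.
have [||F hF|A [mA sA] maxA] := @pr_essmax _ _ _ mu
    [set A | measurable A /\ small (W `&` (A `*` setT))] set0.
- split=> //; exists (fun _ _ => t0), set0; split => //.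
  + by rewrite pr0.
  + by move=> x y [_ []].
- by move=> A [].
- split; first by apply: bigcup_measurable => k _; case: (hF k).
  apply: sub_small (small_bigcup (fun k => (hF k).2)).
  by move=> p [Wp [[k _ Fp] _]]; exists k.
exists (~` A); split; rewrite ?setCK //; first exact: measurableC.
by move=> A' mA' sA'; rewrite -setDE; apply: maxA.
Qed.

Section scheme.
Variables (P : nat -> (nat -> nat) -> set X) (Q : nat -> (nat -> nat) -> set T).
Hypothesis PQ : souslin_scheme cv P Q.

(** A node of the search for a point of a section: the word narrows the branch, the list of balls narrows the point. *)
Definition piece (ut : seq nat * seq (nat * nat)) : set (X * T) :=
  [set p | (exists s, extends ut.1 s /\ forall j, P j s p.1 /\ Q j s p.2) /\
     forall q, q \in ut.2 -> b q.1 q.2 p.2].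

Lemma souslin_piece ut : souslin cv (piece ut).
Proof.
case: ut => u t; have [mP detPQ convQ] := PQ.
pose pre (s : nat -> nat) i := if (i < size u)%N then nth 0%N u i else s (i - size u)%N.
have spre : souslin cv (souslin_of (fun j s => P j (pre s)) (fun j s => Q j (pre s))).
  exists (fun j s => P j (pre s)), (fun j s => Q j (pre s)); split => //; split => //.
    move=> j s; have [D hD] := detPQ j (pre s); exists D => s' hs'.
    apply: hD => i iD; rewrite /pre; case: ifP => // _; apply: hs'.
    by apply: leq_ltn_trans iD; exact: leq_subr.
  by move=> s y; exact: convQ.
have sball : souslin cv (@setT X `*` [set y | forall q, q \in t -> b q.1 q.2 y]).
  apply: (souslin_rect pb) => // y a [N hN] ya q qt.
  by apply: (pb_closed pb _ ya); exists N => i /hN; apply.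
rewrite (_ : piece _ = souslin_of (fun j s => P j (pre s)) (fun j s => Q j (pre s)) `&`
   (setT `*` [set y | forall q, q \in t -> b q.1 q.2 y])).
  exact: (souslinI pb).
apply/seteqP; split => p /=.
  move=> [[s [us hs]] ht]; split; last by [].
  exists (fun i => s (i + size u)%N) => j.
  rewrite (_ : pre _ = s) //; apply/funext => i; rewrite /pre.
  by case: ltnP => iu; [rewrite us|rewrite subnK].
move=> [[s hs] [_ ht]]; split => //; exists (pre s); split => //.
by move=> i iu; rewrite /pre iu.
Qed.

(** If the set is not small, some point x is heavy for the empty node and outside of the countably many exceptional null
    sets. Over x one can go down the nodes, staying heavy, and at the n-th step choose a ball that omits the n-th
    point of the countable section of x. The limit of the branch is a point of the section that differs from all of them. *)
Lemma small_souslin_of N : measurable N -> pr mu N = 0 ->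
  (forall x, ~ N x -> countable (xsection (souslin_of P Q) x)) ->
  small (souslin_of P Q).
Proof.
move=> mN N0 cnt; have [mP detPQ convQ] := PQ.
have /choice[H hH] := fun ut => heavy_exists (piece ut).
have mH ut : measurable (H ut) by case: (hH ut).
have maxH ut A : measurable A -> small (piece ut `&` (A `*` setT)) ->
    pr mu (A `&` H ut) = 0 by have [_ _ +] := hH ut; apply.
have smH ut : small (piece ut `&` (~` H ut `*` setT)) by case: (hH ut).
(* Almost every point that is heavy for a node is heavy for one of its children: the children cover the piece. *)
pose Z1 ut := (\bigcap_i ~` H (rcons ut.1 i, ut.2)).
have mZ1 ut : measurable (Z1 ut).
  by apply: bigcap_measurable => [|i _]; [exists 0%N|exact: measurableC].
have [||N1 [mN1 N10 hN1]] := @pr_null_cover _ _ _ mu _ (fun ut => Z1 ut `&` H ut).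
- by move=> ut; exact: measurableI.
- move=> ut; apply: maxH => //.
  apply: sub_small (small_bigcup (fun i => smH (rcons ut.1 i, ut.2))).
  move=> [x y] [[[s [us hs]] ht] [/= Zx _]]; exists (s (size ut.1)) => //.
  split; last by split => //; exact: Zx.
  split => //; exists s; split => // i.
  rewrite size_rcons ltnS nth_rcons => iu.
  by case: ltngtP iu => //; [move=> /us|move=> ->].
(* Over almost every heavy point the section of the piece is nonempty; it gives the points t n below. *)
have /choice[K /choice[M hKM]] := fun ut => souslin_proj mu (souslin_piece ut).
have [||N2 [mN2 N20 hN2]] := @pr_null_cover _ _ _ mu _ (fun ut => ~` K ut `&` H ut).
- by move=> ut; apply: measurableI => //; apply: measurableC; case: (hKM ut).
- move=> ut; have [mK mM M0 hK] := hKM ut; apply: maxH; first exact: measurableC.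
  exists (fun _ _ => t0), (M ut); split => //.
  by move=> x y [/= Wxy [/= nK _]] /hK h; case: nK; apply/h; exists y.
have [||N3 [mN3 N30 hN3]] := @pr_null_cover _ _ _ mu _ M.
- by move=> ut; case: (hKM ut).
- by move=> ut; case: (hKM ut).
(* Almost every heavy point stays heavy in two disjoint balls: otherwise the part of the piece inside the heavy balls
   would have at most one point over x, hence be the graph of a function. *)
pose add ut q : seq nat * seq (nat * nat) := (ut.1, q :: ut.2).
pose Z2 ut := [set x | forall q : nat * (nat * nat),
  b q.1 q.2.1 `&` b q.1 q.2.2 = set0 ->
  ~ (H (add ut (q.1, q.2.1)) x /\ H (add ut (q.1, q.2.2)) x)].
have mZ2 ut : measurable (Z2 ut).
  pose F (q : nat * (nat * nat)) := if `[< b q.1 q.2.1 `&` b q.1 q.2.2 = set0 >] then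
    ~` (H (add ut (q.1, q.2.1)) `&` H (add ut (q.1, q.2.2))) else setT.
  rewrite (_ : Z2 ut = \bigcap_n (if unpickle n is Some q then F q else setT)).
    apply: bigcap_measurable => [|n _]; first by exists 0%N.
    case: (unpickle n) => // q; rewrite /F; case: ifP => // _.
    by apply: measurableC; exact: measurableI.
  apply/seteqP; split => x hx.
    move=> n _; case: (unpickle n) => // q; rewrite /F; case: asboolP => // hq.
    exact: hx.
  move=> q hq; have := hx (pickle q) Logic.I; rewrite pickleK /F.
  by case: asboolP.
have [||N4 [mN4 N40 hN4]] := @pr_null_cover _ _ _ mu _ (fun ut => Z2 ut `&` H ut).
- by move=> ut; exact: measurableI.
- move=> ut; apply: maxH => //.
  pose V q := (H (add ut q) `*` setT) `|` (setT `*` ~` b q.1 q.2).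
  have mV q : measurable (V q).
    apply: measurableU; apply: measurableX => //.
    by apply: measurableC; exact: (pb_meas pb).
  pose VV := \bigcap_n (if unpickle n is Some q then V q else setT).
  have mVV : measurable VV.
    apply: bigcap_measurable => [|n _]; first by exists 0%N.
    by case: (unpickle n).
  have VVE p : VV p <-> forall q, V q p.
    split=> h q; last by case: (unpickle q).
    by have := h (pickle q) Logic.I; rewrite pickleK.
  have sR : small (piece ut `&` ((Z2 ut `*` setT) `&` VV)).
    have [||s [M' [ms mM' M'0 hs]]] :=
      @souslin_uniformize R _ X _ T cv b pb mu t0 (piece ut `&` ((Z2 ut `*` setT) `&` VV)).
    + apply: (souslinI pb); first exact: souslin_piece.
      apply: (souslin_measurable pb); apply: measurableI => //.
      exact: measurableX.
    + move=> x y y' [_ [[/= Zx _] /VVE hV]] [_ [_ /VVE hV']].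
      apply: contrapT => /(pb_sep pb)[n [k [k' [bk bk' dis]]]].
      apply: (Zx (n, (k, k'))) => //=; split.
        by have [[]|[_]] := hV (n, k).
      by have [[]|[_]] := hV' (n, k').
    by exists (fun=> s), M'; split => // x y Wxy nM; exists 0%N; exact: hs.
  apply: sub_small (smallU (small_bigcup (fun q => smH (add ut q))) sR).
  move=> [x y] [pxy [/= Zx _]].
  have [h|] := pselect (VV (x, y)); first by right; split.
  move=> /VVE /existsNP[q /not_orP[nh1 nh2]]; left; exists q => //.
  have bq : b q.1 q.2 y by apply: contrapT => ?; apply: nh2.
  split; last by split => //= ?; apply: nh1.
  case: pxy => h1 h2; split => // q' /=; rewrite inE => /predU1P[->//|].
  exact: h2.
(* A point x of the heavy set of the empty node, outside of all null sets, leads to a contradiction. *)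
have [||N5 [mN5 N50 hN5]] := @pr_null_cover _ _ _ mu _
    (fun i : 'I_5 => nth N [:: N; N1; N2; N3; N4] i).
- by case=> -[|[|[|[|[|]]]]].
- by case=> -[|[|[|[|[|]]]]].
have [s [M' [ms mM' M'0 hs]]] := smH ([::], [::]).
exists s, (N5 `|` M'); split => //.
- exact: measurableU.
- apply/eqP; rewrite eq_le pr_ge0 andbT.
  by apply: (le_trans (pr_setU_le _ mN5 mM')); rewrite N50 M'0 addr0.
move=> x y Wxy /not_orP[nN5 nM'].
have pxy : piece ([::], [::]) (x, y).
  by case: Wxy => s' hs'; split => //; exists s'; split.
have [nH|Hx] := pselect (~ H ([::], [::]) x); first by apply: hs => //; split.
move: Hx => /contrapT Hx; exfalso.
have nN : ~ N x by move=> ?; apply: nN5; apply: (hN5 (inord 0)); rewrite inordK.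
have nN1 : ~ N1 x by move=> ?; apply: nN5; apply: (hN5 (inord 1)); rewrite inordK.
have nN2 : ~ N2 x by move=> ?; apply: nN5; apply: (hN5 (inord 2)); rewrite inordK.
have nN3 : ~ N3 x by move=> ?; apply: nN5; apply: (hN5 (inord 3)); rewrite inordK.
have nN4 : ~ N4 x by move=> ?; apply: nN5; apply: (hN5 (inord 4)); rewrite inordK.
have [yy hyy] : exists yy : nat -> T, forall z, souslin_of P Q (x, z) -> exists n, yy n = z.
  have [g /= ginj] := countable_injP _ (cnt x nN).
  exists (fun k => xget t0 [set z | souslin_of P Q (x, z) /\ g z = k]) => z Wz.
  exists (g z); case: xgetP => [w -> [Ww gw]|/(_ z)]; last by case.
  by apply: ginj => //; rewrite inE /xsection /= inE.
have /choice[st hst] : forall nut : nat * (seq nat * seq (nat * nat)),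
    exists iq : nat * (nat * nat), H nut.2 x ->
      H (rcons nut.2.1 iq.1, iq.2 :: nut.2.2) x /\ ~ b iq.2.1 iq.2.2 (yy nut.1).
  move=> [n ut] /=; have [Hu|] := pselect (H ut x); last by exists (0%N, (0%N, 0%N)).
  have /existsNP[[m [k k']]] : ~ Z2 ut x by move=> Zx; apply: nN4; apply: (hN4 ut).
  move=> /not_implyP[/= dis /contrapT[Hk Hk']].
  have [q [Hq bq]] : exists q, H (add ut q) x /\ ~ b q.1 q.2 (yy n).
    have [bk|bk] := pselect (b m k (yy n)); last by exists (m, k).
    exists (m, k'); split => //= bk'.
    by have : (b m k `&` b m k') (yy n) by []; rewrite dis.
  have /existsNP[i /contrapT Hi] : ~ forall i, ~ H (rcons (add ut q).1 i, (add ut q).2) x.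
    move=> h; apply: nN1; apply: (hN1 (add ut q)); split => // i _; exact: h.
  by exists (i, q).
pose next k (ut : seq nat * seq (nat * nat)) :=
  (rcons ut.1 (st (k, ut)).1, (st (k, ut)).2 :: ut.2).
pose node := fix node n := if n is k.+1 then next k (node k) else ([::], [::]).
have Hnode n : H (node n) x.
  by elim: n => [//|n IH]; have [] := hst (n, node n) IH.
pose s0 n := (st (n, node n)).1; pose q0 n := (st (n, node n)).2.
have node1 n : (node n).1 = mkseq s0 n.
  by elim: n => [//|n IH]; rewrite mkseqS -IH.
have node2 n i : (i < n)%N -> q0 i \in (node n).2.
  elim: n => [//|n IH]; rewrite ltnS leq_eqVlt => /predU1P[->|/IH h] /=.
    by rewrite inE eqxx.
  by rewrite inE h orbT.
have /choice[t ht] : forall n, exists z, piece (node n) (x, z).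
  move=> n; have [_ _ _ hK] := hKM (node n).
  apply/(hK x); first by move=> ?; apply: nN3; apply: (hN3 (node n)).
  by apply: contrapT => ?; apply: nN2; apply: (hN2 (node n)).
have evt j : exists D, forall n, (D <= n)%N -> P j s0 x /\ Q j s0 (t n).
  have [D hD] := detPQ j s0; exists D => n Dn.
  have [[s' [us' hs']] _] := ht n; rewrite node1 in us'.
  have [|E1 E2] := hD s'.
    by move=> i iD; have iD' := leq_trans iD Dn; rewrite us' ?size_mkseq // nth_mkseq.
  by rewrite -E1 -E2; exact: hs'.
have [j|a [ta Qa]] := convQ s0 t.
  by have [D hD] := evt j; exists D => i /hD[].
have /hyy[n yn] : souslin_of P Q (x, a).
  by exists s0 => j; split => //=; have [D /(_ D (leqnn D))[]] := evt j.
have [_] := hst (n, node n) (Hnode n); rewrite yn; apply => /=.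
apply: (pb_closed pb _ ta); exists n.+1 => i ni.
by have [_ h] := ht i; exact: h (node2 _ _ ni).
Qed.

End scheme.

Theorem small_countable_sections W N : measurable W -> measurable N -> pr mu N = 0 ->
  (forall x, ~ N x -> countable (xsection W x)) -> small W.
Proof.
move=> /(souslin_measurable pb)[P [Q [PQ ->]]] mN N0 cnt.
exact: small_souslin_of mN N0 cnt.
Qed.

End covering.

(** * Lower integrals and the counting measure *)

Section lower_integral.
Context (R : realType) (d : measure_display) (T : measurableType d).
Variable mu : {measure set T -> \bar R}.
Local Open Scope ereal_scope.
Import HBNNSimple.

(** The integral of a nonnegative function is the supremum of the integrals of the simple functions below it, so it is
    monotone on all functions. The counting functions in rel_measure are not known to be measurable in advance. *)
Lemma ge0_le_lower_integral (D : set T) (f g : T -> \bar R) :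
  (forall x, D x -> 0 <= f x) -> (forall x, D x -> f x <= g x) ->
  \int[mu]_(x in D) f x <= \int[mu]_(x in D) g x.
Proof.
move=> f0 fg; have g0 x : D x -> 0 <= g x by move=> Dx; exact: le_trans (f0 x Dx) (fg x Dx).
rewrite !ge0_integralE //; apply: le_ereal_sup => _ [h /= hf <-].
exists h => //= x; apply: le_trans (hf x) _; rewrite /patch.
by case: ifP => // /set_mem /fg.
Qed.

Lemma lower_integral0 (D A : set T) (f : T -> \bar R) : measurable D -> measurable A -> A `<=` D ->
  (forall x, D x -> 0 <= f x) -> (forall x, A x -> 1 <= f x) ->
  \int[mu]_(x in D) f x = 0 -> mu A = 0.
Proof.
move=> mD mA AD f0 f1 int0; apply/eqP; rewrite eq_le measure_ge0 andbT -int0.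
have /setIidl <- := AD; rewrite -integral_indic //.
apply: ge0_le_lower_integral => x Dx; first by rewrite lee_fin.
have [Ax|nAx] := pselect (A x).
  by rewrite indicE mem_set //; exact: f1.
by rewrite indicE memNset //; exact: f0.
Qed.

Lemma lower_integral_null (D N : set T) (f : T -> \bar R) : measurable N -> mu N = 0 ->
  (forall x, D x -> 0 <= f x) -> (forall x, D x -> ~ N x -> f x = 0) ->
  \int[mu]_(x in D) f x = 0.
Proof.
move=> mN N0 f0 f1; apply/eqP; rewrite eq_le; apply/andP; split; last exact: integral_ge0.
rewrite integral_mkcond.
apply: (@le_trans _ _ (\int[mu]_x ((cst +oo : T -> \bar R) \_ N) x)).
  apply: ge0_le_lower_integral => x _.
    by rewrite /patch; case: ifP => // /set_mem /f0.
  rewrite /patch; case: ifP => [/set_mem Dx|_]; last by case: ifP => _ //=; exact: leey.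
  case: ifP => [_|/negbT]; first by rewrite leey.
  by rewrite notin_setE => /(f1 _ Dx) ->.
by rewrite -integral_mkcond integral_cst // N0 mule0.
Qed.

End lower_integral.

Section counting.
Context (R : realType) (T : choiceType).
Local Open Scope ereal_scope.

Lemma counting_ge0 (A : set T) : 0 <= counting A :> \bar R.
Proof. by rewrite /counting; case: ifP => // _; rewrite lee_fin. Qed.

Lemma counting_ge1 (A : set T) : A !=set0 -> 1 <= counting A :> \bar R.
Proof.
move=> [x Ax]; rewrite /counting; case: asboolP => [fA|_]; last by rewrite leey.
rewrite lee_fin ler1n finmap.cardfs_gt0; apply/finmap.fset0Pn; exists x.
by rewrite in_fset_set ?mem_set.
Qed.

Lemma counting0 : counting (@set0 T) = 0 :> \bar R.
Proof. by rewrite /counting; case: asboolP => //; rewrite fset_set0 finmap.cardfs0. Qed.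

Lemma counting1 (x : T) : counting [set x] = 1 :> \bar R.
Proof. by rewrite /counting; case: asboolP => //; rewrite fset_set1 finmap.cardfs1. Qed.

End counting.

(** * Generating involutions *)

Section gens.
Context (R : realType) (d : measure_display) (T : measurableType d).
Variable mu : probability T R.

(** Involutions preserve the measure exactly and are their own inverses, so that images and preimages agree. Outside
    of D they are the identity, which makes them total maps of T. *)
Record generators (D : set T) (rel : set (T * T)) (g : nat -> T -> T) : Prop :=
  Generators {
  gen_meas : forall i, measurable_fun setT (g i) ;
  gen_inv : forall i x, g i (g i x) = x ;
  gen_rel : forall i x, D x -> rel (x, g i x) ;
  gen_out : forall i x, ~ D x -> g i x = x ;
  gen_pres : forall i A, measurable A -> pr mu (g i @^-1` A) = pr mu A ;
  gen_cover : exists N, [/\ measurable N, pr mu N = 0 &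
    forall x y, rel (x, y) -> ~ N x -> exists i, y = g i x] }.

Lemma measurable_preimage (U : measurableType d) (f : T -> U) A :
  measurable_fun setT f -> measurable A -> measurable (f @^-1` A).
Proof. by move=> mf mA; rewrite -[_ @^-1` _]setTI; exact: mf. Qed.

Lemma measurable_fun_if_set (A : set T) (f g : T -> T) : measurable A ->
  measurable_fun setT f -> measurable_fun setT g ->
  measurable_fun setT (fun x => if `[< A x >] then f x else g x).
Proof.
move=> mA mf mg _ B mB; rewrite setTI.
rewrite (_ : _ @^-1` B = (A `&` f @^-1` B) `|` (~` A `&` g @^-1` B)).
  apply: measurableU; apply: measurableI => //; try exact: measurable_preimage.
  exact: measurableC.
apply/seteqP; split => x /=; case: asboolP => Ax.
- by left.
- by right.
- by move=> [[? ?]|[? ?]].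
- by move=> [[? ?]|[? ?]].
Qed.

(** Each involution is applied only where it does not leave the smaller relation. *)
Lemma generators_restrict D rel g D' rel' : generators D rel g ->
  measurable D' -> borel_equivalence D' rel' -> rel' `<=` rel ->
  generators D' rel' (fun i x => if `[< rel' (x, g i x) >] then g i x else x).
Proof.
move=> [gm gi gr go gp [N [mN N0 cov]]] mD' [mrel subD refl sym trans] sub.
have mg2 i : measurable_fun setT (fun x => (x, g i x)).
  by apply: measurable_fun_pair => //; exact: measurable_id.
pose Z i := [set x | rel' (x, g i x)].
have mZ i : measurable (Z i).
  by rewrite /Z -[X in measurable X]setTI; exact: mg2.
have Zg i x : Z i x <-> Z i (g i x).
  by rewrite /Z /= gi; split => /sym.
split.
- move=> i; apply: measurable_fun_if_set => //; exact: mZ.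
- move=> i x; case: (asboolP (rel' (x, g i x))) => [h|h]; last by case: asboolP.
  by rewrite (asboolT ((Zg i x).1 h)) gi.
- by move=> i x Dx; case: asboolP => // _; exact: refl.
- by move=> i x nDx; case: asboolP => // /subD[].
- move=> i A mA.
  have mpre : measurable (g i @^-1` A) by exact: measurable_preimage.
  rewrite (_ : _ @^-1` A = (Z i `&` g i @^-1` A) `|` (~` Z i `&` A)); last first.
    apply/seteqP; split => x /=; case: asboolP => Ax.
    - by left.
    - by right.
    - by move=> [[? ?]|[? ?]].
    - by move=> [[? ?]|[? ?]].
  have mC := measurableC (mZ i).
  have dis : (Z i `&` g i @^-1` A) `&` (~` Z i `&` A) = set0.
    by apply/seteqP; split => [x [[zx _] [nzx _]]|//]; exact: (nzx zx).
  rewrite (pr_setU mu (measurableI _ _ (mZ i) mpre) (measurableI _ _ mC mA) dis).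
  have -> : Z i `&` g i @^-1` A = g i @^-1` (Z i `&` A).
    by apply/seteqP; split => x [/Zg zx Ax]; split => //; rewrite -(gi i x); exact: zx.
  rewrite gp; last exact: measurableI.
  rewrite [RHS](pr_setID mu mA (mZ i)) setIC; congr (_ + pr _ _).
  by rewrite setDE setIC.
- exists N; split => // x y rxy nN.
  have [i yi] := cov x y (sub _ rxy) nN; exists i.
  by case: asboolP => //; rewrite -yi.
Qed.

(** The two sides are the measures of the graph of g over A and of its flip. *)
Lemma pmp_involution (rel : set (T * T)) (g : T -> T) :
  measurable [set p : T * T | p.2 = p.1] ->
  measure_preserving_rel setT mu rel ->
  measurable_fun setT g -> (forall x, g (g x) = x) -> (forall x, rel (x, g x)) ->
  forall A, measurable A -> pr mu (g @^-1` A) = pr mu A.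
Proof.
move=> mdiag pmp mg gg rg A mA.
pose E := [set p : T * T | p.2 = g p.1 /\ A p.2].
have mE : measurable E.
  apply: measurableI.
    have mf : measurable_fun setT (fun p : T * T => (g p.1, p.2)).
      apply: measurable_fun_pair; last exact: measurable_snd.
      exact: measurableT_comp mg measurable_fst.
    by have := mf measurableT _ mdiag; rewrite setTI.
  have := @measurable_snd _ _ T T measurableT _ mA; by rewrite setTI.
have Erel : E `<=` rel by move=> [x y] [/= -> _].
have := pmp E mE Erel.
have mpre : measurable (g @^-1` A) by exact: measurable_preimage.
have intI (B : set T) : measurable B -> (\int[mu]_(x in setT) (\1_B x)%:E = mu B)%E.
  by move=> mB; rewrite integral_indic // setIT.
rewrite /rel_measure (_ : (fun x => _) = (fun x => (\1_A x)%:E)); last first.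
  apply/funext => x; rewrite indicE; have [Ax|nAx] := pselect (A x).
    rewrite mem_set // (_ : xsection _ _ = [set g x]) ?counting1 //.
    apply/seteqP; split => y; rewrite /xsection /= inE /=.
      by move=> [[/= e _] _]; rewrite e gg.
    move=> ->; split; first by split => //=; rewrite gg.
    by have := rg (g x); rewrite gg.
  rewrite memNset // (_ : xsection _ _ = set0) ?counting0 //.
  by rewrite -subset0 => y; rewrite /xsection /= inE /= => -[[_ /nAx]].
rewrite (_ : (fun x => counting _) = (fun x => (\1_(g @^-1` A) x)%:E)); last first.
  apply/funext => x; rewrite indicE; have [Ax|nAx] := pselect (A (g x)).
    rewrite mem_set // (_ : xsection _ _ = [set g x]) ?counting1 //.
    apply/seteqP; split => y; rewrite /xsection /= inE /=; first by move=> [[]].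
    by move=> ->; split.
  rewrite memNset // (_ : xsection _ _ = set0) ?counting0 //.
  by rewrite -subset0 => y; rewrite /xsection /= inE /= => -[[/= -> /nAx]].
by rewrite !intI // /pr => ->.
Qed.

(** Distinct points are separated by disjoint balls of the countable base. *)
Lemma measurable_diagonal (cv : (nat -> T) -> T -> Prop) (b : nat -> nat -> set T) :
  polish_base cv b -> measurable [set p : T * T | p.2 = p.1].
Proof.
move=> pb.
pose F (q : nat * (nat * nat)) := if `[< b q.1 q.2.1 `&` b q.1 q.2.2 = set0 >] then
  b q.1 q.2.1 `*` b q.1 q.2.2 else set0.
rewrite (_ : [set p | _] = ~` \bigcup_n (if unpickle n is Some q then F q else set0)).
  apply: measurableC; apply: bigcup_measurable => n _.
  case: (unpickle n) => // q; rewrite /F; case: ifP => // _.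
  by apply: measurableX; exact: (pb_meas pb).
apply/seteqP; split => [[x y] /= ->|[x y] /= h].
  move=> [n _]; case: (unpickle n) => // q; rewrite /F; case: asboolP => // e [/= h1 h2].
  by have : (b q.1 q.2.1 `&` b q.1 q.2.2) x by []; rewrite e.
apply: contrapT => ne.
have /(pb_sep pb)[n [k [k' [bk bk' dis]]]] : x <> y by move=> e; apply: ne; rewrite e.
apply: h; exists (pickle (n, (k, k'))) => //; rewrite pickleK /F /=.
by case: asboolP.
Qed.

(** The functions that enumerate the sections of the relation are cut into partial injections between disjoint balls,
    each of which extends to an involution. *)
Theorem feldman_moore (rel : set (T * T)) : standard_borel R T ->
  discrete_pmp_equivalence setT mu rel -> exists g, generators setT rel g.
Proof.
move=> stT [[mrel _ refl sym trans] disc pmp].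
have [t0 _] : [set: T] !=set0.
  apply/set0P/eqP => T0; have := probability_setT mu.
  by rewrite T0 measure0 => /esym/eqP; rewrite onee_eq0.
have [cv [b pb]] := standard_polish_base t0 stT.
have [N0 [mN0 muN0 hN0]] := disc.
have [s [N1 [ms mN1 N10 hs]]] : small mu rel.
  apply: (small_countable_sections pb t0 mrel mN0); first exact: pr_null.
  by move=> x nN; apply: contrapT => h; apply: nN; apply: hN0 => /= /(_ Logic.I).
have mdiag := measurable_diagonal pb.
have m2 i : measurable_fun setT (fun x => (x, s i x)).
  by apply: measurable_fun_pair => //; exact: measurable_id.
pose Y i := [set x | rel (x, s i x) /\ N1 (s i x)].
have mY i : measurable (Y i).
  apply: measurableI; last exact: measurable_preimage.
  by rewrite -[X in measurable X]setTI; exact: m2.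
have Y0 i : pr mu (Y i) = 0.
  apply: pr_null.
  (* By preservation of the measure, a null set has a null saturation. *)
  pose E := rel `&` (N1 `*` setT).
  have mE : measurable E by apply: measurableI => //; exact: measurableX.
  have h := pmp E mE (@subIsetl _ _ _).
  apply: (lower_integral0 measurableT (mY i) (@subsetT _ _)) _ _ (etrans h _).
  + by move=> x _; exact: counting_ge0.
  + move=> x [rx Nx]; apply: counting_ge1; exists (s i x).
    by rewrite /xsection /= inE /=; split => //; split => //=; exact: sym.
  + apply: (lower_integral_null mN1 (pr_eq0 mN1 N10)) => x _.
      exact: counting_ge0.
    move=> nN; rewrite (_ : xsection _ _ = set0) ?counting0 //.
    by rewrite -subset0 => y; rewrite /xsection /= inE /= => -[[_ [/nN]]].
(* Points with s i x = y and s j y = x in disjoint balls are exchanged; everything else is fixed.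
   Disjointness of the balls makes the domain A q and the range A' q disjoint. *)
pose idx := (nat * nat * (nat * nat) * (nat * nat))%type.
pose A (q : idx) := [set x | [/\ rel (x, s q.1.1.1 x), s q.1.1.2 (s q.1.1.1 x) = x,
  b q.1.2.1 q.1.2.2 x, b q.2.1 q.2.2 (s q.1.1.1 x) &
  b q.1.2.1 q.1.2.2 `&` b q.2.1 q.2.2 = set0]].
pose A' (q : idx) := [set y | A q (s q.1.1.2 y) /\ s q.1.1.1 (s q.1.1.2 y) = y].
have mss i j : measurable [set x | s j (s i x) = x].
  have mf : measurable_fun setT (fun x => (x, s j (s i x))).
    apply: measurable_fun_pair; first exact: measurable_id.
    exact: measurableT_comp (ms j) (ms i).
  by have := mf measurableT _ mdiag; rewrite setTI.
have mA q : measurable (A q).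
  have [e|ne] := pselect (b q.1.2.1 q.1.2.2 `&` b q.2.1 q.2.2 = set0); last first.
    by rewrite (_ : A q = set0) // -subset0 => x [].
  rewrite (_ : A q = [set x | rel (x, s q.1.1.1 x)] `&` [set x | s q.1.1.2 (s q.1.1.1 x) = x]
     `&` b q.1.2.1 q.1.2.2 `&` (s q.1.1.1 @^-1` b q.2.1 q.2.2)); last first.
    by apply/seteqP; split => x; [case|move=> [[[]]]; split].
  apply: measurableI; last by apply: measurable_preimage => //; exact: (pb_meas pb).
  apply: measurableI; last exact: (pb_meas pb).
  apply: measurableI; last exact: mss.
  by rewrite -[X in measurable X]setTI; exact: m2.
have mA' q : measurable (A' q).
  apply: measurableI; last exact: mss.
  exact: measurable_preimage.
have dis q x : A q x -> A' q x -> False.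
  move=> [_ _ bx _ e] [[_ _ _ + _] E]; rewrite E => bx'.
  by have : (b q.1.2.1 q.1.2.2 `&` b q.2.1 q.2.2) x by []; rewrite e.
pose gam q x := if `[< A q x >] then s q.1.1.1 x else
  if `[< A' q x >] then s q.1.1.2 x else x.
pose g n := if unpickle n is Some (Some q) then gam q else id.
have mgam q : measurable_fun setT (gam q).
  apply: measurable_fun_if_set => //; apply: measurable_fun_if_set => //.
have gamK q x : gam q (gam q x) = x.
  rewrite /gam; case: (asboolP (A q x)) => [Ax|nAx].
    have [_ E _ _ _] := Ax.
    have A'x : A' q (s q.1.1.1 x) by split; rewrite E.
    case: asboolP => [/dis/(_ A'x)//|_].
    by case: asboolP.
  case: (asboolP (A' q x)) => [[A'x E]|nA'x]; first by case: asboolP.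
  by case: asboolP => //; case: asboolP.
have relgam q x : rel (x, gam q x).
  rewrite /gam; case: asboolP => [[]//|_].
  case: asboolP => [[[+ _ _ _ _] E]|_]; last exact: refl.
  by rewrite E => /sym.
have mg n : measurable_fun setT (g n).
  by rewrite /g; case: (unpickle n) => [[q|]|] //; exact: measurable_id.
have gK n x : g n (g n x) = x by rewrite /g; case: (unpickle n) => [[q|]|].
have relg n x : rel (x, g n x).
  by rewrite /g; case: (unpickle n) => [[q|]|] //=; exact: refl.
exists g; split.
- exact: mg.
- exact: gK.
- by move=> i x _; exact: relg.
- by move=> i x nT; case: nT.
- by move=> i A0 mA0; exact: (pmp_involution mdiag pmp (mg i) (gK i) (relg i)).
exists (N1 `|` \bigcup_i Y i).
have mU : measurable (\bigcup_i Y i) by exact: bigcup_measurable.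
split.
- exact: measurableU.
- apply/eqP; rewrite eq_le pr_ge0 andbT.
  by apply: (le_trans (pr_setU_le _ mN1 mU)); rewrite N10 pr_bigcup0 // addr0.
move=> x y rxy /not_orP[nN1 nY].
have [xy|nxy] := pselect (x = y).
  by exists (pickle (None : option idx)); rewrite /g pickleK.
have [i yi] := hs x y rxy nN1.
have nN1y : ~ N1 y by move=> Ny; apply: nY; exists i => //; rewrite /Y /= -yi.
have [j xj] := hs y x (sym _ _ rxy) nN1y.
have [n [k [k' [bk bk' e]]]] := pb_sep pb nxy.
exists (pickle (Some ((i, j), (n, k), (n, k')) : option idx)).
rewrite /g pickleK /gam; case: asboolP => //=.
by case; split => //=; rewrite -yi.
Qed.

End gens.

(** * Boundaries and the full group *)

(** For the nonnegative sequences to which it is applied, this is convergence to 0. *)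
Definition cv0 (R : realType) (u : nat -> R) : Prop :=
  forall e, 0 < e -> exists N, forall n, (N <= n)%N -> u n < e.

Lemma cv0_le (R : realType) (u v : nat -> R) : (forall n, u n <= v n) -> cv0 v -> cv0 u.
Proof.
by move=> uv h e /h[N hN]; exists N => n /hN; exact: le_lt_trans.
Qed.

Lemma cv0_cst (R : realType) (r : R) : cv0 (fun=> r) -> r <= 0.
Proof.
move=> h; rewrite leNgt; apply/negP => /h[N /(_ N (leqnn N))].
by rewrite ltxx.
Qed.

Lemma cv0_EFin (R : realType) (u : nat -> R) (v : nat -> \bar R) :
  (forall n, 0 <= u n) -> (forall n, v n = (u n)%:E) ->
  v @ \oo --> 0%E <-> cv0 u.
Proof.
move=> u0 /funext ->; split.
  move=> /fine_cvgP[_ /cvgrPdist_lt h] e /h[N _ hN]; exists N => n /hN /=.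
  by rewrite sub0r normrN ger0_norm.
move=> h; apply/fine_cvgP; split; first by exists 0%N.
apply/cvgrPdist_lt => e /h[N hN]; exists N => // n /= /hN.
by rewrite sub0r normrN ger0_norm.
Qed.

Section dynamics.
Context (R : realType) (d : measure_display) (T : measurableType d).
Variable mu : probability T R.
Hypothesis mdiag : measurable [set p : T * T | p.2 = p.1].

Definition bdry (g : T -> T) (A : set T) : set T := A `+` (g @^-1` A).

Lemma bdryE g A x : bdry g A x <-> ~ (A x <-> A (g x)).
Proof.
rewrite /bdry /setY /=; split.
  by move=> [[Ax nA]|[Ax nA]] [h1 h2]; [exact: nA (h1 Ax)|exact: nA (h2 Ax)].
move=> h; have [Ax|nAx] := pselect (A x); have [Ag|nAg] := pselect (A (g x)).
- by case: h.
- by left.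
- by right.
- by case: h.
Qed.

Lemma measurable_bdry g A : measurable_fun setT g -> measurable A -> measurable (bdry g A).
Proof.
move=> mg mA; have mp : measurable (g @^-1` A) by exact: measurable_preimage.
by apply: measurableU; exact: measurableD.
Qed.

Lemma bdryU g A B : bdry g (A `|` B) `<=` bdry g A `|` bdry g B.
Proof.
move=> x /bdryE h; apply: contrapT => /not_orP[h1 h2]; apply: h.
have {}h1 : A x <-> A (g x) by apply: contrapT => k; apply: h1; apply/bdryE.
have {}h2 : B x <-> B (g x) by apply: contrapT => k; apply: h2; apply/bdryE.
by split=> -[/h1|/h2]; [left|right|left|right].
Qed.

(** All that the full group and invariance modulo null sets see of a measure concentrated on D; it serves mu on the
    whole space and the normalized measure of a subset at the same time. *)
Definition same_null (D : set T) (nu : set T -> \bar R) :=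
  forall N, measurable N -> (nu N = 0%E <-> pr mu (D `&` N) = 0).

Lemma same_null_mu : same_null setT mu.
Proof.
by move=> N mN; rewrite setTI; split => [/pr_null//|/(pr_eq0 mN)].
Qed.

Lemma normalized_restrE E A : measurable E -> measurable A -> pr mu E != 0 ->
  normalized_restr mu E A = (pr mu (E `&` A) / pr mu E)%:E.
Proof.
move=> mE mA E0; rewrite /normalized_restr (prE mu mE) prE; last exact: measurableI.
by rewrite inver (negbTE E0) -EFinM.
Qed.

Lemma same_null_restr E : measurable E -> pr mu E != 0 ->
  same_null E (normalized_restr mu E).
Proof.
move=> mE E0 N mN; rewrite normalized_restrE //; split => [/eqP|->]; last by rewrite mul0r.
by rewrite eqe mulf_eq0 invr_eq0 (negbTE E0) orbF => /eqP.
Qed.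

Section gens_facts.
Variables (D : set T) (rel : set (T * T)) (g : nat -> T -> T).
Hypothesis (mD : measurable D) (G : generators mu D rel g).

Lemma gen_stable i x : D x -> D (g i x).
Proof.
move=> Dx; apply: contrapT => nD; have := gen_out G i nD.
by rewrite (gen_inv G) => e; rewrite -e in nD.
Qed.

Lemma gen_image i A : g i @` A = g i @^-1` A.
Proof.
apply/seteqP; split => [_ [x Ax <-]|x Ax]; first by rewrite /= (gen_inv G).
by exists (g i x) => //; exact: (gen_inv G).
Qed.

Lemma gen_full_group (nu : set T -> \bar R) i : same_null D nu -> full_group D nu rel (g i).
Proof.
move=> sn; split.
- split.
  + by move=> x /gen_stable.
  + by move=> x y _ _ e; rewrite -(gen_inv G i x) e (gen_inv G).
  + by move=> x Dx; exists (g i x); [exact: gen_stable|exact: (gen_inv G)].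
- by apply: measurable_funTS; exact: (gen_meas G).
- by move=> A mA _; rewrite gen_image; exact: measurable_preimage (gen_meas G i) mA.
- exists set0; split => //; first by apply/sn => //; rewrite setI0 pr0.
  by move=> x; apply; exact: (gen_rel G).
Qed.

Lemma gen_bdry i A : (g i @` A) `+` A = bdry (g i) A.
Proof. by rewrite gen_image /bdry setYC. Qed.

(** An element h of the full group agrees with g i on a set P i, and these sets cover D up to the null set Bad. The cover
    of the image consists of the sets h (P i) and of h (Bad), which is null too. *)
Lemma full_group_bdry (nu : set T -> \bar R) h : same_null D nu ->
  full_group D nu rel h -> exists N (C : nat -> set T),
  [/\ measurable N, pr mu N = 0, (forall i, measurable (C i)) &
   forall A, A `<=` D -> (h @` A) `+` A `<=` N `|` \bigcup_i C i /\
     forall i, ((h @` A) `+` A) `&` C i `<=` bdry (g i) A].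
Proof.
move=> sn [[hD hinj hsurj] mh mimh [N0 [mN0 nuN0 hN0]]].
have [N1 [mN1 N10 cov]] := gen_cover G.
pose P i := [set x | D x /\ h x = g i x].
have mP i : measurable (P i).
  pose h' x := if `[< D x >] then h x else x.
  have mh' : measurable_fun setT h'.
    move=> _ B mB; rewrite setTI.
    rewrite (_ : h' @^-1` B = (D `&` h @^-1` B) `|` (~` D `&` B)).
      by apply: measurableU; [exact: mh|apply: measurableI => //; exact: measurableC].
    apply/seteqP; split => x; rewrite /h' /=; case: asboolP => Dx.
    - by left.
    - by right.
    - by move=> [[]|[]].
    - by move=> [[]|[]].
  have mf : measurable_fun setT (fun x => (g i x, h' x)).
    by apply: measurable_fun_pair => //; exact: (gen_meas G).
  have mPi : measurable (D `&` [set x | h' x = g i x]).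
    by apply: measurableI => //; have := mf measurableT _ mdiag; rewrite setTI.
  rewrite (_ : P i = D `&` [set x | h' x = g i x]) //.
  by apply/seteqP; split => x [Dx] /=; rewrite /h' asboolT.
pose Bad := D `\` \bigcup_i P i.
have mBad : measurable Bad by apply: measurableD => //; exact: bigcup_measurable.
have Bad0 : pr mu Bad = 0.
  have N00 : pr mu (D `&` N0) = 0 by apply/sn.
  have mDN : measurable (D `&` N0) by exact: measurableI.
  have U0 : pr mu ((D `&` N0) `|` N1) = 0.
    apply/eqP; rewrite eq_le pr_ge0 andbT.
    by apply: (le_trans (pr_setU_le _ mDN mN1)); rewrite N00 N10 addr0.
  apply: (pr_sub0 _ _ _ U0) => //; first exact: measurableU.
  move=> x [Dx nP].
  have [rx|nrx] := pselect (rel (x, h x)).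
    right; apply: contrapT => nN1; have [i hx] := cov _ _ rx nN1.
    by apply: nP; exists i.
  by left; split => //; apply: hN0 => /= /(_ Dx).
have mhP A : measurable A -> A `<=` D -> measurable (h @` A) by exact: mimh.
exists (h @` Bad), (fun i => h @` P i).
have subP i : P i `<=` D by move=> x [].
have subBad : Bad `<=` D by move=> x [].
split.
- exact: mhP.
- (* On Q i the map h is the involution g i, so h preserves the measure off Bad;
     since h maps D onto D, nothing is left for the image of Bad. *)
  pose Q i := P i `\` \bigcup_(j in [set j | (j < i)%N]) P j.
  have mQ i : measurable (Q i) by apply: measurableD => //; exact: bigcup_measurable.
  have QP i : Q i `<=` P i by move=> x [].
  have hQ i : h @` Q i = g i @^-1` Q i.
    rewrite -gen_image; apply/seteqP; split => _ [x Qx <-]; exists x => //;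
    by have [_ ->] := QP _ _ Qx.
  have UQ : \bigcup_i Q i = \bigcup_i P i.
    apply/seteqP; split => x [i _ h']; first by exists i => //; exact: QP.
    have ex : exists i, `[< P i x >] by exists i; exact/asboolP.
    exists (ex_minn ex) => //; case: ex_minnP => m /asboolP Pm mmin.
    by split => // -[j /= jm /asboolP Pj]; have := mmin j Pj; rewrite leqNgt jm.
  have disQ : trivIset setT Q.
    apply/trivIsetP => i j _ _ ij; rewrite -subset0 => x [[Pi ni] [Pj nj]].
    case: (ltngtP i j) => [lij|lji|eij].
    - by apply: nj; exists i.
    - by apply: ni; exists j.
    - by rewrite eij eqxx in ij.
  have dishQ : trivIset setT (fun i => h @` Q i).
    apply/trivIsetP => i j _ _ ij; rewrite -subset0 => _ [[x Qx <-] [y Qy e]].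
    have Dx : D x by apply: (subP i); exact: QP.
    have Dy : D y by apply: (subP j); exact: QP.
    have exy : y = x by apply: hinj; rewrite ?inE.
    move/trivIsetP : disQ => /(_ i j Logic.I Logic.I ij); rewrite -subset0 => /(_ x); apply.
    by split => //; rewrite -exy.
  have mhQ i : measurable (h @` Q i) by rewrite hQ; exact: measurable_preimage (gen_meas G i) (mQ i).
  have E : mu (\bigcup_i (h @` Q i)) = mu (\bigcup_i Q i).
    have e i : mu (h @` Q i) = mu (Q i).
      by rewrite (prE mu (mhQ i)) (prE mu (mQ i)) hQ (gen_pres G).
    by rewrite !measure_bigcup //; apply: eq_eseriesr => i _; exact: e.
  have DE : D = h @` Bad `|` \bigcup_i (h @` Q i).
    rewrite -image_bigcup UQ -image_setU /Bad setUC setDUK; last by move=> x [i _ []].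
    by apply/seteqP; split => x; [move/hsurj|move=> [y Dy <-]; exact: hD].
  have mU : measurable (\bigcup_i Q i) by exact: bigcup_measurable.
  have mhU : measurable (\bigcup_i (h @` Q i)) by exact: bigcup_measurable.
  have e1 : pr mu D = pr mu (h @` Bad) + pr mu (\bigcup_i (h @` Q i)).
    rewrite {1}DE pr_setU //; first exact: mhP.
    rewrite -subset0 => _ [[x Bx <-] [i _ [y Qy e]]].
    have exy : y = x.
      by apply: hinj; rewrite ?inE //; [apply: (subP i); exact: QP|exact: subBad].
    by case: Bx => _; apply; exists i => //; rewrite -exy; exact: QP.
  have e2 : pr mu D = pr mu Bad + pr mu (\bigcup_i Q i).
    rewrite -pr_setU //; last by rewrite UQ -subset0 => x [[_ nP] /nP].
    by rewrite /Bad UQ setUC setDUK // => x [i _ []].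
  have e3 : pr mu (\bigcup_i (h @` Q i)) = pr mu (\bigcup_i Q i) by rewrite /pr E.
  by move: e1; rewrite e2 Bad0 e3; lra.
- by move=> i; apply: mhP.
- move=> A AD; split.
    move=> y hy.
    have [x Dx <-] : (h @` D) y.
      by case: hy => [[[x Ax <-] _]|[/AD/hsurj]//]; exists x => //; exact: AD.
    have [[i _ Px]|nP] := pselect ((\bigcup_i P i) x); first by right; exists i => //; exists x.
    by left; exists x.
  move=> i y [hy [x [Dx e] exy]]; rewrite -exy in hy *; apply/bdryE => -[h1 h2].
  have gx : g i (h x) = x by rewrite e (gen_inv G).
  rewrite gx in h1 h2.
  have hA : (h @` A) (h x) <-> A x.
    split=> [[z Az ezx]|Ax]; last by exists x.
    have <- // : z = x by apply: hinj; rewrite ?inE //; exact: AD.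
  case: hy => [[/hA Ax nA]|[Ahx nA]]; first exact: nA (h2 Ax).
  exact: nA (hA.2 (h1 Ahx)).
Qed.

(** By full_group_bdry, the boundary for an element of the full group is covered by the boundaries for the generators. *)
Lemma gens_invariant (nu : set T -> \bar R) A : same_null D nu ->
  measurable A -> A `<=` D ->
  (invariant_set D nu rel A <-> forall i, pr mu (bdry (g i) A) = 0).
Proof.
move=> sn mA AD; split.
  move=> [_ _ inv] i; have mb := measurable_bdry (gen_meas G i) mA.
  have := inv _ (gen_full_group i sn); rewrite gen_bdry => /sn -/(_ mb).
  rewrite (_ : D `&` _ = bdry (g i) A) //; apply/setIidPr => x.
  case=> [[Ax _]|[Agx _]]; first exact: AD.
  by rewrite -(gen_inv G i x); apply: gen_stable; exact: AD.
move=> h; split => // f /[dup] [[_ _ mimf _]] /(full_group_bdry sn)[N [C [mN N0 mC hC]]].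
have mB : measurable ((f @` A) `+` A).
  by have mfA := mimf A mA AD; apply: measurableU; exact: measurableD.
apply/sn => //; have [sub1 sub2] := hC A AD.
have U0 : pr mu (N `|` \bigcup_i bdry (g i) A) = 0.
  have mb i := measurable_bdry (gen_meas G i) mA.
  have mU : measurable (\bigcup_i bdry (g i) A) by exact: bigcup_measurable.
  apply/eqP; rewrite eq_le pr_ge0 andbT.
  by apply: (le_trans (pr_setU_le _ mN mU)); rewrite N0 pr_bigcup0 // addr0.
apply: (pr_sub0 _ _ _ U0).
- exact: measurableI.
- apply: measurableU => //; apply: bigcup_measurable => i _.
  exact: measurable_bdry (gen_meas G i) mA.
- move=> x [_ hx]; have [|[i _ Cx]] := sub1 x hx; first by left.
  by right; exists i => //; apply: sub2.
Qed.

Lemma gens_asymptotic (nu : set T -> \bar R) (E : nat -> set T) : same_null D nu ->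
  (forall n, measurable (E n) /\ E n `<=` D) ->
  (forall i, cv0 (fun n => pr mu (bdry (g i) (E n)))) ->
  forall h, full_group D nu rel h -> 
  cv0 (fun n => pr mu ((h @` E n) `+` E n)).
Proof.
move=> sn hE cE f /[dup] [[_ _ mimf _]] /(full_group_bdry sn)[N [C [mN N0 mC hC]]].
have mB n : measurable ((f @` E n) `+` E n).
  have [mE ED] := hE n.
  by have mfA := mimf _ mE ED; apply: measurableU; exact: measurableD.
apply: (pr_split mB mC mN N0).
  by move=> n; have [mE ED] := hE n; have [] := hC _ ED.
move=> i e /(cE i)[n0 hn0]; exists n0 => n /hn0; apply: le_lt_trans.
have [mE ED] := hE n; have [_ sub] := hC _ ED.
apply: le_pr => //; first exact: measurableI.
exact: measurable_bdry (gen_meas G i) mE.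
Qed.

End gens_facts.

End dynamics.

(** * Strong ergodicity through generators *)

Section strong_ergodicity.
Context (R : realType) (d : measure_display) (T : measurableType d).
Variable mu : probability T R.
Hypothesis mdiag : measurable [set p : T * T | p.2 = p.1].

Definition gens_strongly_ergodic (D : set T) (g : nat -> T -> T) :=
  forall E : nat -> set T, (forall n, measurable (E n) /\ E n `<=` D) ->
    (forall i, cv0 (fun n => pr mu (bdry (g i) (E n)))) ->
    cv0 (fun n => pr mu (E n) * (pr mu D - pr mu (E n))).

Lemma strongly_ergodic_gens rel g : generators mu setT rel g ->
  strongly_ergodic setT mu rel -> gens_strongly_ergodic setT g.
Proof.
move=> G se E hE cE; have sn := same_null_mu mu.
have mE n : measurable (E n) by case: (hE n).
have h1 n : (mu (E n) * (1 - mu (E n)))%E = (pr mu (E n) * (pr mu setT - pr mu (E n)))%:E.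
  by rewrite prT prE // -EFinB -EFinM.
have h0 n : 0 <= pr mu (E n) * (pr mu setT - pr mu (E n)).
  by rewrite mulr_ge0 ?pr_ge0 // subr_ge0 prT pr_le1.
apply/(cv0_EFin h0 h1); apply: se => // f ff.
apply/(@cv0_EFin _ (fun n => pr mu ((f @` E n) `+` E n))).
- by move=> n; exact: pr_ge0.
- move=> n; rewrite prE //; have [_ _ mimf _] := ff.
  have mfE := mimf _ (mE n) (@subsetT _ _).
  by apply: measurableU; exact: measurableD.
- exact: (gens_asymptotic mdiag measurableT G sn hE cE ff).
Qed.

Lemma strongly_ergodic_of_gens D rel g : measurable D -> 0 < pr mu D ->
  generators mu D rel g -> gens_strongly_ergodic D g ->
  strongly_ergodic D (normalized_restr mu D) rel.
Proof.
move=> mD D0 G se E hE cE.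
have Dn0 : pr mu D != 0 by rewrite gt_eqF.
have sn := same_null_restr mD Dn0.
have mE n : measurable (E n) by case: (hE n).
have ED n : E n `<=` D by case: (hE n).
have nuE A : measurable A -> A `<=` D -> normalized_restr mu D A = (pr mu A / pr mu D)%:E.
  by move=> mA AD; rewrite normalized_restrE //; move/setIidr : AD => ->.
have le n : pr mu (E n) <= pr mu D by exact: le_pr.
have cv : cv0 (fun n => pr mu (E n) * (pr mu D - pr mu (E n))).
  apply: se => // i e e0.
  have mb n : measurable (bdry (g i) (E n)) by exact: measurable_bdry (gen_meas G i) (mE n).
  have bD n : bdry (g i) (E n) `<=` D.
    move=> x [[/ED //]|[/= Egx _]]; rewrite -(gen_inv G i x).
    by apply: (gen_stable G); exact: ED Egx.
  have := cE _ (gen_full_group G i sn).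
  rewrite (@cv0_EFin _ (fun n => pr mu (bdry (g i) (E n)) / pr mu D)).
  - move=> /(_ (e / pr mu D))[|N hN]; first by rewrite divr_gt0.
    by exists N => n /hN; rewrite ltr_pM2r // invr_gt0.
  - by move=> n; rewrite divr_ge0 ?pr_ge0.
  - by move=> n; rewrite (gen_bdry G) nuE.
apply/(@cv0_EFin _ (fun n => pr mu (E n) * (pr mu D - pr mu (E n)) / pr mu D ^+ 2)).
- by move=> n; rewrite divr_ge0 ?mulr_ge0 ?subr_ge0 ?pr_ge0 // exprn_ge0 // pr_ge0.
- move=> n; rewrite nuE // -EFinB -EFinM; congr EFin; by field.
- move=> e e0; have [|N hN] := cv (e * pr mu D ^+ 2).
    by rewrite mulr_gt0 // exprn_gt0.
  by exists N => n /hN; rewrite ltr_pdivrMr // exprn_gt0.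
Qed.

(** Strong ergodicity passes to subsets E of positive measure: asymptotically invariant subsets B n of E are pulled back
    to the whole space along maps of the relation that send almost every point into E. *)
Lemma gens_strongly_ergodic_restr rel g E gE :
  (forall x y, rel (x, y) -> rel (y, x)) ->
  (forall x y z, rel (x, y) -> rel (y, z) -> rel (x, z)) ->
  generators mu setT rel g -> gens_strongly_ergodic setT g ->
  measurable E -> 0 < pr mu E -> generators mu E (restr_rel rel E) gE ->
  gens_strongly_ergodic E gE.
Proof.
move=> sym trans G se mE E0 GE B hB cB.
have mB n : measurable (B n) by case: (hB n).
have BE n : B n `<=` E by case: (hB n).
have [N [mN N0 cov]] := gen_cover G.
have [NE [mNE NE0 covE]] := gen_cover GE.
pose gam i := if i is i'.+1 then g i' else id.
have mgam i : measurable_fun setT (gam i).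
  by case: i => [|i]; [exact: measurable_id|exact: gen_meas G i].
have pgam i A : measurable A -> pr mu (gam i @^-1` A) = pr mu A.
  by case: i => [//|i] mA; rewrite /gam (gen_pres G).
have mpg i A : measurable A -> measurable (gam i @^-1` A).
  by move=> mA; exact: measurable_preimage.
have rg j x : rel (x, g j x) by exact: (gen_rel G).
have relgam' i x : rel (x, gam i x).
  case: i => [|i] //=; have h := rg 0%N x.
  exact: trans h (sym _ _ h).
(* A strongly ergodic relation is ergodic, so the saturation of E is conull. *)
pose sat := \bigcup_i gam i @^-1` E.
have msat : measurable sat by apply: bigcup_measurable => i _; exact: mpg.
have satg j x : ~ N (g j x) -> sat x -> sat (g j x).
  move=> nN [i _ Ei].
  have [|k hk] := cov (g j x) (gam i x) _ nN.
    exact: trans (sym _ _ (rg j x)) (relgam' i x).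
  by exists k.+1 => //=; rewrite -hk.
have sat1 : pr mu sat = 1.
  have Esat : pr mu E <= pr mu sat by apply: le_pr => // x Ex; exists 0%N.
  have bd j : pr mu (bdry (g j) sat) = 0.
    have mgN : measurable (g j @^-1` N) by exact: measurable_preimage (gen_meas G j) mN.
    have U0 : pr mu (N `|` g j @^-1` N) = 0.
      apply/eqP; rewrite eq_le pr_ge0 andbT.
      by apply: (le_trans (pr_setU_le _ mN mgN)); rewrite N0 (gen_pres G) // N0 addr0.
    apply: (pr_sub0 _ _ _ U0); [exact: measurable_bdry (gen_meas G j) msat|exact: measurableU|].
    move=> x hx; apply: contrapT => /not_orP[nNx nNg].
    move/bdryE : hx; apply; split; first exact: satg.
    by rewrite -{2}(gen_inv G j x); apply: satg; rewrite (gen_inv G).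
  have := se (fun=> sat) (fun=> conj msat (@subsetT _ _)).
  have cb i : cv0 (fun=> pr mu (bdry (g i) sat)) by move=> e e0; exists 0%N => n _; rewrite bd.
  move=> /(_ cb)/cv0_cst; rewrite prT.
  have := pr_le1 mu msat; have : 0 < pr mu sat by exact: lt_le_trans Esat.
  nra.
(* On the piece L i of the saturation, gam i is the first of the maps that brings a point into E;
   B' n pulls B n back along these maps. It contains B n because gam 0 is the identity. *)
pose L i := gam i @^-1` E `\` \bigcup_(j in [set j | (j < i)%N]) gam j @^-1` E.
have mL i : measurable (L i).
  apply: measurableD; first exact: mpg.
  by apply: bigcup_measurable => j _; exact: mpg.
have LE i x : L i x -> E (gam i x) by case.
have Linj i j x : L i x -> L j x -> i = j.
  move=> [Ei ni] [Ej nj]; case: (ltngtP i j) => // ij.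
  - by case: nj; exists i.
  - by case: ni; exists j.
have Lsat x : sat x -> exists i, L i x.
  move=> [i _ Ei].
  have ex : exists i, `[< E (gam i x) >] by exists i; exact/asboolP.
  exists (ex_minn ex); case: ex_minnP => m /asboolP Pm mmin.
  by split => // -[j /= jm /asboolP Pj]; have := mmin j Pj; rewrite leqNgt jm.
pose B' n := \bigcup_i (L i `&` gam i @^-1` B n).
have mB' n : measurable (B' n).
  by apply: bigcup_measurable => i _; apply: measurableI => //; exact: mpg.
have B'E n i x : L i x -> (B' n x <-> B n (gam i x)).
  move=> Lx; split=> [[j _ [Lj Bj]]|Bx]; last by exists i.
  by rewrite (Linj _ _ _ Lx Lj).
have cB' j : cv0 (fun n => pr mu (bdry (g j) (B' n))).
  pose C (q : nat * nat * nat) := L q.1.1 `&` [set x | L q.1.2 (g j x) /\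
    gam q.1.2 (g j x) = gE q.2 (gam q.1.1 x)].
  have mC q : measurable (C q).
    apply: measurableI => //; apply: measurableI.
      by apply: (measurable_preimage (gen_meas G j)); exact: mL.
    have m1 : measurable_fun setT (fun x => gam q.1.2 (g j x)).
      exact: measurableT_comp (mgam _) (gen_meas G j).
    have m2 : measurable_fun setT (fun x => gE q.2 (gam q.1.1 x)).
      exact: measurableT_comp (gen_meas GE _) (mgam _).
    by have := measurable_fun_pair m2 m1 measurableT mdiag; rewrite setTI.
  pose M := (~` sat `|` g j @^-1` (~` sat)) `|` \bigcup_i gam i @^-1` NE.
  have mCs : measurable (~` sat) by exact: measurableC.
  have mgs : measurable (g j @^-1` (~` sat)) by exact: measurable_preimage (gen_meas G j) mCs.
  have mU : measurable (\bigcup_i gam i @^-1` NE) by apply: bigcup_measurable => i _; exact: mpg.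
  have mM : measurable M by apply: measurableU => //; exact: measurableU.
  have sat0 : pr mu (~` sat) = 0 by rewrite -setTD pr_setD // sat1 prT subrr.
  have M0 : pr mu M = 0.
    apply/eqP; rewrite eq_le pr_ge0 andbT.
    apply: (le_trans (pr_setU_le _ (measurableU _ _ mCs mgs) mU)).
    rewrite [X in _ + X]pr_bigcup0 ?addr0; first last.
    - by move=> i; rewrite pgam.
    - by move=> i; exact: mpg.
    apply: (le_trans (pr_setU_le _ mCs mgs)).
    by rewrite sat0 (gen_pres G) // sat0 addr0.
  apply: (@pr_split_count _ _ _ mu _ (fun n => bdry (g j) (B' n)) C M) => //.
  - by move=> n; exact: measurable_bdry (gen_meas G j) (mB' n).
  - move=> n x _; apply: contrapT => /not_orP[/not_orP[/not_orP[s1 s2] s3] s4].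
    have [i Li] := Lsat x (contrapT s1).
    have [i' Li'] := Lsat (g j x) (contrapT s2).
    have [k hk] : exists k, gam i' (g j x) = gE k (gam i x).
      apply: covE; last by move=> ?; apply: s3; exists i.
      split; last by split; exact: LE.
      exact: trans (sym _ _ (relgam' i x)) (trans _ _ _ (rg j x) (relgam' _ _)).
    by apply: s4; exists ((i, i'), k).
  - move=> [[i i'] k] e /(cB k)[n0 hn0]; exists n0 => n /hn0; apply: le_lt_trans.
    have mb := measurable_bdry (gen_meas GE k) (mB n).
    rewrite -[X in _ <= X](pgam i) //; apply: le_pr.
    + by apply: measurableI => //; exact: measurable_bdry (gen_meas G j) (mB' n).
    + exact: mpg.
    move=> x [/bdryE hx [/= Li [Li' e']]]; apply/bdryE => h; apply: hx.
    by rewrite (B'E _ _ _ Li) (B'E _ _ _ Li') e'.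
have /cv0_le : cv0 (fun n => pr mu (B' n) * (pr mu setT - pr mu (B' n))).
  by apply: se.
apply => n.
have BB' : pr mu (B n) <= pr mu (B' n).
  apply: le_pr => // x Bx; exists 0%N => //; split => //; split; first exact: (BE n).
  by move=> [k /=].
have EB : pr mu (E `\` B n) <= pr mu (setT `\` B' n).
  apply: le_pr; [exact: measurableD|exact: measurableD|].
  move=> x [Ex nB]; split => // -[i _ [[Ei ni] Bi]].
  case: i Ei ni Bi => // i _ ni _; apply: ni; exists 0%N => //.
have e1 := pr_setD mu mE (mB n) (BE n).
have e2 := pr_setD mu measurableT (mB' n) (@subsetT _ _).
rewrite e1 e2 in EB; rewrite ler_pM ?pr_ge0 // -e1 pr_ge0 //.
Qed.

End strong_ergodicity.

(** * Rounding an almost invariant distribution to a set *)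

Section weights.
Context (R : realType) (d : measure_display) (T : measurableType d).
Variable mu : probability T R.

Lemma integral_weighted (I : finType) (c : I -> R) (A : I -> set T) :
  (forall i, 0 <= c i) -> (forall i, measurable (A i)) ->
  (\int[mu]_x (\sum_i c i * \1_(A i) x)%:E = (\sum_i c i * pr mu (A i))%:E)%E.
Proof.
move=> c0 mA.
under eq_integral => x _ do rewrite -sumEFin.
rewrite ge0_integral_sum //.
- rewrite -sumEFin; apply: eq_bigr => i _.
  under eq_integral => x _ do rewrite EFinM.
  have mi : measurable_fun setT (fun x => (\1_(A i) x)%:E : \bar R).
    by apply/measurable_EFinP; exact: measurable_indic.
  have i0 x : setT x -> (0 <= (\1_(A i) x)%:E :> \bar R)%E by move=> _; rewrite lee_fin.
  have ci : (0 <= (c i)%:E)%E by rewrite lee_fin; exact: c0.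
  rewrite (ge0_integralZl mu measurableT mi i0 ci).
  by rewrite integral_indic // setIT EFinM -prE.
- move=> i; apply/measurable_EFinP; apply: measurable_funM => //.
- by move=> i x _; rewrite lee_fin mulr_ge0.
Qed.

(** Integration of a pointwise inequality between weighted sums of indicators. *)
Lemma le_weighted (I J : finType) (c : I -> R) (A : I -> set T)
    (e : J -> R) (B : J -> set T) :
  (forall i, 0 <= c i) -> (forall i, measurable (A i)) ->
  (forall i, 0 <= e i) -> (forall i, measurable (B i)) ->
  (forall x, \sum_i c i * \1_(A i) x <= \sum_j e j * \1_(B j) x) ->
  \sum_i c i * pr mu (A i) <= \sum_j e j * pr mu (B j).
Proof.
move=> c0 mA e0 mB h; rewrite -lee_fin -!integral_weighted //.
apply: ge0_le_lower_integral => x _; last by rewrite lee_fin.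
by rewrite lee_fin; apply: sumr_ge0 => i _; rewrite mulr_ge0.
Qed.

End weights.

Section counts.
Context (R : realType).
Implicit Types u v : R.

Lemma sum_threshold (n m : nat) : (m <= n)%N -> \sum_(k < n) ((k < m)%N%:R : R) = m%:R.
Proof.
elim: n m => [|n IH] m; first by rewrite leqn0 => /eqP ->; rewrite big_ord0.
rewrite leq_eqVlt => /predU1P[->|]; last first.
  by rewrite ltnS => mn; rewrite big_ord_recr /= IH // ltnNge mn addr0.
rewrite (eq_bigr (fun=> 1)) ?sumr_const ?card_ord // => k _.
by rewrite ltn_ord.
Qed.

(** On the scale n * pi, the number of thresholds below a value is the value up to 1. *)
Lemma threshold_count (n : nat) u : 0 <= u -> u <= n%:R ->
  u - 1 <= \sum_(k < n) ((k.+1%:R <= u)%R)%:R.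
Proof.
move=> u0 un.
under eq_bigr => k _ do rewrite -truncn_gt_nat.
rewrite sum_threshold; first by rewrite lerBlDr natr1 ltW // truncnS_gt.
by rewrite -(ler_nat R); apply: le_trans un; rewrite truncn_le.
Qed.

Lemma threshold_diff (n : nat) u v : 0 <= u -> u <= n%:R -> 0 <= v -> v <= n%:R ->
  \sum_(k < n) (((k.+1%:R <= u)%R != (k.+1%:R <= v)%R))%:R <= `|u - v| + 1.
Proof.
wlog uv : u v / u <= v.
  move=> h u0 un v0 vn; have [uv|/ltW vu] := leP u v; first exact: h.
  by under eq_bigr => k _ do rewrite eq_sym; rewrite distrC; exact: h.
move=> u0 un v0 vn.
have nu : (Num.truncn u <= n)%N.
  by rewrite -(ler_nat R); apply: le_trans un; rewrite truncn_le.
have nv : (Num.truncn v <= n)%N.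
  by rewrite -(ler_nat R); apply: le_trans vn; rewrite truncn_le.
rewrite (eq_bigr (fun k : 'I_n => (k < Num.truncn v)%N%:R - (k < Num.truncn u)%N%:R)).
  rewrite sumrB !sum_threshold // distrC ger0_norm ?subr_ge0 //.
  have := truncnS_gt u; rewrite -natr1.
  have : (Num.truncn v)%:R <= v by rewrite truncn_le.
  lra.
move=> k _; rewrite -!truncn_gt_nat.
have le_uv : (Num.truncn u <= Num.truncn v)%N by exact: le_truncn.
case: (ltnP k (Num.truncn u)) => ku /=.
  by rewrite (leq_trans ku le_uv) subrr.
by case: (ltnP k (Num.truncn v)) => kv /=; rewrite subr0.
Qed.

End counts.

Section rounding.
Context (R : realType) (d : measure_display) (T : measurableType d).
Variable mu : probability T R.
Variables (E : set T) (g : nat -> T -> T).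
Hypothesis mE : measurable E.
Hypothesis E0 : 0 < pr mu E.
Hypothesis mg : forall i, measurable_fun setT (g i).

Definition perimeter (N : nat) (A : set T) := \sum_(l < N) pr mu (bdry (g l) A).

Lemma perimeter0 N : perimeter N set0 = 0.
Proof.
apply: big1 => l _; rewrite (_ : bdry _ _ = set0) ?pr0 //.
by rewrite /bdry preimage_set0 setYK.
Qed.

Lemma perimeterU N A B : measurable A -> measurable B ->
  perimeter N (A `|` B) <= perimeter N A + perimeter N B.
Proof.
move=> mA mB; rewrite -big_split /=; apply: ler_sum => l _.
have mbA := measurable_bdry (mg l) mA; have mbB := measurable_bdry (mg l) mB.
apply: le_trans (pr_setU_le _ mbA mbB); apply: le_pr.
- exact: measurable_bdry (mg l) (measurableU _ _ mA mB).
- exact: measurableU.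
- exact: bdryU.
Qed.

(** The sets C q cover G nearly once on average, with total perimeter at most eta. As long as B has measure below V / 3,
    at least half of the measure remains to be covered, hence some C q has a perimeter proportional to its gain over B. Adding it
    keeps the ratio of perimeter to measure, and the measure cannot jump over [V / 3, V / 2] since C q is small. *)
Lemma greedy_union (I : finType) (C : I -> set T) (a eta : R) (N : nat) (G : set T) :
  (forall q, measurable (C q)) -> (forall q, C q `<=` E) ->
  0 <= a -> 0 < eta ->
  measurable G -> G `<=` E -> pr mu (E `\` G) <= pr mu E / 100 ->
  (forall x, G x -> 9 / 10 <= \sum_q a * \1_(C q) x) ->
  \sum_q a * perimeter N (C q) <= eta ->
  (forall q, pr mu (C q) <= pr mu E / 10) ->
  exists B, [/\ measurable B, B `<=` E, pr mu E / 3 <= pr mu B,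
    pr mu B <= pr mu E / 2 & perimeter N B <= 4 * eta].
Proof.
move=> mC CE a0 eta0 mG GE EG cov peri small.
pose V := pr mu E; have V0 : 0 < V := E0; rewrite -/V in EG small *.
(* With this ratio a greedy set, of measure at most V, has perimeter at most kap * V = 4 * eta. *)
pose kap := 4 * eta / V.
have kap0 : 0 < kap by rewrite divr_gt0 // mulr_gt0.
pose good B := [/\ measurable B, B `<=` E, V / 3 <= pr mu B,
    pr mu B <= V / 2 & perimeter N B <= 4 * eta].
have leV B : measurable B -> B `<=` E -> pr mu B <= V by move=> mB BE; exact: le_pr.
have gain B : measurable B -> pr mu B < V / 3 ->
    exists q, 0 < pr mu (C q `\` B) /\ perimeter N (C q) <= kap * pr mu (C q `\` B).
  move=> mB B3; apply: contrapT => nex.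
  have h q : kap * pr mu (C q `\` B) <= perimeter N (C q).
    rewrite leNgt; apply/negP => hq; apply: nex; exists q; split; last exact: ltW.
    rewrite lt_neqAle pr_ge0 andbT eq_sym; apply/eqP => e.
    move: hq; rewrite e mulr0 ltNge => /negP; apply.
    by apply: sumr_ge0 => l _; exact: pr_ge0.
  have h1 : kap * (\sum_q a * pr mu (C q `\` B)) <= eta.
    apply: le_trans peri; rewrite mulr_sumr; apply: ler_sum => q _.
    by rewrite mulrCA ler_wpM2l.
  have mGB : measurable (G `\` B) by exact: measurableD.
  have h2 : 9 / 10 * pr mu (G `\` B) <= \sum_q a * pr mu (C q `\` B).
    have := @le_weighted _ _ _ mu 'I_1 I (fun=> 9 / 10) (fun=> G `\` B) (fun=> a) (fun q => C q `\` B).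
    rewrite big_ord1; apply => //.
    - by move=> q; exact: measurableD.
    - move=> x; rewrite big_ord1; have [[Gx nBx]|nx] := pselect ((G `\` B) x).
        rewrite indicE mem_set // mulr1; apply: le_trans (cov x Gx) _.
        apply: ler_sum => q _; rewrite ler_wpM2l // !indicE.
        by have [Cx|nCx] := pselect (C q x); [rewrite !mem_set|rewrite memNset].
      rewrite indicE memNset // mulr0; apply: sumr_ge0 => q _.
      by rewrite mulr_ge0.
  have h3 : V <= pr mu (E `\` G) + (pr mu (G `\` B) + pr mu B).
    have mEG : measurable (E `\` G) by exact: measurableD.
    have := pr_setU_le mu mGB mB; have := pr_setU_le mu mEG (measurableU _ _ mGB mB).
    have : V <= pr mu (E `\` G `|` (G `\` B `|` B)).
      apply: le_pr => //; first by apply: measurableU => //; exact: measurableU.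
      move=> x Ex; have [Gx|nGx] := pselect (G x); last by left.
      by right; have [Bx|nBx] := pselect (B x); [right|left].
    lra.
  have h4 : V / 2 <= \sum_q a * pr mu (C q `\` B) by lra.
  have : kap * (V / 2) = 2 * eta by rewrite /kap; field; rewrite gt_eqF.
  have : kap * (V / 2) <= eta by apply: le_trans h1; rewrite ler_pM2l.
  lra.
apply: contrapT => nogood.
(* If the measure never reaches V / 3, each step adds a new member of the finite family,
   as the gain of a member already used is zero; so more than #|I| steps are impossible. *)
have step t : exists B (s : {set I}), [/\ measurable B, B `<=` E, pr mu B < V / 3,
    perimeter N B <= kap * pr mu B & #|s| = t /\ forall q, q \in s -> C q `<=` B].
  elim: t => [|t [B [s [mB BE B3 pB [st sB]]]]].
    exists set0, finset.set0; split => //.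
    - by rewrite pr0 divr_gt0.
    - by rewrite perimeter0 pr0 mulr0.
    - by split; [rewrite cards0|move=> q; rewrite finset.inE].
  have [q [q0 pq]] := gain B mB B3.
  have mU : measurable (B `|` C q) by exact: measurableU.
  have eU : pr mu (B `|` C q) = pr mu B + pr mu (C q `\` B).
    rewrite -pr_setU ?setUDl //; [|exact: measurableD|].
    - by congr pr; apply/seteqP; split => x [Bx|Cx]; [left|
        have [Bx|nBx] := pselect (B x); [left|right]|left|right; case: Cx].
    - by rewrite -subset0 => x [Bx [_ nB]].
  have pU : perimeter N (B `|` C q) <= kap * pr mu (B `|` C q).
    apply: (le_trans (perimeterU N mB (mC q))).
    by rewrite eU mulrDr lerD.
  have UE : B `|` C q `<=` E by move=> x [/BE|/CE].
  have U2 : pr mu (B `|` C q) <= V / 2.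
    have := small q; have := pr_setU_le mu mB (mC q).
    move: B3 V0; lra.
  exists (B `|` C q), (q |: s)%SET; split => //.
  - rewrite ltNge; apply/negP => h3; apply: nogood; exists (B `|` C q); split => //.
    apply: (le_trans pU); have <- : kap * V = 4 * eta by rewrite /kap divfK ?gt_eqF.
    by rewrite ler_pM2l //; exact: leV.
  - split.
      rewrite cardsU1 st; case: (boolP (q \in s)) => //= /sB qB.
      move: q0; rewrite (_ : _ `\` _ = set0) ?pr0 ?ltxx //.
      by rewrite -subset0 => x [/qB].
    by move=> q'; rewrite finset.inE finset.in_set1 => /orP[/eqP ->|/sB sub] x Cx; [right|left; exact: sub].
have [B [s [_ _ _ _ [hs _]]]] := step #|I|.+1.
by have := max_card s; rewrite hs ltnn.
Qed.

End rounding.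

Section cuts.
Context (R : realType) (d : measure_display) (T : measurableType d).
Variable mu : probability T R.
Variables (E : set T) (g : nat -> T -> T).
Hypothesis mE : measurable E.
Hypothesis E0 : 0 < pr mu E.
Hypothesis mg : forall i, measurable_fun setT (g i).

Lemma measurable_gt (f : T -> R) r : measurable_fun setT f -> measurable [set x | r < f x].
Proof.
move=> mf; rewrite (_ : [set x | _] = setT `&` f @^-1` `]r, +oo[%classic).
  exact: mf.
by rewrite setTI; apply/seteqP; split => x /=; rewrite in_itv /= andbT.
Qed.

(** Coarea formula. The level sets C (z, k) of the functions n * pi z cover almost all of G once on average, their
    boundaries are controlled by the l1 distance of the distributions at x and g l x, and they lie in the small
    supports of the functions pi z; greedy_union applies. *)
Lemma round_distribution (K N : nat) (pi : nat -> T -> R) (G : set T)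
    (Bad : nat -> set T) (del : R) :
  (forall z, measurable_fun setT (pi z)) -> (forall z x, 0 <= pi z x) ->
  (forall x, \sum_(z < K) pi z x <= 1) ->
  measurable G -> G `<=` E -> pr mu (E `\` G) <= pr mu E / 100 ->
  (forall x, G x -> 19 / 20 <= \sum_(z < K) pi z x) ->
  (forall z, (z < K)%N -> pr mu (E `&` [set x | 0 < pi z x]) <= pr mu E / 10) ->
  (forall l x, E x <-> E (g l x)) ->
  0 < del -> del <= 1 / 20 ->
  (forall l, measurable (Bad l)) -> (forall l, (l < N)%N -> pr mu (Bad l) <= del) ->
  (forall l x, (l < N)%N -> E x -> ~ Bad l x ->
     \sum_(z < K) `|pi z x - pi z (g l x)| <= del) ->
  exists B, [/\ measurable B, B `<=` E, pr mu E / 3 <= pr mu B,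
    pr mu B <= pr mu E / 2 & perimeter mu g N B <= 20 * N.+1%:R * del].
Proof.
move=> mpi pi0 pi1 mG GE EG piG small Eg del0 del1 mBad Bad1 hBad.
(* The thresholds are the multiples of 1 / n; each of the K labels costs a rounding error 1 / n,
   which is at most del in total. *)
pose n := (Num.truncn (K%:R / del)).+1.
have n0 : 0 < n%:R :> R by rewrite ltr0n.
pose a : R := n%:R^-1.
have a0 : 0 < a by rewrite invr_gt0.
have aK : K%:R * a <= del.
  rewrite /a ler_pdivrMr // mulrC -ler_pdivrMr //; apply: ltW; exact: truncnS_gt.
have an : a * n%:R = 1 by rewrite mulVf // gt_eqF.
pose C (q : 'I_K * 'I_n) := E `&` [set x | (q.2 : nat).+1%:R <= n%:R * pi q.1 x].
have mC q : measurable (C q).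
  apply: measurableI => //; rewrite -[X in measurable X]setTI.
  apply: (@measurable_fun_le _ _ _ setT (cst ((q.2 : nat).+1%:R))) => //.
  by apply: measurable_funM => //; exact: mpi.
have CE q : C q `<=` E by move=> x [].
have u0 z x : 0 <= n%:R * pi z x by rewrite mulr_ge0 // ltW.
have un (z : 'I_K) x : n%:R * pi z x <= n%:R.
  rewrite -[X in _ <= X]mulr1 ler_pM2l //; apply: le_trans (pi1 x).
  rewrite (bigD1 z) //= lerDl; exact: sumr_ge0.
have CI q x : E x -> \1_(C q) x = ((q.2 : nat).+1%:R <= n%:R * pi q.1 x)%R%:R :> R.
  move=> Ex; rewrite indicE; congr (_%:R); apply: congr1.
  by apply/idP/idP => [/set_mem[]|h] //; exact/mem_set.
have eta0 : 0 < 5 * N.+1%:R * del by rewrite !mulr_gt0.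
have [|||B [mB BE B3 B2 pB]] := greedy_union (N := N) (G := G) mE E0 mg mC CE (ltW a0) eta0 mG GE EG.
- move=> x Gx; rewrite -mulr_sumr.
  rewrite -(pair_bigA _ (fun z k => \1_(C (z, k)) x)) /=.
  have h : \sum_(z < K) (n%:R * pi z x - 1) <= \sum_(z < K) \sum_(k < n) \1_(C (z, k)) x.
    apply: ler_sum => z _; apply: le_trans (threshold_count (u0 z x) (un z x)) _.
    by rewrite le_eqVlt; apply/orP; left; apply/eqP/eq_bigr => k _; rewrite CI //; exact: GE.
  rewrite sumrB -mulr_sumr sumr_const card_ord in h.
  have h2 := ler_wpM2l (ltW a0) h.
  apply: le_trans h2; rewrite mulrBr mulrA an mul1r [a * _]mulrC.
  have := piG x Gx; rewrite -[1 *+ K]/(K%:R); lra.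
- have hl (l : 'I_N) : \sum_q a * pr mu (bdry (g l) (C q)) <= 5 * del.
    pose D (j : bool) := if j then E else Bad l.
    pose e (j : bool) : R := if j then 2 * del else 3.
    have e0 j : 0 <= e j by case: j => //=; rewrite mulr_ge0 // ltW.
    have : \sum_q a * pr mu (bdry (g l) (C q)) <= \sum_j e j * pr mu (D j).
      apply: le_weighted => //.
      - by move=> _; exact: ltW.
      - by move=> q; exact: measurable_bdry (mg l) (mC q).
      - by move=> j; rewrite /D; case: j.
      move=> x; rewrite big_bool /=.
      have [Ex|nEx] := pselect (E x); last first.
        rewrite (_ : \sum_q _ = 0); last first.
          apply: big1 => q _; rewrite indicE memNset ?mulr0 // => -[[[] //]|[[/= h _] _]].
          by apply: nEx; exact: (Eg l x).2.
        apply: addr_ge0; rewrite mulr_ge0 //; first by rewrite mulr_ge0 // ltW.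
      have BI q : \1_(bdry (g l) (C q)) x =
          (((q.2 : nat).+1%:R <= n%:R * pi q.1 x)%R != ((q.2 : nat).+1%:R <= n%:R * pi q.1 (g l x))%R)%:R :> R.
        rewrite indicE; congr (_%:R); apply: congr1.
        have Egx : E (g l x) by exact: (Eg l x).1.
        apply/idP/idP => [/set_mem/bdryE h|h].
          by apply/negP => /eqP e'; apply: h; rewrite /C /= e'; split => -[].
        apply/mem_set/bdryE => -[h1 h2]; move/negP : h; apply; apply/eqP.
        apply/idP/idP => h; first by have [] : C q (g l x) by apply: h1.
        by have [] : C q x by apply: h2.
      have tot : \sum_q a * \1_(bdry (g l) (C q)) x <=
          \sum_(z < K) `|pi z x - pi z (g l x)| + del.
        rewrite -mulr_sumr -(pair_bigA _ (fun z k => \1_(bdry (g l) (C (z, k))) x)) /=.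
        have h : \sum_(z < K) \sum_(k < n) \1_(bdry (g l) (C (z, k))) x <=
            \sum_(z < K) (n%:R * `|pi z x - pi z (g l x)| + 1).
          apply: ler_sum => z _; rewrite (eq_bigr _ (fun k _ => BI (z, k))) /=.
          apply: le_trans (threshold_diff (u0 _ _) (un _ _) (u0 _ _) (un _ _)) _.
          by rewrite -mulrBr normrM (ger0_norm (ltW n0)).
        rewrite big_split /= -mulr_sumr sumr_const card_ord in h.
        apply: le_trans (ler_wpM2l (ltW a0) h) _.
        rewrite mulrDr mulrA an mul1r lerD2l.
        by rewrite mulrC -[1 *+ K]/(K%:R).
      rewrite indicE mem_set // mulr1; apply: (le_trans tot).
      have [Bx|nBx] := pselect (Bad l x).
        rewrite indicE mem_set // mulr1.
        have : \sum_(z < K) `|pi z x - pi z (g l x)| <= 1 + 1.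
          apply: le_trans (lerD (pi1 x) (pi1 (g l x))); rewrite -big_split /=.
          apply: ler_sum => z _; apply: le_trans (ler_normB _ _) _.
          by rewrite !ger0_norm.
        lra.
      by rewrite indicE memNset // mulr0; have := hBad l x (ltn_ord l) Ex nBx; lra.
    rewrite big_bool /= => h; apply: (le_trans h).
    have := Bad1 l (ltn_ord l); have := pr_le1 mu mE => h1 h2.
    have : 2 * del * pr mu E <= 2 * del * 1 by rewrite ler_pM2l // mulr_gt0.
    lra.
  have -> : \sum_q a * perimeter mu g N (C q) =
      \sum_(l < N) \sum_q a * pr mu (bdry (g l) (C q)).
    by rewrite exchange_big /=; apply: eq_bigr => q _; rewrite mulr_sumr.
  apply: (@le_trans _ _ (\sum_(l < N) 5 * del)); first exact: ler_sum.
  rewrite sumr_const card_ord -mulr_natr -natr1; lra.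
- move=> q; apply: le_trans (small q.1 (ltn_ord _)).
  apply: le_pr => //.
    by apply: measurableI => //; apply: measurable_gt; exact: mpi.
  move=> x [Ex /= h]; split => //=.
  have : 0 < n%:R * pi q.1 x by apply: lt_le_trans h; rewrite ltr0n.
  by rewrite pmulr_rgt0.
by exists B; split => //; apply: (le_trans pB); lra.
Qed.

End cuts.

(** * Pushing forward squared moduli *)

Section finite_sums.
Context (R : realType) (C : eqType).
Implicit Types (U V : seq C) (f a b : C -> R).

Lemma sum_sub_filter U V f : uniq U -> uniq V -> {subset U <= V} ->
  \sum_(c <- U) f c = \sum_(c <- V | c \in U) f c.
Proof.
move=> uU uV UV; rewrite -[RHS]big_filter; apply: perm_big.
apply: uniq_perm => //; first exact: filter_uniq.
by move=> c; rewrite mem_filter; case: (boolP (c \in U)) => //= /UV ->.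
Qed.

Lemma le_sum_sub U V f : (forall c, 0 <= f c) -> uniq U -> uniq V -> {subset U <= V} ->
  \sum_(c <- U) f c <= \sum_(c <- V) f c.
Proof.
move=> f0 uU uV UV; rewrite (sum_sub_filter f uU uV UV).
rewrite [leRHS](bigID (fun c => c \in U)) /= lerDl.
by apply: sumr_ge0.
Qed.

(** Summed over an index set, this bounds the l1 distance of squares by the l2 distance, at the best choice of s. *)
Lemma sqr_diff_le (s x y : R) : 0 < s -> 0 <= x -> 0 <= y ->
  `|x ^+ 2 - y ^+ 2| <= (x - y) ^+ 2 / (2 * s) + s * (x ^+ 2 + y ^+ 2).
Proof.
move=> s0 x0 y0.
have -> : x ^+ 2 - y ^+ 2 = (x - y) * (x + y) by ring.
rewrite normrM (ger0_norm (addr_ge0 x0 y0)) -[(x - y) ^+ 2]real_normK ?num_real //.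
set t := `|x - y|; set w := x + y.
(* Young inequality. *)
have h : t * w <= t ^+ 2 / (2 * s) + s * w ^+ 2 / 2.
  have -> : t ^+ 2 / (2 * s) + s * w ^+ 2 / 2 = (t - s * w) ^+ 2 / (2 * s) + t * w.
    by field; rewrite gt_eqF.
  by rewrite lerDr divr_ge0 ?sqr_ge0 ?mulr_ge0 ?(ltW s0).
apply: (le_trans h); rewrite lerD2l -mulrA ler_pM2l //.
by have := sqr_ge0 (x - y); rewrite /w; lra.
Qed.

(** The weights a ^ 2 and b ^ 2 at two related points are close in l1, and the labels phi and psi agree on the common
    classes; so the distributions of the labels are close. The classes seen from one point only carry mass at most del. *)
Lemma dist_pushforward (cx cy : seq C) (a b : C -> R) (phi psi : C -> nat) (K : nat)
    (s del : R) :
  uniq cx -> uniq cy -> (forall c, 0 <= a c) -> (forall c, 0 <= b c) ->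
  (forall c, c \in cx -> c \in cy -> phi c = psi c) ->
  0 < s ->
  \sum_(c <- undup (cx ++ cy)) a c ^+ 2 <= 1 ->
  \sum_(c <- undup (cx ++ cy)) b c ^+ 2 <= 1 ->
  1 - del <= \sum_(c <- cx) a c ^+ 2 ->
  1 - del <= \sum_(c <- cy) b c ^+ 2 ->
  \sum_(c <- undup (cx ++ cy)) (a c - b c) ^+ 2 <= s ^+ 2 ->
  \sum_(z < K) `|\sum_(c <- cx) a c ^+ 2 * (phi c == z)%:R
               - \sum_(c <- cy) b c ^+ 2 * (psi c == z)%:R| <= 3 * s + 2 * del.
Proof.
move=> ux uy a0 b0 phipsi s0 A1 B1 Ax By AB.
set U := undup (cx ++ cy) in A1 B1 AB *.
have uU : uniq U by exact: undup_uniq.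
have xU : {subset cx <= U} by move=> c cx'; rewrite mem_undup mem_cat cx'.
have yU : {subset cy <= U} by move=> c cy'; rewrite mem_undup mem_cat cy' orbT.
pose D c := `|a c ^+ 2 - b c ^+ 2|.
pose G c := D c + (c \notin cy)%:R * b c ^+ 2 + (c \notin cx)%:R * a c ^+ 2.
have G0 c : 0 <= G c.
  by rewrite /G /D !addr_ge0 // mulr_ge0 // ?ler0n // sqr_ge0.
have h1 : \sum_(z < K) `|\sum_(c <- cx) a c ^+ 2 * (phi c == z)%:R
               - \sum_(c <- cy) b c ^+ 2 * (psi c == z)%:R| <= \sum_(c <- U) G c.
  apply: (@le_trans _ _ (\sum_(z < K) \sum_(c <- U)
      `|(c \in cx)%:R * a c ^+ 2 * (phi c == z)%:R -
        (c \in cy)%:R * b c ^+ 2 * (psi c == z)%:R|)).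
    apply: ler_sum => z _.
    rewrite (sum_sub_filter _ ux uU xU) (sum_sub_filter _ uy uU yU).
    rewrite [X in `|X - _|]big_mkcond [X in `|_ - X|]big_mkcond /= -sumrB.
    apply: le_trans (ler_norm_sum _ _ _) _.
    apply: ler_sum => c _.
    by case: (c \in cx); case: (c \in cy); rewrite ?mul1r ?mul0r.
  rewrite exchange_big /= big_seq [leRHS]big_seq; apply: ler_sum => c cU.
  have one (th : C -> nat) (r : R) : 0 <= r -> \sum_(z < K) r * (th c == z)%:R <= r.
    move=> r0; rewrite -mulr_sumr -[leRHS]mulr1 ler_wpM2l //.
    have [cK|Kc] := ltnP (th c) K.
      rewrite (bigD1 (Ordinal cK)) //= eqxx big1 ?addr0 // => z zc.
      by case: eqP => // e; case/eqP: zc; apply/val_inj.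
    by rewrite big1 // => z _; case: eqP => // e; move: Kc; rewrite e leqNgt ltn_ord.
  rewrite /G; move: cU; rewrite mem_undup mem_cat.
  case: (boolP (c \in cx)) => cx'; case: (boolP (c \in cy)) => cy' //= _.
  - apply: (@le_trans _ _ (D c)); last by rewrite /= !mul0r !addr0.
    apply: le_trans (one phi _ (normr_ge0 _)).
    apply: ler_sum => z _; rewrite (phipsi c) // !mul1r -mulrBl normrM.
    by rewrite (ger0_norm (ler0n _ _)).
  - apply: (@le_trans _ _ (D c + b c ^+ 2)); last by rewrite /= mul0r mul1r addr0.
    apply: (@le_trans _ _ (a c ^+ 2)).
      apply: le_trans (one phi _ (sqr_ge0 _)); apply: ler_sum => z _.
      by rewrite !mul1r !mul0r subr0 ger0_norm // mulr_ge0 ?sqr_ge0 // ler0n.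
    by have := ler_norm (a c ^+ 2 - b c ^+ 2); rewrite /D; lra.
  - apply: (@le_trans _ _ (D c + a c ^+ 2)); last by rewrite /= mul0r mul1r addr0.
    apply: (@le_trans _ _ (b c ^+ 2)).
      apply: le_trans (one psi _ (sqr_ge0 _)); apply: ler_sum => z _.
      by rewrite !mul1r !mul0r sub0r normrN ger0_norm // mulr_ge0 ?sqr_ge0 // ler0n.
    by have := ler_norm (b c ^+ 2 - a c ^+ 2); rewrite distrC /D; lra.
apply: (le_trans h1); rewrite /G !big_split /=.
have h2 : \sum_(c <- U) (c \notin cy)%:R * b c ^+ 2 <= del.
  have := B1; rewrite (bigID (fun c => c \in cy)) /= -(sum_sub_filter _ uy uU yU).
  rewrite [X in _ + X <= 1](_ : _ = \sum_(c <- U) (c \notin cy)%:R * b c ^+ 2).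
    by move: By; lra.
  rewrite big_mkcond /=; apply: eq_bigr => c _.
  by case: (c \in cy); rewrite /= ?mul0r ?mul1r.
have h3 : \sum_(c <- U) (c \notin cx)%:R * a c ^+ 2 <= del.
  have := A1; rewrite (bigID (fun c => c \in cx)) /= -(sum_sub_filter _ ux uU xU).
  rewrite [X in _ + X <= 1](_ : _ = \sum_(c <- U) (c \notin cx)%:R * a c ^+ 2).
    by move: Ax; lra.
  rewrite big_mkcond /=; apply: eq_bigr => c _.
  by case: (c \in cx); rewrite /= ?mul0r ?mul1r.
have h4 : \sum_(c <- U) D c <= 3 * s.
  apply: (@le_trans _ _ (\sum_(c <- U) ((a c - b c) ^+ 2 / (2 * s) +
      s * (a c ^+ 2 + b c ^+ 2)))).
    by apply: ler_sum => c _; exact: sqr_diff_le.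
  rewrite big_split /= -mulr_suml -mulr_sumr big_split /=.
  have e1 : (\sum_(c <- U) (a c - b c) ^+ 2) / (2 * s) <= s / 2.
    rewrite ler_pdivrMr ?mulr_gt0 //; apply: (le_trans AB).
    by rewrite le_eqVlt; apply/orP; left; apply/eqP; field.
  have e2 : s * (\sum_(c <- U) a c ^+ 2 + \sum_(c <- U) b c ^+ 2) <= s * 2.
    by rewrite ler_pM2l //; lra.
  move: e1 e2; lra.
lra.
Qed.

End finite_sums.

(** * Moduli of the coamenability vectors *)

Section l2norm.
Context (R : realType) (I : choiceType).
Implicit Types (Q : set I) (f : I -> R[i]) (U : seq I).

Lemma fsum_seq (U : seq I) (a : I -> R) : uniq U ->
  (\sum_(c \in [set` U]) (a c)%:E = (\sum_(c <- U) a c)%:E)%E.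
Proof. by move=> uU; rewrite -fsbig_seq // sumEFin. Qed.

Lemma l2norm_sum_le Q f U t : 0 <= t -> uniq U -> (forall c, c \in U -> Q c) ->
  (l2norm Q f <= t%:E)%E -> \sum_(c <- U) Normc.normc (f c) ^+ 2 <= t ^+ 2.
Proof.
move=> t0 uU UQ; rewrite /l2norm.
have -> : t%:E = sqrte (t ^+ 2)%:E by rewrite /= sqrtr_sqr ger0_norm.
rewrite lee_sqrt ?lee_fin ?sqr_ge0 // => h.
rewrite -lee_fin; apply: le_trans h; apply: esum_ge; exists [set` U].
  by split; [exact: finite_seq|move=> c /= /UQ].
by rewrite fsum_seq.
Qed.

Lemma l2norm1_approx Q f del : l2norm Q f = 1%E -> 0 < del ->
  exists U, [/\ uniq U, forall c, c \in U -> Q c &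
    1 - del <= \sum_(c <- U) Normc.normc (f c) ^+ 2].
Proof.
move=> h del0; have : \esum_(c in Q) (Normc.normc (f c) ^+ 2)%:E = 1%E.
  rewrite -[LHS]sqr_sqrte; first by rewrite -/(l2norm Q f) h expe2 mule1.
  by apply: esum_ge0 => c _; rewrite lee_fin sqr_ge0.
move=> e1; have : ((1 - del)%:E < \esum_(c in Q) (Normc.normc (f c) ^+ 2)%:E)%E.
  by rewrite e1 lte_fin ltrBlDr ltrDl.
move=> /ereal_sup_gt[_ [X [fX XQ] <-] hX].
exists (finmap.enum_fset (fset_set X)); split.
- exact: finmap.fset_uniq.
- by move=> c cX; apply: XQ; move: cX; rewrite in_fset_set // => /set_mem.
- rewrite -lee_fin -fsum_seq ?finmap.fset_uniq //.
  by rewrite (fset_setK fX); exact: ltW.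
Qed.

Lemma normc_reverse_triangle (x y : R[i]) :
  (Normc.normc x - Normc.normc y) ^+ 2 <= Normc.normc (x - y) ^+ 2.
Proof.
have n0 (z : R[i]) : 0 <= Normc.normc z by case: z => a b; exact: sqrtr_ge0.
have h1 := le_normcD (x - y) y; rewrite subrK in h1.
have h2 := le_normcD (y - x) x; rewrite subrK in h2.
have h3 : Normc.normc (y - x) = Normc.normc (x - y) by rewrite -normcN opprB.
rewrite -ler_sqrt ?sqr_ge0 // !sqrtr_sqr [leRHS]ger0_norm //.
by rewrite ler_norml; move: h1 h2; rewrite h3; lra.
Qed.

Lemma normcE2 (x : R[i]) : Normc.normc x = Num.sqrt (complex.Re x ^+ 2 + complex.Im x ^+ 2).
Proof. by case: x. Qed.

Lemma normc_ge0 (x : R[i]) : 0 <= Normc.normc x.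
Proof. by rewrite normcE2 sqrtr_ge0. Qed.

End l2norm.

Section coam.
Context (R : realType) (d : measure_display) (T : measurableType d).
Variable mu : probability T R.
Variables (E : set T) (RE SE : set (T * T)) (g : nat -> T -> T).
Hypotheses (mE : measurable E) (E0 : 0 < pr mu E).
Hypotheses (bR : borel_equivalence E RE) (bS : borel_equivalence E SE) (SR : SE `<=` RE).
Hypothesis G : generators mu E RE g.

Let nu := normalized_restr mu E.

Lemma negligible_restr (P : T -> Prop) : {ae nu, forall x, E x -> P x} ->
  exists N, [/\ measurable N, pr mu N = 0 & forall x, E x -> ~ N x -> P x].
Proof.
move=> [N [mN nuN hN]]; exists (E `&` N); split.
- exact: measurableI.
- by apply/(same_null_restr mE _ mN) => //; rewrite gt_eqF.
- move=> x Ex nN; apply: contrapT => nP; apply: nN; split => //.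
  by apply: hN => /= /(_ Ex).
Qed.

Lemma lower_integral_restr (A : set T) (f : T -> \bar R) : measurable A -> A `<=` E ->
  (forall x, E x -> 0 <= f x)%E -> (forall x, A x -> 1 <= f x)%E ->
  (\int[nu]_(x in E) f x = 0)%E -> pr mu A = 0.
Proof.
move=> mA AE f0 f1.
have V0 : 0 <= (pr mu E)^-1 by rewrite invr_ge0 pr_ge0.
have -> : nu = mscale (NngNum V0) (mrestr mu mE).
  apply/funext => B; rewrite /nu /normalized_restr /mscale /mrestr /= (prE mu mE).
  by rewrite inver gt_eqF // muleC setIC.
move=> /(lower_integral0 mE mA AE f0 f1).
rewrite /mscale /mrestr /= => /eqP; rewrite mule_eq0 eqe invr_eq0 gt_eqF //=.
by rewrite /mrestr (setIidl AE) => /eqP /pr_null.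
Qed.

(** A point x whose pair (x, g l x) lies in N adds at least 1 to the counting function whose integral is the measure of N. *)
Lemma negligible_graph (P : T * T -> Prop) l :
  {ae rel_measure E nu RE, forall p, RE p -> P p} ->
  exists N, [/\ measurable N, pr mu N = 0 & forall x, E x -> ~ N x -> P (x, g l x)].
Proof.
move=> [N [mN int0 hN]].
pose A := E `&` [set x | N (x, g l x)].
have mA : measurable A.
  apply: measurableI => //; rewrite -[X in measurable X]setTI.
  by apply: (measurable_fun_pair (@measurable_id _ _ _) (gen_meas G l)).
exists A; split => //.
- apply: (lower_integral_restr (f := fun x => counting (xsection (N `&` RE) x))) int0 => //.
  + by move=> x [].
  + move=> x [Ex Nx]; apply: counting_ge1; exists (g l x).
    by rewrite /xsection /= inE /=; split => //; exact: (gen_rel G).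
- move=> x Ex nA; apply: contrapT => nP; apply: nA; split => //.
  by apply: hN => /= /(_ (gen_rel G l Ex)).
Qed.

Lemma gen_comp_full_group i l : full_group E nu RE (fun x => g i (g l x)).
Proof.
have [_ _ _ _ trans] := bR.
have mgg : measurable_fun setT (fun x => g i (g l x)).
  exact: measurableT_comp (gen_meas G i) (gen_meas G l).
have mgg' : measurable_fun setT (fun x => g l (g i x)).
  exact: measurableT_comp (gen_meas G l) (gen_meas G i).
have st k x : E x -> E (g k x) by exact: (gen_stable G).
split.
- split.
  + by move=> x /(st l)/(st i).
  + by move=> x y _ _ /(congr1 (g i)); rewrite !(gen_inv G) => /(congr1 (g l)); rewrite !(gen_inv G).
  + move=> x Ex; exists (g l (g i x)); first by exact/st/st.
    by rewrite !(gen_inv G).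
- exact: measurable_funTS.
- move=> A mA _; rewrite (_ : _ @` A = (fun x => g l (g i x)) @^-1` A).
    exact: measurable_preimage.
  apply/seteqP; split => [_ [x Ax <-]|x Ax]; first by rewrite /= !(gen_inv G).
  by exists (g l (g i x)) => //; rewrite !(gen_inv G).
- exists set0; split => //.
    by apply/(same_null_restr mE) => //; rewrite ?gt_eqF // setI0 pr0.
  move=> x; apply => Ex.
  by apply: trans (gen_rel G l Ex) _; apply: (gen_rel G); exact: st.
Qed.

Definition gen_class x i := xsection SE (g i x).

Lemma modulus_version (xi : T -> set T -> R[i]) (h : T -> T) :
  measurable_family E nu RE SE xi -> full_group E nu RE h ->
  exists (w : T -> R) N, [/\ measurable_fun setT w, measurable N, pr mu N = 0 &
    forall x, E x -> ~ N x -> w x = Normc.normc (xi x (xsection SE (h x)))].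
Proof.
move=> [_ mf] /mf[[hr mhr /negligible_restr[N1 [mN1 N10 h1]]]
  [hi mhi /negligible_restr[N2 [mN2 N20 h2]]]].
have mhr' : measurable_fun setT (hr \_ E) by apply/(measurable_restrictT _ mE).
have mhi' : measurable_fun setT (hi \_ E) by apply/(measurable_restrictT _ mE).
exists (fun x => Num.sqrt ((hr \_ E) x ^+ 2 + (hi \_ E) x ^+ 2)), (N1 `|` N2); split.
- apply: (@measurableT_comp _ _ _ _ _ _ (@Num.sqrt R)).
    by apply: continuous_measurable_fun; exact: sqrt_continuous.
  by apply: measurable_funD; exact: measurable_funX.
- exact: measurableU.
- apply/eqP; rewrite eq_le pr_ge0 andbT.
  by apply: (le_trans (pr_setU_le _ mN1 mN2)); rewrite N10 N20 addr0.
- move=> x Ex /not_orP[n1 n2]; rewrite normcE2 h1 // h2 //.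
  by rewrite /patch mem_set.
Qed.

(** What coamenability gives pointwise outside of one null set. Only the moduli alpha of the vectors matter, by the
    reverse triangle inequality. The functions w and u are measurable versions of the coordinates at x in the classes
    of g i x and of g i (g l x); finite sums over classes replace the l2 norms. *)
Lemma coamenable_moduli : coamenable E nu SE RE ->
  exists (alpha : nat -> T -> set T -> R) (w : nat -> nat -> T -> R)
    (u : nat -> nat -> nat -> T -> R) (Nul : set T),
  [/\ measurable Nul /\ pr mu Nul = 0, forall m x c, 0 <= alpha m x c,
      forall m i, measurable_fun setT (w m i),
      forall m i l, measurable_fun setT (u m i l) &
      forall x, E x -> ~ Nul x ->
  [/\ (forall y, RE (x, y) -> exists i, y = g i x),
      (forall m i, w m i x = alpha m x (gen_class x i)) /\
      (forall m i l, u m i l x = alpha m x (gen_class (g l x) i)),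
      (forall m U, uniq U -> (forall c, c \in U -> exists i, c = gen_class x i) ->
         \sum_(c <- U) alpha m x c ^+ 2 <= 1),
      (forall m del, 0 < del -> exists U, [/\ uniq U,
         forall c, c \in U -> exists i, c = gen_class x i &
         1 - del <= \sum_(c <- U) alpha m x c ^+ 2]) &
      (forall l e, 0 < e -> exists m0, forall m U, (m0 <= m)%N -> uniq U ->
         (forall c, c \in U -> exists i, c = gen_class x i) ->
         \sum_(c <- U) (alpha m x c - alpha m (g l x) c) ^+ 2 <= e)]].
Proof.
move=> [xi [mfam norm1 inv]].
have En0 : pr mu E != 0 by rewrite gt_eqF.
have sn := same_null_restr mE En0.
have [_ RsubE _ Rsym Rtrans] := bR.
have [_ SsubE Srefl Ssym Strans] := bS.
have /choice[w /choice[N1 h1]] : forall mi : nat * nat, exists (w : T -> R) N,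
    [/\ measurable_fun setT w, measurable N, pr mu N = 0 &
    forall x, E x -> ~ N x -> w x = Normc.normc (xi mi.1 x (xsection SE (g mi.2 x)))].
  by move=> mi; apply: modulus_version => //; exact: (gen_full_group G).
have /choice[u /choice[N2 h2]] : forall mil : nat * nat * nat, exists (w : T -> R) N,
    [/\ measurable_fun setT w, measurable N, pr mu N = 0 &
    forall x, E x -> ~ N x -> w x =
      Normc.normc (xi mil.1.1 x (xsection SE (g mil.1.2 (g mil.2 x))))].
  by move=> mil; apply: modulus_version => //; exact: gen_comp_full_group.
have /choice[N3 h3] : forall m, exists N, [/\ measurable N, pr mu N = 0 &
    forall x, E x -> ~ N x -> l2norm (quotient_classes E RE SE x) (xi m x) = 1%E].
  by move=> m; exact: negligible_restr (norm1 m).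
have /choice[N4 h4] := fun l => negligible_graph l inv.
have [N5 [mN5 N50 cov]] := gen_cover G.
pose J := (nat * nat + (nat * nat * nat) + nat + nat + unit)%type.
have [||Nul [mNul Nul0 hNul]] := @pr_null_cover _ _ _ mu J (fun j => match j with
  | inl (inl (inl (inl a))) => N1 a | inl (inl (inl (inr a))) => N2 a
  | inl (inl (inr a)) => N3 a | inl (inr a) => N4 a | inr _ => N5 end).
- by case=> [[[[a|a]|a]|a]|a]; [case: (h1 a)|case: (h2 a)|case: (h3 a)|case: (h4 a)|].
- by case=> [[[[a|a]|a]|a]|a]; [case: (h1 a)|case: (h2 a)|case: (h3 a)|case: (h4 a)|].
exists (fun m x c => Normc.normc (xi m x c)), (fun m i => w (m, i)),
  (fun m i l => u (m, i, l)), Nul; split => //.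
- by move=> m x c; exact: normc_ge0.
- by move=> m i; case: (h1 (m, i)).
- by move=> m i l; case: (h2 (m, i, l)).
move=> x Ex nN.
have n1 a : ~ N1 a x by move=> ?; apply: nN; apply: (hNul (inl (inl (inl (inl a))))).
have n2 a : ~ N2 a x by move=> ?; apply: nN; apply: (hNul (inl (inl (inl (inr a))))).
have n3 a : ~ N3 a x by move=> ?; apply: nN; apply: (hNul (inl (inl (inr a)))).
have n4 a : ~ N4 a x by move=> ?; apply: nN; apply: (hNul (inl (inr a))).
have n5 : ~ N5 x by move=> ?; apply: nN; apply: (hNul (inr tt)).
have clQ c : (exists i, c = gen_class x i) <-> quotient_classes E RE SE x c.
  split=> [[i ->]|[[y Ey ->] sub]].
    split; first by exists (g i x) => //; exact: (gen_stable G).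
    move=> z; rewrite /gen_class /xsection /= !inE /= => /SR.
    exact: Rtrans (gen_rel G i Ex).
  have : xsection RE x y by apply: sub; rewrite /xsection /= inE; exact: Srefl.
  rewrite /xsection /= inE => Rxy; have [i yi] := cov _ _ Rxy n5.
  by exists i; rewrite /gen_class -yi.
split.
- by move=> y Rxy; exact: cov.
- split=> [m i|m i l].
    by have [_ _ _ h] := h1 (m, i); rewrite h.
  by have [_ _ _ h] := h2 (m, i, l); rewrite h.
- move=> m U uU UQ; rewrite -[leRHS](expr1n R 2).
  apply: (l2norm_sum_le (Q := quotient_classes E RE SE x)) => //.
    by move=> c /UQ /clQ.
  by have [_ _ h] := h3 m; rewrite h.
- move=> m del del0; have [_ _ h] := h3 m.
  have [U [uU UQ hU]] := l2norm1_approx (h x Ex (n3 m)) del0.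
  by exists U; split => // c /UQ /clQ.
- move=> l e e0; have [_ _ h] := h4 l.
  have s0 : 0 < Num.sqrt e by rewrite sqrtr_gt0.
  have := h x Ex (n4 l) => /= cv.
  have [m0 _ hm0] : \forall m \near \oo, (l2norm (quotient_classes E RE SE x)
      (fun c => xi m x c - xi m (g l x) c)%R < (Num.sqrt e)%:E)%E.
    move/fine_cvgP : cv => [fin /cvgrPdist_lt /(_ _ s0) cv].
    near=> m; have : l2norm (quotient_classes E RE SE x)
      (fun c => xi m x c - xi m (g l x) c)%R \is a fin_num by near: m.
    move=> /fineK <-; rewrite lte_fin.
    have : `|0 - fine (l2norm (quotient_classes E RE SE x)
      (fun c => xi m x c - xi m (g l x) c))| < Num.sqrt e by near: m; exact: cv.
    by rewrite sub0r normrN; apply: le_lt_trans; exact: ler_norm.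
  exists m0 => m U /hm0 /= /ltW hm uU UQ.
  have := l2norm_sum_le (ltW s0) uU (fun c cU => (clQ c).1 (UQ c cU)) hm.
  rewrite sqr_sqrtr ?(ltW e0) //; apply: le_trans; apply: ler_sum => c _.
  exact: normc_reverse_triangle.
Unshelve. all: by end_near. Qed.

End coam.

(** * Sets with small boundary from coamenability *)

Lemma cv0_sum (R : realType) (I : finType) (u : I -> nat -> R) :
  (forall i, cv0 (u i)) -> cv0 (fun n => \sum_i u i n).
Proof.
move=> h e e0.
have [I0|I0] := posnP #|I|.
  exists 0%N => n _; rewrite big_pred0 // => i.
  by have := card0_eq I0 i; rewrite inE.
have e1 : 0 < e / #|I|%:R by rewrite divr_gt0 // ltr0n.
have /choice[N hN] := fun i => h i _ e1.
exists (\max_i N i)%N => n hn.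
have [i0 _] : exists i0 : I, i0 \in I by apply/card_gt0P.
apply: (@lt_le_trans _ _ (\sum_(i : I) e / #|I|%:R)).
  apply: ltr_sum; first by apply/hasP; exists i0 => //; exact: mem_index_enum.
  by move=> i _; apply: hN; apply: leq_trans hn; exact: leq_bigmax.
by rewrite sumr_const -(mulr_natr (e / _)) divfK // pnatr_eq0 -lt0n.
Qed.

Lemma pr_bigU_le (R : realType) (d : measure_display) (T : measurableType d)
  (mu : probability T R) (I : finType) (A : set T) (X : I -> set T) :
  measurable A -> (forall i, measurable (X i)) ->
  A `<=` \bigcup_i X i -> pr mu A <= \sum_i pr mu (X i).
Proof.
move=> mA mX AX.
suff : \sum_(i < 1) 1 * pr mu A <= \sum_i 1 * pr mu (X i).
  rewrite big_ord1 mul1r => /le_trans; apply; apply: ler_sum => i _.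
  by rewrite mul1r.
apply: le_weighted => // x; rewrite big_ord1 mul1r.
have [Ax|nA] := pselect (A x); last first.
  by rewrite indicE memNset //; apply: sumr_ge0 => i _; rewrite mul1r.
have [i _ Xi] := AX x Ax.
rewrite indicE mem_set // (bigD1 i) //= mul1r indicE mem_set // lerDl.
by apply: sumr_ge0 => j _; rewrite mul1r.
Qed.

Section small_perimeter.
Context (R : realType) (d : measure_display) (T : measurableType d).
Variable mu : probability T R.
Hypothesis mdiag : measurable [set p : T * T | p.2 = p.1].
Variables (E : set T) (RE SE : set (T * T)) (g s : nat -> T -> T).
Hypotheses (mE : measurable E) (E0 : 0 < pr mu E).
Hypotheses (bR : borel_equivalence E RE) (bS : borel_equivalence E SE) (SR : SE `<=` RE).
Hypothesis G : generators mu E RE g.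
Hypothesis GS : generators mu E SE s.

Local Notation cl := (gen_class SE g).

(** The index i is kept when the class of g i x has not occurred before, so that sums over classes become sums over
    indices with measurable terms. *)
Definition first_index i := [set x | forall j, (j < i)%N -> ~ SE (g j x, g i x)].

Lemma measurable_pair_rel (f h : T -> T) (rel : set (T * T)) : measurable rel ->
  measurable_fun setT f -> measurable_fun setT h -> measurable [set x | rel (f x, h x)].
Proof.
move=> mr mf mh; rewrite -[X in measurable X]setTI.
exact: (measurable_fun_pair mf mh).
Qed.

Lemma measurable_first_index i : measurable (first_index i).
Proof.
rewrite (_ : first_index i = \bigcap_(j in [set j | (j < i)%N]) ~` [set x | SE (g j x, g i x)]).
  have [->|i0] := posnP i.
    rewrite (_ : [set j | _] = set0) ?bigcap_set0 //.
    by apply/seteqP; split.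
  apply: bigcap_measurable => [|j _]; first by exists 0%N.
  apply: measurableC; apply: measurable_pair_rel; [by case: bS| |]; exact: (gen_meas G).
by apply/seteqP; split => x h j ji; exact: h.
Qed.

Lemma cl_eq x i j : E x -> (cl x i = cl x j <-> SE (g i x, g j x)).
Proof.
have [_ _ refl sym trans] := bS; move=> Ex; rewrite /gen_class; split=> [e|h].
  have : xsection SE (g i x) (g j x).
    by rewrite e /xsection /= inE; apply: refl; exact: (gen_stable G).
  by rewrite /xsection /= inE.
apply/seteqP; split => z; rewrite /xsection /= !inE => hz.
  exact: trans (sym _ _ h) hz.
exact: trans h hz.
Qed.

Lemma first_index_inj x i j : E x -> first_index i x -> first_index j x ->
  cl x i = cl x j -> i = j.
Proof.
have [_ _ _ sym _] := bS.
move=> Ex fi fj /(cl_eq _ _ Ex) h; case: (ltngtP i j) => // ij.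
  by have := fj _ ij.
by have := fi _ ij; case; exact: sym.
Qed.

Lemma first_index_ex x i : E x -> exists2 j, (j <= i)%N & first_index j x /\ cl x j = cl x i.
Proof.
have [_ _ refl sym trans] := bS; move=> Ex.
have ex : exists j, `[< cl x j = cl x i >] by exists i; exact/asboolP.
exists (ex_minn ex); first by case: ex_minnP => m _; apply; exact/asboolP.
case: ex_minnP => m /asboolP em mmin; split => // k km /(cl_eq _ _ Ex) h.
have := mmin k; rewrite leqNgt km /=.
by move=> /(_ (asboolT (etrans h em))).
Qed.

Definition cls x M : seq (set T) := [seq cl x i | i <- iota 0 M & `[< first_index i x >]].

Lemma cls_uniq x M : E x -> uniq (cls x M).
Proof.
move=> Ex; rewrite map_inj_in_uniq ?filter_uniq ?iota_uniq // => i j.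
rewrite !mem_filter => /andP[/asboolP fi _] /andP[/asboolP fj _].
exact: first_index_inj.
Qed.

Lemma mem_cls x M c : c \in cls x M -> exists i, [/\ (i < M)%N, first_index i x & c = cl x i].
Proof.
move=> /mapP[k kM ->]; exists k; move: kM.
by rewrite mem_filter mem_iota add0n /= => /andP[/asboolP fk kM].
Qed.

Lemma cls_mem x M i : (i < M)%N -> first_index i x -> cl x i \in cls x M.
Proof.
move=> iM fi; apply/mapP; exists i => //.
by rewrite mem_filter mem_iota add0n /= iM andbT; apply/asboolP.
Qed.

Lemma cls_cover x (U : seq (set T)) : E x -> (forall c, c \in U -> exists i, c = cl x i) ->
  exists M, forall M', (M <= M')%N -> {subset U <= cls x M'}.
Proof.
move=> Ex; elim: U => [|c U IH] h; first by exists 0%N.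
have [|M hM] := IH; first by move=> c' c'U; apply: h; rewrite inE c'U orbT.
have [i ci] := h c (mem_head _ _).
have [j ji [fj cj]] := first_index_ex i Ex.
exists (maxn M j.+1) => M'; rewrite geq_max => /andP[MM' jM'] c'.
rewrite inE => /predU1P[->|]; last exact: hM.
by rewrite ci -cj; exact: cls_mem.
Qed.

Lemma sum_cls x M (f : set T -> R) :
  \sum_(c <- cls x M) f c = \sum_(i < M) \1_(first_index i) x * f (cl x i).
Proof.
rewrite big_map big_filter big_mkcond /= -{1}[M]subn0 -/(index_iota 0 M) big_mkord.
apply: eq_bigr => i _; rewrite indicE; case: asboolP => fi.
  by rewrite mem_set // mul1r.
by rewrite memNset // mul0r.
Qed.

Lemma gen_stableE l x : E x <-> E (g l x).
Proof.
split=> [|h]; first exact: (gen_stable G).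
by rewrite -(gen_inv G l x); exact: (gen_stable G).
Qed.

Lemma measurable_label_neq (F : T -> nat) (f1 f2 : T -> T) :
  (forall z, measurable [set x | F x = z]) ->
  measurable_fun setT f1 -> measurable_fun setT f2 ->
  measurable [set x | F (f1 x) <> F (f2 x)].
Proof.
move=> mF m1 m2; rewrite (_ : [set x | _] =
    ~` \bigcup_z (f1 @^-1` [set x | F x = z] `&` f2 @^-1` [set x | F x = z])).
  apply: measurableC; apply: bigcup_measurable => z _.
  by apply: measurableI; exact: measurable_preimage.
apply/seteqP; split => x /=; first by move=> ne [z _ [/= e1 e2]]; apply: ne; rewrite e1 e2.
by move=> h' e; apply: h'; exists (F (f1 x)) => //; split => //=; rewrite -e.
Qed.

(** Where two maps have SE-related values, one of them is, on countably many pieces, a generator applied to the other. *)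
Lemma mismatch_cv0 (F : nat -> T -> nat) (f h : T -> T) :
  (forall n z, measurable [set x | F n x = z]) ->
  (forall j, cv0 (fun n => pr mu (E `&` [set x | F n (s j x) <> F n x]))) ->
  measurable_fun setT f -> measurable_fun setT h ->
  (forall A, measurable A -> pr mu (f @^-1` A) = pr mu A) ->
  cv0 (fun n => pr mu (E `&` [set x | SE (f x, h x) /\ F n (f x) <> F n (h x)])).
Proof.
move=> mF cF mf mh pf.
have [_ subE _ _ _] := bS.
have [N [mN N0 cov]] := gen_cover GS.
pose C j := [set x | h x = s j (f x)].
have mC j : measurable (C j).
  have m2 : measurable_fun setT (fun x => s j (f x)) by exact: measurableT_comp (gen_meas GS j) mf.
  by have := measurable_fun_pair m2 mh measurableT mdiag; rewrite setTI.
have mB n : measurable (E `&` [set x | SE (f x, h x) /\ F n (f x) <> F n (h x)]).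
  apply: measurableI => //; apply: measurableI; last exact: measurable_label_neq.
  by apply: measurable_pair_rel => //; case: bS.
apply: (pr_split mB mC (measurable_preimage mf mN)); first by rewrite pf.
  move=> n x [Ex [Sx ne]]; have [Nx|nN] := pselect (N (f x)); first by left.
  by right; have [j hj] := cov _ _ Sx nN; exists j.
move=> j e /(cF j)[n0 hn0]; exists n0 => n /hn0; apply: le_lt_trans.
have mD : measurable (E `&` [set x | F n (s j x) <> F n x]).
  apply: measurableI => //.
  exact: (measurable_label_neq (mF n) (gen_meas GS j) (@measurable_id _ _ _)).
rewrite -[X in _ <= X]pf //; apply: le_pr; [exact: measurableI|exact: measurable_preimage|].
move=> x [[Ex [Sx ne]] /= Cx]; split; first by have [] := subE _ Sx.
by move=> /= e'; apply: ne; rewrite Cx e'.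
Qed.

(** The distribution of the label F n of a random class of x, drawn with the squared moduli, is almost invariant under
    the generators of RE, since F n is almost constant on classes; each label has a support of small measure, contained
    in M translates of an atom. round_distribution turns it into a set. *)
Lemma small_perimeter_set : coamenable E (normalized_restr mu E) SE RE ->
  forall (F : nat -> T -> nat) (K : nat -> nat),
  (forall n x, (F n x < K n)%N) -> (forall n z, measurable [set x | F n x = z]) ->
  (forall e, 0 < e -> exists n0, forall n, (n0 <= n)%N ->
     forall z, pr mu (E `&` [set x | F n x = z]) <= e) ->
  (forall j, cv0 (fun n => pr mu (E `&` [set x | F n (s j x) <> F n x]))) ->
  forall N e, 0 < e -> exists B, [/\ measurable B, B `<=` E, pr mu E / 3 <= pr mu B,
    pr mu B <= pr mu E / 2 & perimeter mu g N B <= e].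
Proof.
move=> /(coamenable_moduli mE E0 bR bS SR G)
  [al [w [u [Nul [[mNul Nul0] al0 mw mu' hgood]]]]] F K FK mF atoms cF N e e0.
set V := pr mu E.
(* del is the total error that round_distribution tolerates; dist_pushforward turns it
   into 3 * s0 for the l2 distance plus 2 * (2 * d4) for the mass that is cut off. *)
pose del := Num.min (1 / 20) (e / (20 * N.+1%:R)).
have N20 : 0 < 20 * N.+1%:R :> R by rewrite mulr_gt0.
have del0 : 0 < del by rewrite lt_min divr_gt0 // divr_gt0.
have del20 : del <= 1 / 20 by rewrite ge_min lexx.
have dele : 20 * N.+1%:R * del <= e.
  by rewrite mulrC -ler_pdivlMr // ge_min lexx orbT.
pose s0 := del / 6; have s00 : 0 < s0 by rewrite divr_gt0.
pose d4 := del / 8; have d40 : 0 < d4 by rewrite divr_gt0.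
have mI i : measurable_fun setT (fun x => \1_(first_index i) x : R).
  by apply: measurable_indic; exact: measurable_first_index.
(* Off NN, the facts that hold outside of Nul hold at x and at all g l x. *)
pose NN := Nul `|` \bigcup_l g l @^-1` Nul.
have mgN l : measurable (g l @^-1` Nul) by exact: measurable_preimage (gen_meas G l) mNul.
have mNN : measurable NN by apply: measurableU => //; exact: bigcup_measurable.
have NN0 : pr mu NN = 0.
  have mU : measurable (\bigcup_l g l @^-1` Nul) by exact: bigcup_measurable.
  apply/eqP; rewrite eq_le pr_ge0 andbT.
  apply: (le_trans (pr_setU_le _ mNul mU)).
  by rewrite Nul0 pr_bigcup0 ?addr0 // => l; rewrite (gen_pres G).
have goodg l x : E x -> ~ NN x -> E (g l x) /\ ~ Nul (g l x).
  move=> Ex /not_orP[_ nU]; split; first exact: (gen_stableE l x).1.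
  by move=> ?; apply: nU; exists l.
(* First choice: an index m of the family for which the vectors at x and g l x are s0-close
   for all l < N and most x. *)
pose D m l M x := \sum_(i < M) \1_(first_index i) x * (w m i x - u m i l (g l x)) ^+ 2.
have mD m l M : measurable_fun setT (D m l M).
  apply: measurable_sum => i; apply: measurable_funM => //.
  apply: measurable_funX; apply: measurable_funB; first exact: mw.
  exact: measurableT_comp (mu' m i l) (gen_meas G l).
pose Vb m l := \bigcup_M [set x | s0 ^+ 2 < D m l M x].
have mVb m l : measurable (Vb m l).
  by apply: bigcup_measurable => M _; exact: measurable_gt.
have DE m l M x : E x -> ~ NN x -> D m l M x =
    \sum_(c <- cls x M) (al m x c - al m (g l x) c) ^+ 2.
  move=> Ex nNN; rewrite sum_cls; apply: eq_bigr => i _.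
  have [_ [wE _] _ _ _] := hgood x Ex (fun h => nNN (or_introl h)).
  have [Egx nNg] := goodg l x Ex nNN.
  have [_ [_ uE] _ _ _] := hgood _ Egx nNg.
  by rewrite wE uE (gen_inv G).
have [m hm] : exists m, forall l, (l < N)%N -> pr mu ((E `\` NN) `&` Vb m l) <= d4.
  have /choice[m0 hm0] : forall l, exists m0, forall m, (m0 <= m)%N ->
      pr mu ((E `\` NN) `&` Vb m l) <= d4.
    move=> l; pose W m := \bigcup_(m' in [set m' | (m <= m')%N]) ((E `\` NN) `&` Vb m' l).
    have mEV m' : measurable ((E `\` NN) `&` Vb m' l).
      by apply: measurableI => //; exact: measurableD.
    have mW m : measurable (W m) by exact: bigcup_measurable.
    have [||M hM] := pr_cvg_bigcap0 (mu := mu) mW _ _ d40.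
    - by move=> k x [m' /= km' h]; exists m' => //=; apply: leq_trans km'.
    - rewrite (_ : \bigcap_k W k = set0) ?pr0 // -subset0 => x hx.
      have [m' _ [[Ex nNN] _]] := hx 0%N Logic.I.
      have [_ _ _ _ inv] := hgood x Ex (fun h => nNN (or_introl h)).
      have [k hk] := inv l (s0 ^+ 2) (exprn_gt0 2 s00).
      have [m'' /= km'' [_ [M _ /=]]] := hx k Logic.I.
      rewrite ltNge => /negP; apply; rewrite DE //; apply: hk => //.
        exact: cls_uniq.
      by move=> c /mem_cls[i [_ _ ->]]; exists i.
    exists M => k Mk; apply: ltW; apply: le_lt_trans (hM M (leqnn M)).
    by apply: le_pr => // x hx; exists k.
  exists (\max_(l < N) m0 l)%N => l lN; apply: hm0.
  exact: (leq_bigmax (Ordinal lN)).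
(* Second choice: a number M of classes that carry almost all the mass at most points. *)
pose S M x := \sum_(i < M) \1_(first_index i) x * w m i x ^+ 2.
have mS M : measurable_fun setT (S M).
  apply: measurable_sum => i; apply: measurable_funM => //.
  by apply: measurable_funX; exact: mw.
have SE' M x : E x -> ~ Nul x -> S M x = \sum_(c <- cls x M) al m x c ^+ 2.
  move=> Ex nN; rewrite (sum_cls x M (fun c => al m x c ^+ 2)); apply: eq_bigr => i _.
  by have [_ [wE _] _ _ _] := hgood x Ex nN; rewrite wE.
pose GM M := (E `\` NN) `&` [set x | 1 - d4 - d4 < S M x].
have mENN : measurable (E `\` NN) by exact: measurableD.
have mGM M : measurable (GM M) by apply: measurableI => //; exact: measurable_gt.
have GMS M : GM M `<=` GM M.+1.
  move=> x [h /= h']; split => //=; apply: (lt_le_trans h').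
  by rewrite /S big_ord_recr /= lerDl mulr_ge0 ?sqr_ge0.
have UGM : \bigcup_M GM M = E `\` NN.
  apply/seteqP; split => [x [M _ []//]|x [Ex nNN]].
  have nN : ~ Nul x by move=> ?; apply: nNN; left.
  have [_ _ _ /(_ m d4 d40)[U [uU Ucl hU]] _] := hgood x Ex nN.
  have [M hM] := cls_cover Ex Ucl; exists M => //; split => //=.
  rewrite SE' //; have := le_sum_sub (fun c => sqr_ge0 (al m x c)) uU (cls_uniq M Ex) (hM M (leqnn M)).
  by move: hU d40; lra.
have d5 : 0 < Num.min d4 (V / 100) by rewrite lt_min d40 divr_gt0.
have [M hM] : exists M, pr mu (E `\` GM M) <= Num.min d4 (V / 100).
  have [M hM] := pr_cvg_bigcup mu mGM GMS d5; exists M.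
  apply: ltW; apply: le_lt_trans (hM M (leqnn M)); rewrite UGM.
  have m1 : measurable (E `\` GM M) by exact: measurableD.
  have m2 : measurable ((E `\` NN) `\` GM M) by exact: measurableD.
  have := pr_setU_le mu m2 mNN; rewrite NN0 addr0; apply: le_trans.
  apply: le_pr => //; first exact: measurableU.
  by move=> x [Ex nG]; have [?|?] := pselect (NN x); [right|left].
have hM4 : pr mu (E `\` GM M) <= d4 by apply: (le_trans hM); rewrite ge_min lexx.
have hM100 : pr mu (E `\` GM M) <= V / 100 by apply: (le_trans hM); rewrite ge_min lexx orbT.
(* Third choice: a partition F n that is constant on the relevant classes at most points,
   with atoms so small that M translates of them are still small. *)
pose X n l i k := E `&` [set x | SE (g i x, g k (g l x)) /\ F n (g i x) <> F n (g k (g l x))].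
have cX l i k : cv0 (fun n => pr mu (X n l i k)).
  apply: mismatch_cv0 => //; first exact: (gen_meas G).
  - exact: measurableT_comp (gen_meas G k) (gen_meas G l).
  - by move=> A mA; rewrite (gen_pres G).
have /(_ _ d40)[n1 hn1] := cv0_sum (fun q : 'I_N * 'I_M * 'I_M => cX q.1.1 q.1.2 q.2).
have at0 : 0 < V / 10 / M.+1%:R by rewrite !divr_gt0.
have [n2 hn2] := atoms _ at0.
pose n := maxn n1 n2.
have {}hn1 := hn1 n (leq_maxl _ _); have {}hn2 := hn2 n (leq_maxr _ _).
have mFz z : measurable [set x | F n x = z] by exact: mF.
have mX l i k : measurable (X n l i k).
  apply: measurableI => //; apply: measurableI.
    apply: measurable_pair_rel; [by case: bS|exact: (gen_meas G)|].
    exact: measurableT_comp (gen_meas G k) (gen_meas G l).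
  apply: (measurable_label_neq mFz (gen_meas G i)).
  exact: measurableT_comp (gen_meas G k) (gen_meas G l).
pose XX l := \bigcup_(i in [set i | (i < M)%N]) \bigcup_(k in [set k | (k < M)%N]) X n l i k.
have mXX l : measurable (XX l).
  by apply: bigcup_measurable => i _; exact: bigcup_measurable.
have XX4 l : (l < N)%N -> pr mu (XX l) <= d4.
  move=> lN; apply: le_trans (ltW hn1); apply: pr_bigU_le => //.
  by move=> x [i /= iM [k /= kM h]]; exists (Ordinal lN, Ordinal iM, Ordinal kM).
(* pi z x is the probability that a class drawn with the weights al m x c ^+ 2 has label z;
   the label of a class is read at its representative of first index. *)
pose A i z := ((E `\` NN) `&` first_index i) `&` g i @^-1` [set x | F n x = z].
have mfst i : measurable (first_index i) by exact: measurable_first_index.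
have mA i z : measurable (A i z).
  by apply: measurableI; [exact: measurableI|exact: measurable_preimage (gen_meas G i) _].
pose pi z x := \sum_(i < M) \1_(A i z) x * w m i x ^+ 2.
have mpi z : measurable_fun setT (pi z).
  apply: measurable_sum => i; apply: measurable_funM; first exact: measurable_indic.
  by apply: measurable_funX; exact: mw.
have pi0 z x : 0 <= pi z x by apply: sumr_ge0 => i _; rewrite mulr_ge0 ?sqr_ge0.
have piS x : E x -> ~ NN x -> \sum_(z < K n) pi z x = S M x.
  move=> Ex nN; rewrite exchange_big /=; apply: eq_bigr => i _.
  rewrite -mulr_suml; congr (_ * _).
  rewrite (bigD1 (Ordinal (FK n (g i x)))) //= big1 ?addr0.
    rewrite !indicE; congr (_%:R); apply: congr1.
    by apply/idP/idP => /set_mem h; apply/mem_set; [case: h => -[]|split].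
  move=> z /eqP zn; rewrite indicE memNset // => -[_ /= e1]; apply: zn.
  by apply/val_inj.
have pi_out z x : ~ (E `\` NN) x -> pi z x = 0.
  by move=> nx; apply: big1 => i _; rewrite indicE memNset ?mul0r // => -[[]].
have al1 x : E x -> ~ NN x -> forall U, uniq U -> (forall c, c \in U -> exists i, c = cl x i) ->
    \sum_(c <- U) al m x c ^+ 2 <= 1.
  by move=> Ex nN; have [_ _ + _ _] := hgood x Ex (fun h => nN (or_introl h)); apply.
have S1 x : E x -> ~ NN x -> S M x <= 1.
  move=> Ex nN; rewrite SE' //; last by move=> ?; apply: nN; left.
  apply: al1 => //; first exact: cls_uniq.
  by move=> c /mem_cls[i [_ _ ->]]; exists i.
have pi1 x : \sum_(z < K n) pi z x <= 1.
  have [[Ex nN]|nx] := pselect ((E `\` NN) x); first by rewrite piS //; exact: S1.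
  by rewrite big1 // => z _; exact: pi_out.
pose phi x c := F n (g (xget 0%N [set i | first_index i x /\ cl x i = c]) x).
have phiE x i : E x -> first_index i x -> phi x (cl x i) = F n (g i x).
  move=> Ex fi; rewrite /phi; case: xgetP => [j -> [fj cj]|/(_ i)]; last by case.
  by rewrite (first_index_inj Ex fj fi cj).
have piE z x : E x -> ~ NN x ->
    pi z x = \sum_(c <- cls x M) al m x c ^+ 2 * (phi x c == z)%:R.
  move=> Ex nN; rewrite (sum_cls x M (fun c => al m x c ^+ 2 * (phi x c == z)%:R)).
  apply: eq_bigr => i _.
  have [_ [wE _] _ _ _] := hgood x Ex (fun h => nN (or_introl h)); rewrite wE.
  have [fi|nfi] := pselect (first_index i x); last first.
    by rewrite !indicE !memNset ?mul0r //; case=> -[].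
  rewrite [in RHS]indicE mem_set // mul1r mulrC; congr (_ * _); rewrite indicE.
  congr (_%:R); apply: congr1; rewrite phiE //.
  by apply/idP/eqP => [/set_mem[]|h] //; apply/mem_set.
pose Bad l := (E `\` GM M) `|` (g l @^-1` (E `\` GM M) `|`
  (((E `\` NN) `&` Vb m l) `|` XX l)).
have mEG : measurable (E `\` GM M) by exact: measurableD.
have mgEG l : measurable (g l @^-1` (E `\` GM M)).
  exact: measurable_preimage (gen_meas G l) mEG.
have mEV l : measurable ((E `\` NN) `&` Vb m l) by exact: measurableI.
have m3 l := measurableU _ _ (mEV l) (mXX l).
have m2 l := measurableU _ _ (mgEG l) (m3 l).
have [||||||||||B [mB BE B3 B2 pB]] := round_distribution (N := N) (G := GM M) (Bad := Bad) (del := del)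
    mE E0 (gen_meas G) mpi pi0 pi1 (mGM M).
- by move=> x [[]].
- exact: hM100.
- move=> x [[Ex nN] /= h]; rewrite piS //; apply: (le_trans _ (ltW h)).
  by move: del20; rewrite /d4; lra.
- move=> z _.
  have mpos : measurable (E `&` [set x | 0 < pi z x]).
    by apply: measurableI => //; exact: measurable_gt.
  pose Y i := E `&` g i @^-1` [set x | F n x = z].
  apply: (@le_trans _ _ (\sum_(i < M) pr mu (g i @^-1` (E `&` [set x | F n x = z])))).
    apply: pr_bigU_le => //.
      by move=> i; apply: measurable_preimage (gen_meas G i) _; exact: measurableI.
    move=> x [Ex /= h]; apply: contrapT => nx; move: h; rewrite ltNge => /negP; apply.
    rewrite le_eqVlt; apply/orP; left; apply/eqP; apply: big1 => i _.
    rewrite indicE memNset ?mul0r // => -[[[_ _] _] /= Fz]; apply: nx; exists i => //.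
    by split => //; exact: (gen_stableE i x).1.
  apply: (@le_trans _ _ (\sum_(i < M) V / 10 / M.+1%:R)).
    apply: ler_sum => i _; rewrite (gen_pres G) //; exact: measurableI.
  rewrite sumr_const card_ord -(mulr_natr (V / 10 / _)) -mulrA ger_pMr ?divr_gt0 //.
  by rewrite mulrC ler_pdivrMr // mul1r ler_nat.
- exact: gen_stableE.
- exact: del0.
- exact: del20.
- by move=> l; apply: measurableU.
- move=> l lN; rewrite /Bad.
  have b1 := pr_setU_le mu mEG (m2 l).
  have b2 := pr_setU_le mu (mgEG l) (m3 l).
  have b3 := pr_setU_le mu (mEV l) (mXX l).
  have b4 := hm l lN; have b5 := XX4 l lN.
  have b6 : pr mu (g l @^-1` (E `\` GM M)) <= d4 by rewrite (gen_pres G).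
  by move: b1 b2 b3 b4 b5 b6 hM4 del0; rewrite /d4; lra.
- move=> l x lN Ex /not_orP[nG /not_orP[nGl /not_orP[nV nX]]].
  have Gx : GM M x by apply: contrapT => ?; apply: nG.
  have Egx : E (g l x) by exact: (gen_stableE l x).1.
  have Ggx : GM M (g l x) by apply: contrapT => ?; apply: nGl.
  have [[_ nN] /= Sx] := Gx; have [[_ nNg] /= Sgx] := Ggx.
  have nNul : ~ Nul x by move=> ?; apply: nN; left.
  have nNulg : ~ Nul (g l x) by move=> ?; apply: nNg; left.
  have clg i : exists j, cl (g l x) i = cl x j.
    have [cov _ _ _ _] := hgood x Ex nNul.
    have [_ _ _ _ trans] := bR.
    have [j hj] := cov (g i (g l x)) (trans _ _ _ (gen_rel G l Ex) (gen_rel G i Egx)).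
    by exists j; rewrite /gen_class hj.
  have clg' i : exists j, cl x i = cl (g l x) j.
    have [cov _ _ _ _] := hgood (g l x) Egx nNulg.
    have [_ _ _ sym trans] := bR.
    have [j hj] := cov (g i x) (trans _ _ _ (sym _ _ (gen_rel G l Ex)) (gen_rel G i Ex)).
    by exists j; rewrite /gen_class hj.
  set U := undup (cls x M ++ cls (g l x) M).
  have uU : uniq U by exact: undup_uniq.
  have Ucl c : c \in U -> exists i, c = cl x i.
    rewrite mem_undup mem_cat => /orP[|] /mem_cls[i [_ _ ->]]; first by exists i.
    exact: clg.
  have Uclg c : c \in U -> exists i, c = cl (g l x) i.
    rewrite mem_undup mem_cat => /orP[|] /mem_cls[i [_ _ ->]]; last by exists i.
    exact: clg'.
  have e6 : 3 * s0 + 2 * (d4 + d4) <= del by rewrite /s0 /d4; lra.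
  rewrite (eq_bigr (fun z : 'I_(K n) => `|\sum_(c <- cls x M) al m x c ^+ 2 * (phi x c == z)%:R -
      \sum_(c <- cls (g l x) M) al m (g l x) c ^+ 2 * (phi (g l x) c == z)%:R|)); last first.
    by move=> z _; rewrite !piE.
  apply: le_trans e6; apply: dist_pushforward => //.
  + exact: cls_uniq.
  + exact: cls_uniq.
  + move=> c /mem_cls[i [iM fi ->]] /mem_cls[k [kM fk e1]].
    rewrite phiE // e1 phiE //; apply: contrapT => ne; apply: nX.
    exists i => //; exists k => //; split => //; split => //.
    have [_ _ refl sym trans] := bS.
    have : xsection SE (g i x) (g k (g l x)).
      rewrite -[xsection _ _]/(cl x i) e1 /gen_class /xsection /= inE; apply: refl.
      exact: (gen_stableE k _).1.
    by rewrite /xsection /= inE.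
  + exact: al1.
  + exact: al1.
  + by rewrite -SE' //; lra.
  + by rewrite -SE' //; lra.
  + have [M' hM'] := cls_cover Ex Ucl.
    apply: le_trans (le_sum_sub (fun c => sqr_ge0 (al m x c - al m (g l x) c)) uU
      (cls_uniq M' Ex) (hM' M' (leqnn M'))) _.
    rewrite -DE // leNgt; apply/negP => h; apply: nV; split => //.
    by exists M'.
by exists B; split => //; apply: (le_trans pB).
Qed.

End small_perimeter.

(** * Fine almost invariant partitions *)

Section no_partition.
Context (R : realType) (d : measure_display) (T : measurableType d).
Variable mu : probability T R.

(** The partitions are given by labels, so that invariance is measured by the set of points whose label a generator changes. *)
Definition almost_invariant_fine (E : set T) (s : nat -> T -> T) :=
  exists (F : nat -> T -> nat) (K : nat -> nat),
  [/\ forall n x, (F n x < K n)%N, forall n z, measurable [set x | F n x = z],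
      forall e, 0 < e -> exists n0, forall n, (n0 <= n)%N ->
        forall z, pr mu (E `&` [set x | F n x = z]) <= e &
      forall j, cv0 (fun n => pr mu (E `&` [set x | F n (s j x) <> F n x]))].

Lemma invS_lt (e : R) : 0 < e -> exists n : nat, n.+1%:R^-1 < e.
Proof.
move=> e0; exists (Num.truncn e^-1); rewrite invf_plt ?posrE ?ltr0n//.
exact: truncnS_gt.
Qed.

(** The sets of small_perimeter_set have measure between 1 / 3 and 1 / 2 of E and vanishing boundary. *)
Lemma strongly_ergodic_no_fine E RE SE g s :
  measurable [set p : T * T | p.2 = p.1] ->
  measurable E -> 0 < pr mu E ->
  borel_equivalence E RE -> borel_equivalence E SE -> SE `<=` RE ->
  generators mu E RE g -> generators mu E SE s ->
  coamenable E (normalized_restr mu E) SE RE ->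
  gens_strongly_ergodic mu E g -> ~ almost_invariant_fine E s.
Proof.
move=> mdiag mE E0 bR bS SR G GS co se [F [K [FK mF atoms cF]]].
have /choice[B hB] : forall N : nat, exists B, [/\ measurable B, B `<=` E,
    pr mu E / 3 <= pr mu B, pr mu B <= pr mu E / 2 & perimeter mu g N B <= N.+1%:R^-1].
  move=> N; apply: (small_perimeter_set mdiag mE E0 bR bS SR G GS co FK mF atoms cF).
  by rewrite invr_gt0.
have cB i : cv0 (fun n => pr mu (bdry (g i) (B n))).
  move=> e /invS_lt[n0 hn0]; exists (maxn n0 i.+1) => n; rewrite geq_max => /andP[n0n inn].
  have [_ _ _ _ pB] := hB n.
  apply: le_lt_trans (le_lt_trans pB _) => //.
    rewrite /perimeter (bigD1 (Ordinal inn)) //= lerDl.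
    by apply: sumr_ge0 => l _; exact: pr_ge0.
  by apply: le_lt_trans hn0; rewrite lef_pV2 ?posrE // ler_nat.
have := se B (fun n => let: And5 a b _ _ _ := hB n in conj a b) cB.
(* The sets B n keep this much of pr (B n) * (pr E - pr (B n)). *)
pose c := pr mu E / 3 * (pr mu E / 2).
have c0 : 0 < c by rewrite mulr_gt0 // divr_gt0.
move=> /(_ c c0)[n /(_ n (leqnn n))]; rewrite ltNge => /negP; apply.
have [_ _ B3 B2 _] := hB n.
apply: ler_pM => //; rewrite ?divr_ge0 // ?(ltW E0) //; lra.
Qed.

End no_partition.

(** * Hahn decomposition and ultralimits *)

(** Hahn decomposition for a real set function, with countable additivity in elementary form. *)
Lemma hahn_real (R : realType) (d : measure_display) (T : measurableType d)
  (chi : set T -> R) : chi set0 = 0 ->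
  (forall F : nat -> set T, (forall i, measurable (F i)) -> trivIset setT F ->
    forall e, 0 < e -> exists n0, forall n, (n0 <= n)%N ->
      `|chi (\bigcup_i F i) - \sum_(i < n) chi (F i)| < e) ->
  exists P, [/\ measurable P,
    forall A, measurable A -> A `<=` P -> 0 <= chi A &
    forall A, measurable A -> A `<=` ~` P -> chi A <= 0].
Proof.
move=> chi0 chiS.
pose nu A : \bar R := (chi A)%:E.
have nu0 : nu set0 = 0%E by rewrite /nu chi0.
have nufin A : measurable A -> nu A \is a fin_num by [].
have nuS : semi_sigma_additive nu.
  move=> F mF tF _; rewrite /nu.
  under eq_fun => n do rewrite sumEFin.
  apply/fine_cvgP; split; first by near=> n.
  apply/cvgrPdist_lt => e e0; have [n0 hn0] := chiS F mF tF e e0.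
  exists n0 => // n /= /hn0; by rewrite big_mkord.
pose C := isCharge.Build d T R nu nu0 nufin nuS.
pose nuc : {charge set T -> \bar R} := HB.pack nu C.
have [P [N [[mP posP] [mN negN] PN PN0]]] := Hahn_decomposition nuc.
exists P; split; first exact: mP.
  by move=> A mA AP; have h := posP A mA AP; rewrite -lee_fin; exact: h.
move=> A mA AP.
have AN : A `<=` N.
  by move=> x /AP nP; have [] : (P `|` N) x by rewrite PN.
by have h := negN A mA AN; rewrite -lee_fin; exact: h.
Unshelve. all: by end_near. Qed.

Section ultralimit.
Context (R : realType) (U : set_system nat) {UU : UltraFilter U}.
Hypothesis freeU : \oo `<=` U.
Implicit Types u v : nat -> R.

Definition bounded01 u := forall n, 0 <= u n <= 1.

Definition is_ulim u (l : R) := forall e, 0 < e -> U [set n | `|u n - l| < e].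

Lemma ultraN0 (A : set nat) : U A -> exists n, A n.
Proof. by move=> /filter_ex. Qed.

(** The limit is the supremum of the numbers that the sequence exceeds on a set of the ultrafilter. *)
Lemma ulim_ex u : bounded01 u -> exists l, is_ulim u l.
Proof.
move=> u01.
pose S := [set r | U [set n | r <= u n]].
have S0 : S 0.
  by apply: filterS filterT => n _ /=; have /andP[] := u01 n.
have Sub : ubound S 1.
  by move=> r /ultraN0[n /= rn]; apply: (le_trans rn); have /andP[] := u01 n.
have supS : has_sup S by split; [exists 0|exists 1].
exists (sup S) => e e0.
have [r Sr hr] := sup_adherent e0 supS.
have nS : ~ S (sup S + e / 2).
  move=> /(ub_le_sup (proj2 supS)); lra.
have [//|h2] := in_ultra_setVsetC [set n | sup S + e / 2 <= u n] UU.
apply: filterS (filterI Sr h2) => n /= [h1 /negP]; rewrite -ltNge => h3.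
by rewrite ltr_norml; lra.
Qed.

Lemma ulim_le u v l l' : is_ulim u l -> is_ulim v l' -> U [set n | u n <= v n] -> l <= l'.
Proof.
move=> hu hv huv; apply/ler_addgt0Pr => e e0.
have e2 : 0 < e / 2 by rewrite divr_gt0.
have [n /= [[h1 h2] h3]] := ultraN0 (filterI (filterI (hu _ e2) (hv _ e2)) huv).
by move: h1 h2; rewrite /= !ltr_norml; lra.
Qed.

Lemma ulim_uniq u l l' : is_ulim u l -> is_ulim u l' -> l = l'.
Proof.
move=> h h'; apply/eqP; rewrite eq_le.
by rewrite !(@ulim_le u u) //; apply: filterS filterT => n _ /=.
Qed.

Lemma ulimD u v l l' : is_ulim u l -> is_ulim v l' -> is_ulim (fun n => u n + v n) (l + l').
Proof.
move=> hu hv e e0; have e2 : 0 < e / 2 by rewrite divr_gt0.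
apply: filterS (filterI (hu _ e2) (hv _ e2)) => n /= [].
by rewrite !ltr_norml; lra.
Qed.

Lemma ulim_close u v l : is_ulim u l -> cv0 (fun n => `|u n - v n|) -> is_ulim v l.
Proof.
move=> hu huv e e0; have e2 : 0 < e / 2 by rewrite divr_gt0.
have [N hN] := huv _ e2.
have hU : U [set n | (N <= n)%N] by apply: freeU; exists N.
apply: filterS (filterI (hu _ e2) hU) => n /= [h1 /hN].
by move: h1; rewrite !ltr_norml; lra.
Qed.

End ultralimit.

(** * Asymptotically invariant sets of an ergodic relation *)

Section component.
Context (R : realType) (d : measure_display) (T : measurableType d).
Variable mu : probability T R.
Variables (E : set T) (rel : set (T * T)) (s : nat -> T -> T).
Hypotheses (mE : measurable E) (E0 : 0 < pr mu E) (bS : borel_equivalence E rel).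
Hypothesis G : generators mu E rel s.
Hypothesis erg : forall A, measurable A -> A `<=` E ->
  (forall i, pr mu (bdry (s i) A) = 0) -> pr mu A = 0 \/ pr mu A = pr mu E.

(** The saturation of N is invariant, so ergodicity makes it conull. *)
Lemma saturation_full N : measurable N -> N `<=` E -> 0 < pr mu N ->
  pr mu (E `\` \bigcup_i s i @^-1` N) = 0.
Proof.
move=> mN NE N0; have [_ _ _ sym trans] := bS.
have [M [mM M0 cov]] := gen_cover G.
have msN i : measurable (s i @^-1` N) by exact: measurable_preimage (gen_meas G i) mN.
pose sat := \bigcup_i s i @^-1` N.
have msat : measurable sat by exact: bigcup_measurable.
have satE : sat `<=` E.
  by move=> x [i _ /NE h]; rewrite -(gen_inv G i x); exact: (gen_stable G).
have satg j x : ~ M (s j x) -> sat x -> sat (s j x).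
  move=> nM sx; have Ex := satE x sx; case: sx => i _ Ni.
  have [|k hk] := cov (s j x) (s i x) _ nM.
    exact: trans (sym _ _ (gen_rel G j Ex)) (gen_rel G i Ex).
  by exists k => //=; rewrite -hk.
have bd j : pr mu (bdry (s j) sat) = 0.
  have mgM : measurable (s j @^-1` M) by exact: measurable_preimage (gen_meas G j) mM.
  have U0 : pr mu (M `|` s j @^-1` M) = 0.
    apply/eqP; rewrite eq_le pr_ge0 andbT.
    by apply: (le_trans (pr_setU_le _ mM mgM)); rewrite M0 (gen_pres G) // M0 addr0.
  apply: (pr_sub0 _ _ _ U0); [exact: measurable_bdry (gen_meas G j) msat|exact: measurableU|].
  move=> x hx; apply: contrapT => /not_orP[nMx nMg].
  move/bdryE : hx; apply; split; first exact: satg.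
  by rewrite -{2}(gen_inv G j x); apply: satg; rewrite (gen_inv G).
have Nsat : pr mu N <= pr mu sat.
  rewrite -(gen_pres G 0%N mN); apply: le_pr => // x Nx; exists 0%N => //.
rewrite pr_setD //; have [h|->] := erg msat satE bd; last by rewrite subrr.
by move: Nsat; rewrite h; move: N0; lra.
Qed.

Section ratio.
Variables (U : set_system nat) (UU : UltraFilter U) (freeU : \oo `<=` U).
Variables (A : nat -> set T) (e : R).
Hypotheses (mA : forall n, measurable (A n)) (AE : forall n, A n `<=` E).
Hypothesis cA : forall i, cv0 (fun n => pr mu (bdry (s i) (A n))).
Hypothesis e0 : 0 < e.
Hypothesis large : forall n, e <= pr mu (A n).

(** The ultralimit nu of C |-> mu (C /\ A n) is an invariant measure, dominated by mu, of total mass at least e. The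
    Hahn decomposition of nu - (e / 2) mu and ergodicity show that nu >= (e / 2) mu on every subset of E. *)
Lemma ratio_lower : forall C, measurable C -> C `<=` E ->
  U [set n | e / 4 * pr mu C <= pr mu (C `&` A n)].
Proof.
have mCA C n : measurable C -> measurable (C `&` A n) by move=> mC; exact: measurableI.
have /choice[nu hnu] : forall C, exists l, measurable C -> is_ulim U (fun n => pr mu (C `&` A n)) l.
  move=> C; have [mC|nm] := pselect (measurable C); last by exists 0.
  have [|l hl] := @ulim_ex _ U UU (fun n => pr mu (C `&` A n)); last by exists l.
  by move=> n; rewrite pr_ge0 pr_le1 //; exact: mCA.
have ucst (r : R) : is_ulim U (fun=> r) r.
  by move=> e1 e10; apply: filterS filterT => n _ /=; rewrite subrr normr0.
have nu_le C : measurable C -> nu C <= pr mu C.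
  move=> mC; apply: (ulim_le (hnu C mC) (ucst (pr mu C))).
  by apply: filterS filterT => n _; apply: le_pr => //; exact: mCA.
have nu_ge0 C : measurable C -> 0 <= nu C.
  move=> mC; apply: (ulim_le (ucst 0) (hnu C mC)).
  by apply: filterS filterT => n _; exact: pr_ge0.
have nuD C C' : measurable C -> measurable C' -> C `&` C' = set0 ->
    nu (C `|` C') = nu C + nu C'.
  move=> mC mC' CC'; apply: (ulim_uniq (hnu _ (measurableU _ _ mC mC'))).
  have E1 : (fun n => pr mu (C `&` A n) + pr mu (C' `&` A n)) =
      (fun n => pr mu ((C `|` C') `&` A n)).
    apply/funext => n; rewrite setIUl pr_setU //; [exact: mCA|exact: mCA|].
    by rewrite setIACA CC' set0I.
  by rewrite -E1; exact: ulimD (hnu C mC) (hnu C' mC').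
have nuE C C' : measurable C -> measurable C' -> C' `<=` C -> nu C = nu C' + nu (C `\` C').
  move=> mC mC' sub; rewrite -nuD //; first by rewrite setDUK.
    exact: measurableD.
  by rewrite -subset0 => x [h []].
have nu_mono C C' : measurable C -> measurable C' -> C' `<=` C -> nu C' <= nu C.
  by move=> mC mC' sub; rewrite (nuE C C') // lerDl nu_ge0 //; exact: measurableD.
have nu_inv i C : measurable C -> nu (s i @^-1` C) = nu C.
  move=> mC; have msC : measurable (s i @^-1` C) by exact: measurable_preimage (gen_meas G i) mC.
  apply: (ulim_uniq (hnu _ msC)); apply: (ulim_close freeU (hnu C mC)).
  apply: cv0_le (cA i) => n.
  have msA : measurable (s i @^-1` A n) by exact: measurable_preimage (gen_meas G i) (mA n).
  have -> : pr mu (s i @^-1` C `&` A n) = pr mu (C `&` s i @^-1` A n).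
    rewrite -[RHS](gen_pres G i); last exact: measurableI.
    by congr pr; apply/seteqP; split => x [h1 h2]; split => //; move: h2;
      rewrite /preimage /= (gen_inv G).
  have m1 := mCA C n mC; have m2 : measurable (C `&` s i @^-1` A n) by exact: measurableI.
  have mb := measurable_bdry (gen_meas G i) (mA n).
  have h1 : pr mu (C `&` A n) <= pr mu (C `&` s i @^-1` A n) + pr mu (bdry (s i) (A n)).
    apply: le_trans (pr_setU_le _ m2 mb); apply: le_pr => //; first exact: measurableU.
    move=> x [Cx Ax]; have [h|h] := pselect (A n (s i x)); first by left.
    by right; left.
  have h2 : pr mu (C `&` s i @^-1` A n) <= pr mu (C `&` A n) + pr mu (bdry (s i) (A n)).
    apply: le_trans (pr_setU_le _ m1 mb); apply: le_pr => //; first exact: measurableU.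
    move=> x [Cx Ax]; have [h|h] := pselect (A n x); first by left.
    by right; right.
  by rewrite ler_norml; move: h1 h2; lra.
(* Half of e leaves room: the saturation argument below needs kap < e. *)
pose kap := e / 2; have kap0 : 0 < kap by rewrite divr_gt0.
have kap1 : kap <= 1.
  have := large 0%N; have := pr_le1 mu (mA 0%N); rewrite /kap; move: e0; lra.
pose chi C := nu C - kap * pr mu C.
have nu0 : nu set0 = 0.
  apply/eqP; rewrite eq_le nu_ge0 // andbT; apply: le_trans (nu_le _ _) _ => //.
  by rewrite pr0.
have chi0 : chi set0 = 0 by rewrite /chi nu0 pr0 mulr0 subrr.
have [|P [mP chi_pos chi_neg]] := hahn_real chi0.
  move=> F mF tF e1 e10.
  pose D n := \bigcup_(i in [set i | (i < n)%N]) F i.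
  have mD n : measurable (D n) by exact: bigcup_measurable.
  have mU : measurable (\bigcup_i F i) by exact: bigcup_measurable.
  have DS n : D n.+1 = D n `|` F n.
    apply/seteqP; split => [x [i /=]|x [[i /= ni Fi]|Fx]].
    - by rewrite ltnS leq_eqVlt => /predU1P[->|ni] Fi; [right|left; exists i].
    - by exists i => //=; exact: ltnW.
    - by exists n => /=.
  have Ddis n : D n `&` F n = set0.
    rewrite -subset0 => x [[i /= ni Fi] Fx].
    move/trivIsetP : tF => /(_ i n Logic.I Logic.I); rewrite ltn_eqF // => /(_ isT).
    by rewrite -subset0 => /(_ x); apply.
  have sumnu n : \sum_(i < n) nu (F i) = nu (D n).
    elim: n => [|n IH]; last by rewrite big_ord_recr /= IH DS nuD.
    rewrite big_ord0 (_ : D 0%N = set0) ?nu0 //.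
    by rewrite -subset0 => x [].
  have sumpr n : \sum_(i < n) pr mu (F i) = pr mu (D n).
    elim: n => [|n IH]; last by rewrite big_ord_recr /= IH DS pr_setU.
    rewrite big_ord0 (_ : D 0%N = set0) ?pr0 //.
    by rewrite -subset0 => x [].
  have DU : \bigcup_n D n = \bigcup_i F i.
    apply/seteqP; split => [x [n _ [i _ Fi]]|x [i _ Fi]]; first by exists i.
    by exists i.+1 => //; exists i => /=.
  have [|n0 hn0] := pr_cvg_bigcup mu mD _ e10.
    by move=> n x [i /= ni Fi]; exists i => //=; exact: ltnW.
  exists n0 => n /hn0; rewrite DU => hn.
  rewrite /chi sumrB -mulr_sumr sumnu sumpr.
  have subD : D n `<=` \bigcup_i F i by move=> x [i _ Fi]; exists i.
  have mUD : measurable ((\bigcup_i F i) `\` D n) by exact: measurableD.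
  have e2 := nuE _ _ mU (mD n) subD; have e3 := pr_setD mu mU (mD n) subD.
  have h1 := nu_le _ mUD; have h2 := nu_ge0 _ mUD.
  have h3 : 0 <= kap * pr mu ((\bigcup_i F i) `\` D n) <= pr mu ((\bigcup_i F i) `\` D n).
    by rewrite mulr_ge0 ?(ltW kap0) ?pr_ge0 //= ler_piMl // pr_ge0.
  have -> : nu (\bigcup_i F i) - kap * pr mu (\bigcup_i F i) - (nu (D n) - kap * pr mu (D n)) =
    nu (\bigcup_i F i `\` D n) - kap * pr mu (\bigcup_i F i `\` D n).
    by rewrite e2 e3; ring.
  move: h3 => /andP[h3 h4]; rewrite ltr_norml; move: h1 h2 hn; lra.
have mEP : measurable (E `\` P) by exact: measurableD.
have EP0 : pr mu (E `\` P) = 0.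
  apply/eqP; rewrite eq_le pr_ge0 andbT leNgt; apply/negP => N0.
  have sub : E `\` P `<=` E by move=> x [].
  (* If the limit measure were below kap * mu on a non-null set N, invariance would carry this
     over to the translates of N, which exhaust E; but nu E >= e > kap. *)
  have full := saturation_full mEP sub N0.
  set N := E `\` P in mEP N0 sub full.
  have msN i : measurable (s i @^-1` N) by exact: measurable_preimage (gen_meas G i) mEP.
  pose sat := \bigcup_i s i @^-1` N.
  have msat : measurable sat by exact: bigcup_measurable.
  have satE : sat `<=` E.
    by move=> x [i _ /sub h]; rewrite -(gen_inv G i x); exact: (gen_stable G).
  have negN C : measurable C -> C `<=` N -> nu C <= kap * pr mu C.
    move=> mC CN; rewrite -subr_le0; apply: chi_neg => // x /CN[]//.
  pose D n := \bigcup_(i in [set i | (i < n)%N]) s i @^-1` N.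
  have mD n : measurable (D n) by exact: bigcup_measurable.
  have hD n : nu (D n) <= kap * pr mu (D n).
    elim: n => [|n IH].
      by rewrite (_ : D 0%N = set0) ?nu0 ?pr0 ?mulr0 // -subset0 => x [].
    have -> : D n.+1 = D n `|` (s n @^-1` N `\` D n).
      apply/seteqP; split => [x [i /=]|x [[i /= ni Fi]|[Fx _]]].
      - rewrite ltnS leq_eqVlt => /predU1P[->|ni] Fi; last by left; exists i.
        by have [?|?] := pselect (D n x); [left|right].
      - by exists i => //=; exact: ltnW.
      - by exists n => /=.
    have mX : measurable (s n @^-1` N `\` D n) by exact: measurableD.
    have dis : D n `&` (s n @^-1` N `\` D n) = set0 by rewrite -subset0 => x [h []].
    rewrite nuD // pr_setU // mulrDr lerD //.
    rewrite -(nu_inv n) // -[X in _ <= _ * X](gen_pres G n) //; apply: negN.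
      exact: measurable_preimage (gen_meas G n) mX.
    by move=> x [/=]; rewrite (gen_inv G).
  have nuEe : e <= nu E.
    apply: (ulim_le (ucst e) (hnu E mE)); apply: filterS filterT => n _ /=.
    by move/setIidr : (@AE n) => ->.
  have e2 := nuE E sat mE msat satE.
  have mEs : measurable (E `\` sat) by exact: measurableD.
  have e3 : nu (E `\` sat) <= 0 by rewrite -full; exact: nu_le.
  have e4 : 0 < e / 4 by rewrite divr_gt0.
  have [|n hn] := pr_cvg_bigcup mu mD _ e4.
    by move=> n x [i /= ni Fi]; exists i => //=; exact: ltnW.
  have DU : \bigcup_n D n = sat.
    apply/seteqP; split => [x [k _ [i _ Fi]]|x [i _ Fi]]; first by exists i.
    by exists i.+1 => //; exists i => /=.
  have := hn n (leqnn n); rewrite DU => hn'.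
  have subD : D n `<=` sat by move=> x [i _ Fi]; exists i.
  have e5 := nuE _ _ msat (mD n) subD.
  have e6 := nu_le _ (measurableD msat (mD n)).
  have e7 : kap * pr mu (D n) <= kap * 1 by rewrite ler_pM2l // pr_le1.
  have := hD n; move: e0 e7; rewrite /kap; lra.
move=> C mC CE; have mCP : measurable (C `&` P) by exact: measurableI.
have mCP' : measurable (C `\` P) by exact: measurableD.
have h1 : kap * pr mu C <= nu C.
  have -> : pr mu C = pr mu (C `&` P).
    rewrite (pr_setID mu mC mP) (@pr_sub0 _ _ _ mu (C `\` P) (E `\` P)) ?addr0 //.
    by move=> x [/CE].
  apply: (@le_trans _ _ (nu (C `&` P))); last by apply: nu_mono => // x [].
  by rewrite -subr_ge0; apply: chi_pos => // x [].
have [->|Cn0] := eqVneq (pr mu C) 0.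
  by apply: filterS filterT => n _ /=; rewrite mulr0 pr_ge0.
have C0 : 0 < pr mu C by rewrite lt_neqAle pr_ge0 eq_sym Cn0.
have k4 : 0 < e / 4 * pr mu C by rewrite mulr_gt0 // divr_gt0.
apply: filterS (hnu C mC _ k4) => n /=; rewrite ltr_norml => /andP[h2 _].
by move: h1 h2; rewrite /kap; lra.
Qed.

End ratio.

End component.

Section iterated_splitting.
Context (R : realType) (d : measure_display) (T : measurableType d).
Variable mu : probability T R.
Variables (E : set T) (rel : set (T * T)) (s : nat -> T -> T).
Hypotheses (mE : measurable E) (G : generators mu E rel s).

Definition nat_partition (F : T -> nat) K :=
  (forall x, (F x < K)%N) /\ forall z, measurable [set x | F x = z].

Section iterate.
Variables (U : set_system nat) (UU : UltraFilter U) (freeU : \oo `<=` U).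
Variables (A : nat -> set T) (k : R).
Hypotheses (mA : forall n, measurable (A n)) (k01 : 0 < k <= 1).
Hypothesis cA : forall i, cv0 (fun n => pr mu (bdry (s i) (A n))).
Hypothesis split : forall C, measurable C -> C `<=` E ->
  U [set n | k * pr mu C <= pr mu (C `&` A n) /\ k * pr mu C <= pr mu (C `\` A n)].

Lemma filter_below (P : nat -> set nat) m : (forall j, U (P j)) ->
  U [set n | forall j, (j < m)%N -> P j n].
Proof.
move=> UP; elim: m => [|m IH]; first by apply: filterS filterT => n _ j.
apply: filterS (filterI IH (UP m)) => n /= [h1 h2] j.
by rewrite ltnS leq_eqVlt => /predU1P[->|/h1].
Qed.

Lemma complementary_parts (c a b : R) : k * c <= a -> k * c <= b -> c = a + b ->
  a <= (1 - k) * c /\ b <= (1 - k) * c.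
Proof. by move=> h1 h2 h; rewrite mulrBl mul1r; split; lra. Qed.

Lemma split_half (a b eta : R) : a <= eta / 2 -> b <= eta / 2 -> a + b <= eta.
Proof. by lra. Qed.

(** Each step cuts all atoms of the previous partition by one set A n: it splits every atom in a proportion at least k,
    so the measures of the atoms shrink by the factor 1 - k, and its boundary is as small as one likes. *)
Lemma iterated_split L J (eta : R) : 0 < eta -> exists F,
  [/\ nat_partition F (2 ^ L),
    forall z, pr mu (E `&` [set x | F x = z]) <= (1 - k) ^+ L &
    forall j, (j < J)%N -> pr mu (E `&` [set x | F (s j x) <> F x]) <= eta].
Proof.
have [k0 k1] := andP k01.
elim: L eta => [|L IH] eta eta0.
  exists (fun=> 0%N); split.
  - split=> // z; have [<-|nz] := eqVneq 0%N z.
      by rewrite (_ : [set _ | _] = setT) //; apply/seteqP; split.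
    rewrite (_ : [set _ | _] = set0) // -subset0 => x /= e; by rewrite e eqxx in nz.
  - move=> z; rewrite expr0 pr_le1 //; apply: measurableI => //.
    have [<-|nz] := eqVneq 0%N z.
      by rewrite (_ : [set _ | _] = setT) //; apply/seteqP; split.
    rewrite (_ : [set _ | _] = set0) // -subset0 => x /= e; by rewrite e eqxx in nz.
  - move=> j _; rewrite (_ : _ `&` _ = set0) ?pr0 ?(ltW eta0) // -subset0.
    by move=> x [_ /=].
have eta2 : 0 < eta / 2 by rewrite divr_gt0.
have [F [[FL mF] FE FJ]] := IH _ eta2.
pose C z := E `&` [set x | F x = z].
have mC z : measurable (C z) by exact: measurableI.
have CE z : C z `<=` E by move=> x [].
have h1 := filter_below (2 ^ L) (fun z => split (mC z) (CE z)).
have h2 : U [set n | forall j, (j < J)%N -> pr mu (bdry (s j) (A n)) < eta / 2].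
  apply: filter_below => j; have [n0 hn0] := cA j eta2.
  by apply: freeU; exists n0.
have [n [{h1} /= spl {h2} bd]] := ultraN0 (filterI h1 h2).
(* The old label is doubled, and the new bit tells on which side of A n a point lies. *)
pose b x := `[< A n x >].
exists (fun x => b x + (F x).*2)%N.
have lev z : [set x | (b x + (F x).*2)%N = z] = [set x | F x = z./2] `&`
    (if odd z then A n else ~` A n).
  apply/seteqP; split => x /=.
    move=> <-; rewrite half_bit_double; split => //.
    by rewrite oddD odd_double addbF oddb /b; case: asboolP.
  move=> [->]; rewrite -[X in _ = X](odd_double_half z); case: (odd z) => h.
    by rewrite /b asboolT.
  by rewrite /b asboolF.
have mlev z : measurable (if odd z then A n else ~` A n).
  by case: (odd z) => //; exact: measurableC.
split.
- split=> [x|z]; last by rewrite lev; exact: measurableI.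
  have h : ((F x).+1.*2 <= (2 ^ L).*2)%N by rewrite leq_double.
  rewrite expnS mul2n; apply: leq_trans h; rewrite doubleS.
  by case: (b x) => //; rewrite add0n ltnS leqnSn.
- move=> z; rewrite lev setIA -/(C _).
  have [zL|Lz] := ltnP z./2 (2 ^ L)%N; last first.
    rewrite (_ : C _ = set0) ?set0I ?pr0 ?exprn_ge0 ?subr_ge0 // -subset0.
    by move=> x [_ /= e]; have := FL x; rewrite e ltnNge Lz.
  have [s1 s2] := spl _ zL.
  have e1 := pr_setID mu (mC z./2) (mA n).
  have e2 : (1 - k) * pr mu (C z./2) <= (1 - k) ^+ L.+1.
    by rewrite exprS ler_wpM2l ?subr_ge0 //; exact: FE.
  apply: le_trans e2.
  have [h1 h2] := complementary_parts s1 s2 e1.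
  by case: (odd z) => //; rewrite -setDE.
- move=> j jJ; have mb := measurable_bdry (gen_meas G j) (mA n).
  have mF' : measurable [set x | F (s j x) <> F x].
    by apply: (@measurable_label_neq _ _ F (s j) id) => //; exact: (gen_meas G j).
  have mX : measurable (E `&` [set x | F (s j x) <> F x]) by exact: measurableI.
  have mY : measurable (E `&` [set x | (b (s j x) + (F (s j x)).*2)%N <> (b x + (F x).*2)%N]).
    apply: measurableI => //.
    apply: (@measurable_label_neq _ _ (fun x => b x + (F x).*2)%N (s j) id) => //.
      by move=> z; rewrite lev; exact: measurableI.
    exact: (gen_meas G j).
  have := FJ j jJ; have := bd j jJ; have := pr_setU_le mu mX mb.
  suff : pr mu (E `&` [set x | (b (s j x) + (F (s j x)).*2)%N <> (b x + (F x).*2)%N]) <=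
      pr mu ((E `&` [set x | F (s j x) <> F x]) `|` bdry (s j) (A n)).
    by move=> h1 h2 h3 h4; exact: le_trans h1 (le_trans h2 (split_half h4 (ltW h3))).
  apply: le_pr => //; first exact: measurableU.
  move=> x [Ex /= ne]; have [e1|e1] := eqVneq (F (s j x)) (F x); last first.
    by left; split => //=; exact/eqP.
  right; apply/bdryE => e2; apply: ne; rewrite e1; congr (_ + _)%N.
  by rewrite /b (asbool_equiv_eq e2).
Qed.

Lemma iterated_split_fine : almost_invariant_fine mu E s.
Proof.
have /choice[F hF] : forall n, exists F, [/\ nat_partition F (2 ^ n),
    forall z, pr mu (E `&` [set x | F x = z]) <= (1 - k) ^+ n &
    forall j, (j < n)%N -> pr mu (E `&` [set x | F (s j x) <> F x]) <= n.+1%:R^-1].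
  by move=> n; apply: iterated_split; rewrite invr_gt0.
have [k0 k1] := andP k01.
exists F, (fun n => 2 ^ n)%N; split.
- by move=> n; have [[]] := hF n.
- by move=> n; have [[]] := hF n.
- move=> e e0; have : `|1 - k| < 1 by rewrite ger0_norm ?subr_ge0 //; move: k0; lra.
  move=> /cvg_expr/cvgrPdist_lt/(_ e e0)[n0 _ hn0]; exists n0 => n /hn0 /=.
  rewrite sub0r normrN ger0_norm ?exprn_ge0 ?subr_ge0 // => h z.
  by have [_ hz _] := hF n; exact: le_trans (hz z) (ltW h).
- move=> j e /invS_lt[n0 hn0]; exists (maxn n0 j.+1) => n; rewrite geq_max => /andP[n0n jn].
  have [_ _ hj] := hF n; apply: le_lt_trans (hj j jn) (le_lt_trans _ hn0).
  by rewrite lef_pV2 ?posrE // ler_nat.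
Qed.


End iterate.

End iterated_splitting.

Section ergodic_component.
Context (R : realType) (d : measure_display) (T : measurableType d).
Variable mu : probability T R.
Variables (E : set T) (rel : set (T * T)) (s : nat -> T -> T).
Hypotheses (mE : measurable E) (E0 : 0 < pr mu E) (bS : borel_equivalence E rel).
Hypothesis G : generators mu E rel s.
Hypothesis erg : forall A, measurable A -> A `<=` E ->
  (forall i, pr mu (bdry (s i) A) = 0) -> pr mu A = 0 \/ pr mu A = pr mu E.

(** Both A n and its complement in E are asymptotically invariant and of measure at least e, so ratio_lower applies to
    both. *)
Lemma ergodic_asymptotic_fine (A : nat -> set T) e : 0 < e ->
  (forall n, measurable (A n) /\ A n `<=` E) ->
  (forall i, cv0 (fun n => pr mu (bdry (s i) (A n)))) ->
  (forall n, e <= pr mu (A n) * (pr mu E - pr mu (A n))) ->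
  almost_invariant_fine mu E s.
Proof.
move=> e0 hA cA large.
have mA n : measurable (A n) by case: (hA n).
have AE n : A n `<=` E by case: (hA n).
have [U [UU freeU]] := ultraFilterLemma (F := \oo : set_system nat) _.
have mB n : measurable (E `\` A n) by exact: measurableD.
have BE n : E `\` A n `<=` E by move=> x [].
have cB i : cv0 (fun n => pr mu (bdry (s i) (E `\` A n))).
  apply: cv0_le (cA i) => n; apply: le_pr; try exact: measurable_bdry (gen_meas G i) _.
  move=> x /bdryE h; apply/bdryE => h2; apply: h.
  split=> -[Ex nA]; split.
  - exact: (gen_stable G).
  - by move/h2.
  - by rewrite -(gen_inv G i x); exact: (gen_stable G).
  - by move/h2.
have bounds n : e <= pr mu (A n) /\ e <= pr mu (E `\` A n).
  rewrite pr_setD //; have h1 := pr_le1 mu mE; have h2 := pr_ge0 mu (A n).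
  have h3 := le_pr mu (mA n) mE (@AE n); have := large n.
  by split; nra.
have rA := ratio_lower mE bS G erg UU freeU mA AE cA e0 (fun n => proj1 (bounds n)).
have rB := ratio_lower mE bS G erg UU freeU mB BE cB e0 (fun n => proj2 (bounds n)).
have e41 : 0 < e / 4 <= 1.
  have := proj1 (bounds 0%N); have := pr_le1 mu (mA 0%N); move: e0; lra.
apply: (iterated_split_fine mE G UU freeU mA e41 cA) => C mC CE.
apply: filterS (filterI (rA C mC CE) (rB C mC CE)) => n /= [-> h]; split => //.
apply: le_trans h _; apply: le_pr; [exact: measurableI|exact: measurableD|].
by move=> x [Cx []].
Qed.

(** A failure of strong ergodicity gives a subsequence along which the product of measures is bounded below. *)
Lemma no_fine_gens_strongly_ergodic :
  ~ almost_invariant_fine mu E s -> gens_strongly_ergodic mu E s.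
Proof.
move=> nf A hA cA; apply: contrapT => ncv; apply: nf.
have [e [e0 /choice[f hf]]] : exists e, 0 < e /\ forall N, exists n, (N <= n)%N /\
    e <= pr mu (A n) * (pr mu E - pr mu (A n)).
  apply: contrapT => h; apply: ncv => e e0; apply: contrapT => h2; apply: h.
  exists e; split => // N; apply: contrapT => h3; apply: h2; exists N => n Nn.
  by rewrite ltNge; apply/negP => h4; apply: h3; exists n.
apply: (@ergodic_asymptotic_fine (fun n => A (f n)) e e0) => // [i e' e'0|n].
- have [N hN] := cA i e' e'0; exists N => n Nn; apply: hN.
  by apply: leq_trans Nn _; have [] := hf n.
- by have [] := hf n.
Qed.

End ergodic_component.

(** * Exhaustion and the diffuse part *)

Section exhaustion.
Context (R : realType) (d : measure_display) (T : measurableType d).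
Variable mu : probability T R.

Lemma greedy_choice (P : set (set T)) (U : set T) : P `<=` measurable ->
  exists A, [/\ P A \/ A = set0, A `&` U = set0 &
    forall B, P B -> B `&` U = set0 -> pr mu B <= 2 * pr mu A].
Proof.
move=> Pm.
have [h|h] := pselect (exists B, [/\ P B, B `&` U = set0 & 0 < pr mu B]); last first.
  exists set0; split; [by right|by rewrite set0I|].
  move=> B PB BU; rewrite pr0 mulr0 leNgt; apply/negP => B0; apply: h.
  by exists B.
have [B0 [PB0 BU0 pB0]] := h.
(* Half of the supremum S is attained. *)
pose S := [set r | exists B, [/\ P B, B `&` U = set0 & r = pr mu B]].
have supS : has_sup S.
  split; first by exists (pr mu B0), B0.
  by exists 1 => _ [B [/Pm mB _ ->]]; exact: pr_le1.
have subS B : P B -> B `&` U = set0 -> pr mu B <= sup S.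
  by move=> PB BU; apply: (ub_le_sup (proj2 supS)); exists B.
have s0 : 0 < sup S := lt_le_trans pB0 (subS B0 PB0 BU0).
have s2 : 0 < sup S / 2 by rewrite divr_gt0.
have [_ [A [PA AU ->]] hA] := sup_adherent s2 supS.
exists A; split => //; first by left.
by move=> B PB BU; apply: le_trans (subS B PB BU) _; move: hA; lra.
Qed.

(** A maximal disjoint sequence in P, chosen greedily: each set has at least half of the largest measure still
    available, and the measures of disjoint sets tend to 0. *)
Lemma exhaustion (P : set (set T)) : P `<=` measurable ->
  exists A : nat -> set T, [/\ forall n, P (A n) \/ A n = set0,
    trivIset setT A &
    forall B, P B -> B `&` \bigcup_n A n = set0 -> pr mu B = 0].
Proof.
move=> Pm.
have /choice[next hnext] := fun U => greedy_choice U Pm.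
pose U := fix U n := if n is n'.+1 then U n' `|` next (U n') else set0.
pose A n := next (U n).
have PA n : P (A n) \/ A n = set0 by have [] := hnext (U n).
have mA n : measurable (A n) by case: (PA n) => [/Pm//|->].
have AU n : A n `&` U n = set0 by have [] := hnext (U n).
have UA n : U n = \bigcup_(i in [set i | (i < n)%N]) A i.
  elim: n => [|n IH]; first by apply/esym; rewrite -subset0 => x [].
  apply/seteqP; split => [x|x [i /=]].
    move=> /= [|h]; last by exists n => /=.
    by rewrite IH => -[i /= ni Ai]; exists i => //=; exact: ltnW.
  rewrite ltnS leq_eqVlt => /predU1P[->|ni] Ai; first by right.
  by left; rewrite IH; exists i.
have dis : trivIset setT A.
  apply: ltn_trivIset => n2 n1 n12; rewrite -subset0 => x [A1 A2].
  have Ux : U n2 x by rewrite UA; exists n1.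
  have : (A n2 `&` U n2) x by [].
  by rewrite AU.
exists A; split => // B PB BA.
apply/eqP; rewrite eq_le pr_ge0 andbT leNgt; apply/negP => B0.
have le n : pr mu B <= 2 * pr mu (A n).
  have [_ _ h] := hnext (U n); apply: (h) => //; rewrite -subset0 => x [Bx].
  rewrite UA => -[i _ Ai].
  have : (B `&` \bigcup_n A n) x by split => //; exists i.
  by rewrite BA.
have sum n : n%:R * (pr mu B / 2) <= pr mu (U n).
  elim: n => [|n IH]; first by rewrite mul0r pr_ge0.
  have mU : measurable (U n) by rewrite UA; exact: bigcup_measurable.
  have -> : U n.+1 = U n `|` A n by [].
  rewrite pr_setU //; last by rewrite setIC; exact: AU.
  by rewrite -natr1 mulrDl mul1r lerD //; have := le n; lra.
have B2 : 0 < pr mu B / 2 by rewrite divr_gt0.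
have [k hk] := invS_lt B2.
have mU : measurable (U k.+1) by rewrite UA; exact: bigcup_measurable.
have := le_trans (sum k.+1) (pr_le1 mu mU); apply/negP; rewrite -ltNge.
by move: hk; rewrite -[_^-1]mul1r ltr_pdivrMr // mulrC.
Qed.

(** Points that lie in the same sets D k get the same label, so the labelling is as invariant as these sets are. *)
Fixpoint last_hit (D : nat -> set T) N x : nat :=
  if N is N'.+1 then (if `[< D N' x >] then N'.+1 else last_hit D N' x) else 0.

Section last_hit.
Variable D : nat -> set T.
Hypothesis mD : forall n, measurable (D n).

Lemma last_hit_le N x : (last_hit D N x < N.+1)%N.
Proof.
elim: N => [|N IH] //=; case: asboolP => _; first by rewrite ltnS.
exact: ltn_trans IH _.
Qed.

Lemma measurable_last_hit N z : measurable [set x | last_hit D N x = z].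
Proof.
elim: N => [|N IH] /=.
  have [<-|nz] := eqVneq 0%N z.
    by rewrite (_ : [set _ | _] = setT) //; apply/seteqP; split.
  by rewrite (_ : [set _ | _] = set0) // -subset0 => x /= e; rewrite e eqxx in nz.
rewrite (_ : [set _ | _] = (D N `&` [set _ | N.+1 = z]) `|`
    (~` D N `&` [set x | last_hit D N x = z])).
  apply: measurableU; last by apply: measurableI => //; exact: measurableC.
  have [->|nz] := eqVneq N.+1 z.
    by rewrite (_ : [set _ | _] = setT) ?setIT //; apply/seteqP; split.
  by rewrite (_ : [set _ | _] = set0) ?setI0 // -subset0 => x /= e; rewrite e eqxx in nz.
apply/seteqP; split => x /=; case: asboolP => h.
- by left.
- by right.
- by case=> [[]|[]].
- by case=> [[]|[]].
Qed.

Lemma last_hitS N z : [set x | last_hit D N x = z.+1] `<=` D z.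
Proof.
by elim: N => [|N IH] x //=; case: asboolP => [h [<-]//|_]; exact: IH.
Qed.

Lemma last_hit0 N j x : last_hit D N x = 0%N -> (j < N)%N -> ~ D j x.
Proof.
elim: N => [|N IH] //=; case: asboolP => // h h0.
by rewrite ltnS leq_eqVlt => /predU1P[->//|]; exact: IH.
Qed.

Lemma last_hit_eq N x y : (forall j, D j x <-> D j y) -> last_hit D N x = last_hit D N y.
Proof.
by move=> h; elim: N => [|N IH] //=; rewrite IH (asbool_equiv_eq (h N)).
Qed.

End last_hit.

End exhaustion.

Section diffuse.
Context (R : realType) (d : measure_display) (T : measurableType d).
Variable mu : probability T R.
Variable s : nat -> T -> T.
Hypothesis ms : forall i, measurable_fun setT (s i).

Definition gens_invariant_set : set (set T) :=
  [set A | measurable A /\ forall i, pr mu (bdry (s i) A) = 0].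

Lemma gens_invariant_bigcup (A : nat -> set T) :
  (forall n, gens_invariant_set (A n)) -> gens_invariant_set (\bigcup_n A n).
Proof.
move=> hA; have mA n : measurable (A n) by case: (hA n).
have mU : measurable (\bigcup_n A n) by exact: bigcup_measurable.
split => // i; have mb n := measurable_bdry (ms i) (mA n).
apply: (@pr_sub0 _ _ _ mu _ (\bigcup_n bdry (s i) (A n))).
- exact: measurable_bdry.
- exact: bigcup_measurable.
- move=> x /bdryE h; apply: contrapT => h2; apply: h.
  by split=> -[n _ An]; exists n => //; apply: contrapT => h3; apply: h2;
    exists n => //; apply/bdryE => h4; apply: h3; apply/h4.
- by apply: pr_bigcup0 => // n; have [] := hA n.
Qed.

Lemma gens_invariant_setD (A B : set T) :
  gens_invariant_set A -> gens_invariant_set B -> gens_invariant_set (A `\` B).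
Proof.
move=> [mA hA] [mB hB]; have mAB : measurable (A `\` B) by exact: measurableD.
split => // i; have ma := measurable_bdry (ms i) mA; have mb := measurable_bdry (ms i) mB.
apply: (@pr_sub0 _ _ _ mu _ (bdry (s i) A `|` bdry (s i) B)).
- exact: measurable_bdry.
- exact: measurableU.
- move=> x /bdryE h; apply: contrapT => /not_orP[h1 h2]; apply: h.
  have {}h1 : A x <-> A (s i x) by apply: contrapT => k; apply: h1; apply/bdryE.
  have {}h2 : B x <-> B (s i x) by apply: contrapT => k; apply: h2; apply/bdryE.
  by split=> -[/h1 ? nB]; split => // /h2.
- apply/eqP; rewrite eq_le pr_ge0 andbT; apply: le_trans (pr_setU_le _ ma mb) _.
  by rewrite hA hB addr0.
Qed.

Definition gens_ergodic_piece : set (set T) :=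
  [set A | [/\ gens_invariant_set A, 0 < pr mu A &
    forall B, gens_invariant_set B -> B `<=` A -> pr mu B = 0 \/ pr mu B = pr mu A]].

Variable E : set T.
Hypothesis iE : gens_invariant_set E.
Hypothesis noerg : forall A, A `<=` E -> ~ gens_ergodic_piece A.

(** An invariant set that is not an ergodic piece splits in two invariant sets of positive measure, one of which has at
    most half of the measure. *)
Lemma small_invariant_subset A n : gens_invariant_set A -> A `<=` E -> 0 < pr mu A ->
  exists B, [/\ gens_invariant_set B, B `<=` A, 0 < pr mu B & pr mu B * n.+1%:R <= 1].
Proof.
move=> iA AE A0; elim: n => [|n [B [iB BA B0 Bn]]].
  by exists A; split => //; rewrite mulr1; case: iA => mA _; exact: pr_le1.
have BE := subset_trans BA AE; have [mB _] := iB.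
have [C [iC CB C0 CC]] : exists C, [/\ gens_invariant_set C, C `<=` B,
    pr mu C != 0 & pr mu C != pr mu B].
  apply: contrapT => h; apply: (@noerg B) => //; split => // C iC CB.
  have [h1|h1] := eqVneq (pr mu C) 0; first by left.
  have [h2|h2] := eqVneq (pr mu C) (pr mu B); first by right.
  by case: h; exists C.
have [mC _] := iC.
have eD := pr_setD mu mB mC CB; have leC := le_pr mu mC mB CB.
have posC : 0 < pr mu C by rewrite lt_neqAle eq_sym C0 pr_ge0.
have posD : 0 < pr mu (B `\` C) by rewrite eD subr_gt0 lt_neqAle CC.
have nn : n.+2%:R <= 2 * n.+1%:R :> R by rewrite -natrM ler_nat; lia.
have n0 : 0 <= n.+2%:R :> R by [].
have [h|h] := leP (pr mu C) (pr mu B / 2).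
  by exists C; split => //; [exact: subset_trans BA|nra].
exists (B `\` C); split => //; first exact: gens_invariant_setD.
  by move=> x [/BA].
by rewrite eD; nra.
Qed.

(** Without ergodic pieces, E is exhausted by invariant sets of measure at most 1 / (n + 1); finitely many of them,
    together with a small remainder, form an invariant partition. *)
Lemma diffuse_fine : almost_invariant_fine mu E s.
Proof.
have [mE _] := iE.
have main : forall n : nat, exists F : T -> nat, exists K,
   [/\ forall x, (F x < K)%N, forall z, measurable [set x | F x = z],
     forall z, pr mu (E `&` [set x | F x = z]) <= n.+1%:R^-1 &
     forall j, pr mu (E `&` [set x | F (s j x) <> F x]) = 0].
  move=> n; have n0 : 0 < n.+1%:R^-1 :> R by rewrite invr_gt0.
  pose P := [set B | [/\ gens_invariant_set B, B `<=` E & pr mu B <= n.+1%:R^-1]].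
  have [|D [PD _ maxD]] := @exhaustion _ _ _ mu P; first by move=> B [[]].
  have iD k : gens_invariant_set (D k).
    case: (PD k) => [[]//|->]; split => // i.
    by rewrite (_ : bdry _ _ = set0) ?pr0 // -subset0 => x /bdryE; apply.
  have mD k : measurable (D k) by case: (iD k).
  have Dn k : pr mu (D k) <= n.+1%:R^-1.
    by case: (PD k) => [[]//|->]; rewrite pr0 ltW.
  have iU := gens_invariant_bigcup iD; have [mU _] := iU.
  have iL := gens_invariant_setD iE iU; have [mL _] := iL.
  have L0 : pr mu (E `\` \bigcup_k D k) = 0.
    apply/eqP; rewrite eq_le pr_ge0 andbT leNgt; apply/negP => pL.
    have [|B [iB BL B0 Bn]] := @small_invariant_subset _ n iL _ pL; first by move=> x [].
    suff h : pr mu B = 0 by rewrite h ltxx in B0.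
    apply: maxD; last by rewrite -subset0 => x [/BL[]].
    split => //; first by move=> x /BL[].
    by rewrite -[_^-1]mul1r ler_pdivlMr.
  pose V m := \bigcup_(i in [set i | (i < m)%N]) D i.
  have mV m : measurable (V m) by exact: bigcup_measurable.
  have [|N hN] := pr_cvg_bigcup mu mV _ n0.
    by move=> m x [i /= im Di]; exists i => //=; exact: ltnW.
  have VU : \bigcup_m V m = \bigcup_k D k.
    apply/seteqP; split => [x [m _ [i _ Di]]|x [i _ Di]]; first by exists i.
    by exists i.+1 => //; exists i => /=.
  have {hN} := hN N (leqnn N); rewrite VU => hN.
  exists (last_hit D N), N.+1; split.
  - exact: last_hit_le.
  - exact: measurable_last_hit.
  - move=> [|z]; have ml w := measurable_last_hit mD N w; last first.
      apply: le_trans (Dn z); apply: le_pr => //; first exact: measurableI.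
      by move=> x [_]; exact: last_hitS.
    have mUV : measurable (\bigcup_k D k `\` V N) by exact: measurableD.
    apply: (@le_trans _ _ (pr mu ((E `\` \bigcup_k D k) `|` (\bigcup_k D k `\` V N)))).
      apply: le_pr; [exact: measurableI|exact: measurableU|] => x [Ex /= h].
      have [h2|h2] := pselect ((\bigcup_k D k) x); last by left.
      by right; split => // -[j /= jN]; exact: last_hit0 h jN.
    by apply: le_trans (pr_setU_le _ mL mUV) _; rewrite L0 add0r ltW.
  - move=> j; have mb k := measurable_bdry (ms j) (mD k).
    apply: (@pr_sub0 _ _ _ mu _ (\bigcup_k bdry (s j) (D k))).
    + apply: measurableI => //.
      by apply: (@measurable_label_neq _ _ (last_hit D N) (s j) id) => //; exact: measurable_last_hit.
    + exact: bigcup_measurable.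
    + move=> x [_ /= ne]; apply: contrapT => h; apply: ne; apply: last_hit_eq => k.
      by apply: contrapT => h2; apply: h; exists k => //; apply/bdryE => h3; apply: h2;
        split => /h3.
    + by apply: pr_bigcup0 => // k; have [] := iD k.
have /choice[F /choice[K hF]] := main.
exists F, K; split.
- by move=> n; have [] := hF n.
- by move=> n; have [] := hF n.
- move=> e /invS_lt[n0 hn0]; exists n0 => n nn z; have [_ _ h _] := hF n.
  apply: le_trans (h z) (le_trans _ (ltW hn0)).
  by rewrite lef_pV2 ?posrE // ler_nat.
- by move=> j e e0; exists 0%N => n _; have [_ _ _ ->] := hF n.
Qed.

End diffuse.

(** * Ergodic decomposition of a coamenable subrelation *)

Section subrelation.
Context (R : realType) (d : measure_display) (T : measurableType d).
Variables (mu : probability T R) (relS relR : set (T * T)) (g s : nat -> T -> T).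
Hypothesis mdiag : measurable [set p : T * T | p.2 = p.1].
Hypotheses (bS : borel_equivalence setT relS) (bR : borel_equivalence setT relR).
Hypotheses (GR : generators mu setT relR g) (GS : generators mu setT relS s).
Hypothesis SR : relS `<=` relR.
Hypothesis coam : everywhere_coamenable setT mu relS relR.
Hypothesis serg : strongly_ergodic setT mu relR.

Definition restr_gens (h : nat -> T -> T) (rel : set (T * T)) i x :=
  if `[< rel (x, h i x) >] then h i x else x.

Lemma borel_equivalence_restr (rel : set (T * T)) (E : set T) : borel_equivalence setT rel -> measurable E ->
  borel_equivalence E (restr_rel rel E).
Proof.
move=> [mrel _ refl sym trans] mE; split.
- by apply: measurableI => //; exact: measurableX.
- by move=> p [].
- by move=> x Ex; split => //; exact: refl.
- by move=> x y [/sym h [Ex Ey]].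
- by move=> x y z [h1 [Ex _]] [h2 [_ Ez]]; split => //; exact: trans h1 h2.
Qed.

Lemma generators_restr (rel : set (T * T)) h (E : set T) : borel_equivalence setT rel -> generators mu setT rel h ->
  measurable E -> generators mu E (restr_rel rel E) (restr_gens h (restr_rel rel E)).
Proof.
move=> b H mE; apply: (generators_restrict H) => //.
- exact: borel_equivalence_restr.
- by move=> p [].
Qed.

(** The hypotheses on relS and relR pass to E, where strongly_ergodic_no_fine applies. *)
Lemma no_fine_restr E : measurable E -> 0 < pr mu E ->
  ~ almost_invariant_fine mu E (restr_gens s (restr_rel relS E)).
Proof.
move=> mE E0; have [_ _ _ sym trans] := bR.
have GE := generators_restr bR GR mE.
apply: (strongly_ergodic_no_fine mdiag mE E0 (borel_equivalence_restr bR mE)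
  (borel_equivalence_restr bS mE) _ GE (generators_restr bS GS mE)).
- by move=> p [/SR].
- by apply: coam => //; rewrite prE // lte_fin.
- apply: (gens_strongly_ergodic_restr mdiag sym trans GR _ mE E0 GE).
  exact: strongly_ergodic_gens serg.
Qed.

Lemma restr_gens_inside E x i : E x -> E (s i x) ->
  restr_gens s (restr_rel relS E) i x = s i x.
Proof.
move=> Ex Es; rewrite /restr_gens asboolT //; split => //.
exact: (gen_rel GS).
Qed.

Lemma component_strongly_ergodic F : ergodic_component setT mu relS F ->
  strongly_ergodic F (normalized_restr mu F) (restr_rel relS F).
Proof.
move=> [I [E [[inv pos _ _ erg] [i Ii ->]]]].
have [mE _ _] := inv i Ii.
have E0 : 0 < pr mu (E i) by have := pos i Ii; rewrite prE // lte_fin.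
have En0 : pr mu (E i) != 0 by rewrite gt_eqF.
have GE := generators_restr bS GS mE.
apply: (strongly_ergodic_of_gens mE E0 GE).
apply: (no_fine_gens_strongly_ergodic mE (borel_equivalence_restr bS mE) GE); last first.
  exact: no_fine_restr.
move=> A mA AE hA.
have sn := same_null_restr mE En0.
have /erg : invariant_set (E i) (normalized_restr mu (E i)) (restr_rel relS (E i)) A.
  exact/(gens_invariant mdiag mE GE sn mA AE).
move=> /(_ Ii); rewrite normalized_restrE // (setIidr AE) => -[[/eqP]|[h]].
  by rewrite mulf_eq0 invr_eq0 (negbTE En0) orbF => /eqP; left.
by right; apply: (divIf En0); rewrite h divff.
Qed.

(** Take a maximal disjoint sequence of ergodic pieces. Their complement has no ergodic piece, so if it were not null
    diffuse_fine would give it fine invariant partitions. Ergodicity for the restricted relation is the same as for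
    subsets of the piece since the piece is invariant. *)
Lemma ergodic_pieces : countable_ergodic_decomposition setT mu relS.
Proof.
have sn := same_null_mu mu; have ms := gen_meas GS.
have Pm : gens_ergodic_piece mu s `<=` measurable by move=> A [[]].
have [A [PA dis maxA]] := exhaustion mu Pm.
have iA n : gens_invariant_set mu s (A n).
  case: (PA n) => [[]//|->]; split => // i.
  by rewrite (_ : bdry _ _ = set0) ?pr0 // -subset0 => x /bdryE; apply.
have mA n : measurable (A n) by case: (iA n).
have iU := gens_invariant_bigcup ms iA; have [mU _] := iU.
have iT : gens_invariant_set mu s setT.
  split => // i.
  by rewrite (_ : bdry _ _ = set0) ?pr0 // -subset0 => x /bdryE; apply.
pose L := setT `\` \bigcup_n A n.
have iL : gens_invariant_set mu s L := gens_invariant_setD ms iT iU.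
have [mL _] := iL.
have L0 : pr mu L = 0.
  apply/eqP; rewrite eq_le pr_ge0 andbT leNgt; apply/negP => pL.
  have /(diffuse_fine ms iL)[F [K [FK mF atoms cF]]] : forall B, B `<=` L -> ~ gens_ergodic_piece mu s B.
    move=> B BL PB; have [_ B0 _] := PB.
    suff h : pr mu B = 0 by rewrite h ltxx in B0.
    by apply: maxA => //; rewrite -subset0 => x [/BL[]].
  apply: (no_fine_restr mL pL); exists F, K; split => // j.
  apply: cv0_le (cF j) => n.
  have mneq (f : T -> T) : measurable_fun setT f -> measurable (L `&` [set x | F n (f x) <> F n x]).
    by move=> mf; apply: measurableI => //; exact: (@measurable_label_neq _ _ (F n) f id).
  apply: le_pr.
  - by apply: mneq; exact: gen_meas (generators_restr bS GS mL) j.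
  - exact: mneq.
  - by move=> x [Lx] /=; rewrite /restr_gens; case: asboolP.
exists [set n | gens_ergodic_piece mu s (A n)], A; split.
- by move=> n _; apply/(gens_invariant mdiag measurableT GS sn) => //; case: (iA n).
- by move=> n [_ h _]; rewrite prE // lte_fin.
- move=> i j _ _ ij; rewrite (_ : A i `&` A j = set0) ?measure0 //.
  by move/trivIsetP : dis; apply => //; exact/eqP.
- rewrite (_ : setT `\` _ = L); first by rewrite prE // L0.
  apply/seteqP; split => x [_ h]; split => // -[n Pn Ax]; apply: h; last by exists n.
  exists n => //=; case: (PA n) => // A0; by rewrite A0 in Ax.
- move=> n [_ An0 ergA] B hB.
  have nz : pr mu (A n) != 0 by rewrite gt_eqF.
  have [mB BA _] := hB.
  have GA := generators_restr bS GS (mA n).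
  have {}hB := (gens_invariant mdiag (mA n) GA (same_null_restr (mA n) nz) mB BA).1 hB.
  have iB : gens_invariant_set mu s B.
    split => // i.
    have m1 := measurable_bdry (ms i) (mA n).
    have m2 := measurable_bdry (gen_meas GA i) mB.
    apply: (@pr_sub0 _ _ _ mu _ (bdry (s i) (A n) `|`
      bdry (restr_gens s (restr_rel relS (A n)) i) B)).
    + exact: measurable_bdry.
    + exact: measurableU.
    + move=> x /bdryE hx; apply: contrapT => /not_orP[h1 h2]; apply: hx.
      have {}h1 : A n x <-> A n (s i x) by apply: contrapT => k; apply: h1; apply/bdryE.
      have {}h2 : B x <-> B (restr_gens s (restr_rel relS (A n)) i x).
        by apply: contrapT => k; apply: h2; apply/bdryE.
      have [Ax|nAx] := pselect (A n x).
        by rewrite restr_gens_inside // in h2; exact/h1.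
      by split=> [/BA//|/BA/h1].
    + apply/eqP; rewrite eq_le pr_ge0 andbT; apply: le_trans (pr_setU_le _ m1 m2) _.
      by have [_ ->] := iA n; rewrite hB addr0.
  rewrite normalized_restrE // (setIidr BA).
  by case: (ergA B iB BA) => ->; [left|right]; rewrite ?mul0r ?divff.
Qed.

End subrelation.

Local Close Scope ring_scope.

Theorem corollary1p3 (R : realType) (d : measure_display)
  (T : measurableType d) (mu : probability T R) (relS relR : set (T * T))
  (hT : standard_borel R T)
  (hS : discrete_pmp_equivalence [set: T] mu relS)
  (hR : discrete_pmp_equivalence [set: T] mu relR)
  (hSR : relS `<=` relR)
  (hcoam : everywhere_coamenable [set: T] mu relS relR)
  (hserg : strongly_ergodic [set: T] mu relR) :
  countable_ergodic_decomposition [set: T] mu relS /\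
  (forall F : set T, ergodic_component [set: T] mu relS F ->
     strongly_ergodic F (normalized_restr mu F) (restr_rel relS F)).
Proof.
have [bS _ _] := hS; have [bR _ _] := hR.
have [t0 _] : [set: T] !=set0.
  apply/set0P/eqP => T0; have := probability_setT mu.
  by rewrite T0 measure0 => /esym/eqP; rewrite onee_eq0.
have [cv [b pb]] := standard_polish_base t0 hT.
have mdiag := measurable_diagonal pb.
have [g GR] := feldman_moore hT hR.
have [s GS] := feldman_moore hT hS.
split; first exact: (ergodic_pieces mdiag bS bR GR GS hSR hcoam hserg).
exact: (component_strongly_ergodic mdiag bS bR GR GS hSR hcoam hserg).
Qed.
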